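(* Work in the spatial semi-functional linear model described in the context, with its notation. Let $(\Lambda_{\mathbf n},\Lambda)$ be any one of the pairs $(\Gamma_{\mathbf n},\Gamma)$, $(\Gamma'_{\mathbf n},\Gamma')$, $(\Gamma'^{*}_{\mathbf n},\Gamma'^{*})$, $(\Gamma''_{\mathbf n},\Gamma'')$, $(\Delta_{\mathbf n},\Delta)$, $(\Delta'_{\mathbf n},\Delta')$. Let $(v_j)_{j\ge1}$ (resp. $(v_j^\star)_{j\ge 1}$) be a complete orthonormal system in $H$ (resp. $G$), and let $(\lambda_j)_{j\ge1}$ be the sequence of characteristic numbers of $\Lambda$ (the square roots of the eigenvalues of $\Lambda^*\Lambda$), with $\lambda_j=O(u^j)$, $j\ge1$, for some $0<u<1$. Assume: (1) $\mathrm{Ker}(\Gamma)=\mathrm{Ker}(\Gamma'')=\{0\}$; (2) $(\phi,\gamma)\notin\{(f,g)\in H\times G: f+D^*g=0\}$, where $D^*$ is the adjoint of the ordinary differential operator $D:H\to G$, $Dx=x'$; (3) $\|\Gamma^{-1/2}\phi\|_H<+\infty$ and $\|(\Gamma'')^{-1/2}\gamma\|_G<+\infty$; (4) the process $\{Z_{\mathbf i}=(X_{\mathbf i},Y_{\mathbf i},X'_{\mathbf i}),\ \mathbf i\in\mathbb Z^d\}$ is $\alpha$-mixing, i.e. $\lim_{m\to+\infty}\alpha_{1,\infty}(m)=0$, and moreover $\alpha_{1,\infty}(t)=O(t^{-\theta})$ with $\theta>2d$; (5) $\|X_{\mathbf i}\|_H\le C$ a.s. for some positive constant $C$. Then, for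 all $\tau>0$, as $\mathbf n\to+\infty$, $$\mathbb P\left(\|\Lambda_{\mathbf n}-\Lambda\|_\infty>\tau\right)=O\left(\frac{\log\widehat{\mathbf n}}{\widehat{\mathbf n}}\right),$$ and $$\|\Lambda_{\mathbf n}-\Lambda\|_{L^2(\mathcal{HS})}=O\left(\frac{\log\widehat{\mathbf n}}{\sqrt{\widehat{\mathbf n}}}\right).$$
   Context: Spaces: $G=L^2[0,1]$ with $\langle f,g\rangle_G=\int_0^1 f(t)g(t)\,dt$; $H=\{x\in G: x'\in G\}$ is the Sobolev space ($x'$ the first derivative) with $\langle f,g\rangle_H=\langle f,g\rangle_G+\langle f',g'\rangle_G$; $\|\cdot\|_H,\|\cdot\|_G$ are the induced norms. Model: $d\ge2$; for $\mathbf n=(n_1,\dots,n_d)$, $\mathcal I_{\mathbf n}=\{\mathbf i=(i_1,\dots,i_d)\in\mathbb Z^d:1\le i_k\le n_k,\ k=1,\dots,d\}$. For $\mathbf i\in\mathcal I_{\mathbf n}$, $$Y_{\mathbf i}=\langle\phi,X_{\mathbf i}\rangle_H+\langle\gamma,X'_{\mathbf i}\rangle_G+r\left(\frac{i_1}{n_1+1},\dots,\frac{i_d}{n_d+1}\right)+\epsilon_{\mathbf i},$$ where $\phi\in H$, $\gamma\in G$, $r$ is a real function on $[0,1]^d$, $X_{\mathbf i}$ is an $H$-valued random function with derivative $X'_{\mathbf i}$; $X_{\mathbf i}$ and $X'_{\mathbf i}$ are centered and independent of the noise $\epsilon_{\mathbf i}$, which is also centered. The errors are spatially correlated with $\mathrm{Cov}(\epsilon_{\mathbf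 i},\epsilon_{\mathbf j})=\sigma^2\exp(-a\|\mathbf i-\mathbf j\|)$ for $\mathbf i,\mathbf j\in\mathcal I_{\mathbf n}$, with known constants $a,\sigma^2>0$. Each triplet $(X_{\mathbf i},Y_{\mathbf i},X'_{\mathbf i})$ has the same distribution as $(X,Y,X')$. Asymptotics: $\widehat{\mathbf n}=\prod_{k=1}^d n_k$; $\mathbf n\to+\infty$ means $\min_{1\le k\le d}n_k\to+\infty$, and it is assumed that $n_j/n_k\le C$ for all $1\le j,k\le d$, for some $0<C<+\infty$. Operators: $(u\otimes_H v)(h)=\langle u,h\rangle_H v$ and $(u\otimes_G v)(h)=\langle u,h\rangle_G v$. $\Gamma=\mathbb E(X\otimes_H X)$, $\Gamma'=\mathbb E(X'\otimes_G X)$, $\Gamma'^{*}$ is the adjoint of $\Gamma'$, $\Gamma''=\mathbb E(X'\otimes_G X')$, $\Delta=\mathbb E(YX)$, $\Delta'=\mathbb E(YX')$. With $\mathcal I^1_{\mathbf n}=\prod_{k=1}^d\{2,\dots,n_k\}$, the empirical versions are $\Gamma_{\mathbf n}=\frac1{\widehat{\mathbf n}}\sum_{\mathbf i\in\mathcal I_{\mathbf n}}X_{\mathbf i}\otimes_H X_{\mathbf i}$, $\Gamma'_{\mathbf n}=\frac1{\widehat{\mathbf n}}\sum_{\mathbf i\in\mathcal I_{\mathbf n}}X'_{\mathbf i}\otimes_G X_{\mathbf i}$, $\Gamma'^{*}_{\mathbf n}=\frac1{\widehat{\mathbf n}}\sum_{\mathbf i\in\mathcal I_{\mathbf n}}X_{\mathbf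 i}\otimes_H X'_{\mathbf i}$, $\Gamma''_{\mathbf n}=\frac1{\widehat{\mathbf n}}\sum_{\mathbf i\in\mathcal I_{\mathbf n}}X'_{\mathbf i}\otimes_G X'_{\mathbf i}$, $\Delta_{\mathbf n}=\frac1{\prod_{k=1}^d(n_k-1)}\sum_{\mathbf i\in\mathcal I^1_{\mathbf n}}Y_{\mathbf i}X_{\mathbf i}$, $\Delta'_{\mathbf n}=\frac1{\prod_{k=1}^d(n_k-1)}\sum_{\mathbf i\in\mathcal I^1_{\mathbf n}}Y_{\mathbf i}X'_{\mathbf i}$. Mixing coefficient: $\alpha_{1,\infty}(m)=\sup\{|\mathbb P(A\cap B)-\mathbb P(A)\mathbb P(B)|: A\in\sigma(Z_{\mathbf i}),\ B\in\sigma(Z_{\mathbf j};\mathbf j\in E)\}$, the supremum being also over all $\mathbf i\in\mathbb Z^d$ and $E\subset\mathbb Z^d$ with $\rho(E,\{\mathbf i\})\ge m$, where $\rho(E_1,E_2)=\min\{\|\mathbf i-\mathbf j\|:\mathbf i\in E_1,\mathbf j\in E_2\}$ and $\|\mathbf i-\mathbf j\|=\max_{1\le s\le d}|i_s-j_s|$. Norms: $\|R\|_\infty=\sup_{x\neq0}\|Rx\|/\|x\|$ is the operator norm (with the Hilbert norms of the spaces between which $R$ acts). $\mathcal{HS}$ is the space of Hilbert–Schmidt operators, with $\langle R,T\rangle_{\mathcal{HS}}=\sum_i\langle R(w_i),T(w_i)\rangle$ for an orthonormal basis $(w_i)$ of the domain, and $\|R\|_{L^2(\mathcal{HS})}=\{\mathbb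 E(\|R\|^2_{\mathcal{HS}})\}^{1/2}$. The vectors $\Delta,\Delta_{\mathbf n}\in H$ and $\Delta',\Delta'_{\mathbf n}\in G$ are identified with operators of rank at most one from $\mathbb R$ to $H$, resp. $G$, so for them both $\|\cdot\|_\infty$ and $\|\cdot\|_{\mathcal{HS}}$ are the norm of $H$, resp. $G$. *)

(* Defs.v *)
From HB Require Import structures.
From mathcomp Require Import all_boot all_order all_algebra.
From mathcomp Require Import all_classical all_reals all_analysis.
From mathcomp Require Import measurable_realfun.
Set Implicit Arguments. Unset Strict Implicit. Unset Printing Implicit Defensive.
Import Order.TTheory GRing.Theory Num.Theory.
Import numFieldNormedType.Exports.
Local Open Scope classical_set_scope.
Local Open Scope ring_scope.

HB.mixin Record isInnerProduct (R : realType) V of GRing.Lmodule R V := {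
  dot : V -> V -> R;
  dotC : forall x y, dot x y = dot y x;
  dotPl : forall a x y z, dot (a *: x + y) z = a * dot x z + dot y z;
  dot_ge0 : forall x, 0 <= dot x x;
  dot_eq0 : forall x, dot x x = 0 -> x = 0
}.
#[short(type="ipType")]
HB.structure Definition InnerProduct (R : realType) :=
  {V of isInnerProduct R V & GRing.Lmodule R V}.

Section regular.
Variable R : realType.

Let mulrP (a x y z : R^o) : (a *: x + y) * z = a * (x * z) + y * z.
Proof. by rewrite mulrDl -mulrA. Qed.
Let mulr_ge0' (x : R^o) : (0 : R) <= x * x.
Proof. by rewrite -expr2 sqr_ge0. Qed.
Let mulr_eq0' (x : R^o) : x * x = (0 : R) -> x = 0.
Proof. by move/eqP; rewrite mulf_eq0 orbb => /eqP. Qed.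

HB.instance Definition _ := isInnerProduct.Build R R^o
  (@mulrC R) mulrP mulr_ge0' mulr_eq0'.
End regular.

(* L^2(mu): square-integrable functions modulo equality almost everywhere.
   (The library's [LspaceType] carries no vector space structure.) *)
Section L2.
Local Open Scope quotient_scope.
Context d (T : measurableType d) (R : realType) (mu : {measure set T -> \bar R}).
Let E := LfunType mu (lee1n 2 : (1 <= 2%:R%:E :> \bar R)%E).

Definition ae_null : {pred E} := mem [set f : E | {ae mu, forall t, f t = 0}].

Lemma ae_nullP (f : E) : reflect {ae mu, forall t, f t = 0} (f \in ae_null).
Proof. by apply: (iffP idP) => [/set_mem|/mem_set]. Qed.

Lemma ae_null_submod_closed : submod_closed ae_null.
Proof.
split; first by apply/ae_nullP; apply: aeW.
move=> a f g /ae_nullP f0 /ae_nullP g0; apply/ae_nullP.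
apply: filterS2 f0 g0 => t ft gt; rewrite -[LHS]/(a * f t + g t) ft gt.
by rewrite mulr0 addr0.
Qed.

HB.instance Definition _ :=
  GRing.isSubmodClosed.Build R E ae_null ae_null_submod_closed.

Definition L2 : Type := Quotient.quot ae_null.
HB.instance Definition _ := GRing.Zmodule.on L2.
HB.instance Definition _ := isPointed.Build L2 0.

Definition L2_class (f : E) : L2 := \pi_(Quotient.quot ae_null) f.
Definition L2_repr (x : L2) : T -> R := (repr (x : Quotient.quot ae_null) : E).

Let eqP2 (f g : E) : L2_class f = L2_class g <-> {ae mu, forall t, f t = g t}.
Proof.
split=> [/eqP|fg]; last first.
  apply/eqP; rewrite /L2_class -Quotient.idealrBE; apply/ae_nullP.
  by apply: filterS fg => t ft; rewrite -[LHS]/(f t - g t) ft subrr.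
rewrite /L2_class -Quotient.idealrBE => /ae_nullP.
by apply: filterS => t /eqP; rewrite -[X in X == _]/(f t - g t) subr_eq0 => /eqP.
Qed.

Lemma L2_reprK (f : E) : {ae mu, forall t, L2_repr (L2_class f) t = f t}.
Proof. by apply/eqP2; rewrite /L2_class reprK. Qed.

Let reprK' (x : L2) : L2_class (repr (x : Quotient.quot ae_null)) = x.
Proof. by rewrite /L2_class reprK. Qed.

Definition L2_scale (a : R) (x : L2) : L2 :=
  L2_class (a *: repr (x : Quotient.quot ae_null)).

Let classD (f g : E) : L2_class f + L2_class g = L2_class (f + g).
Proof. by rewrite /L2_class; symmetry; exact: Quotient.pi_add. Qed.

Let classZ a (f : E) : L2_scale a (L2_class f) = L2_class (a *: f).
Proof.
apply/eqP2; apply: filterS (L2_reprK f) => t.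
by move=> ft; rewrite -[LHS]/(a * L2_repr (L2_class f) t) ft.
Qed.

Let scaleA a b x : L2_scale a (L2_scale b x) = L2_scale (a * b) x.
Proof. by rewrite -(reprK' x) !classZ scalerA. Qed.
Let scale1 : left_id 1 L2_scale.
Proof. by move=> x; rewrite -(reprK' x) !classZ scale1r. Qed.
Let scaleDr : right_distributive L2_scale +%R.
Proof.
by move=> a x y; rewrite -(reprK' x) -(reprK' y) !(classD, classZ) scalerDr.
Qed.
Let scaleDl x : {morph L2_scale^~ x : a b / a + b}.
Proof. by move=> a b; rewrite -(reprK' x) !(classD, classZ) scalerDl. Qed.

HB.instance Definition _ := GRing.Zmodule_isLmodule.Build R L2
  scaleA scale1 scaleDr scaleDl.

Lemma L2_reprP a (x y : L2) :
  {ae mu, forall t, L2_repr (a *: x + y) t = a * L2_repr x t + L2_repr y t}.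
Proof.
have -> : a *: x + y = L2_class (a *: repr (x : Quotient.quot ae_null) +
    repr (y : Quotient.quot ae_null)).
  by rewrite -classD -classZ !reprK'.
exact: L2_reprK.
Qed.

Lemma L2_repr_Lfun (x : L2) : L2_repr x \in Lfun mu 2%:E.
Proof. exact: LfunP. Qed.

Lemma L2_measurable (x : L2) : measurable_fun setT (L2_repr x).
Proof. by have := L2_repr_Lfun x; rewrite inE => /andP[/[!inE]]. Qed.

Definition L2_dot (x y : L2) : R := \int[mu]_t (L2_repr x t * L2_repr y t).

Lemma L2_mul_integrable (x y : L2) :
  mu.-integrable setT (EFin \o (fun t => L2_repr x t * L2_repr y t)).
Proof. exact/Lfun1_integrable/Lfun2_mul_Lfun1/L2_repr_Lfun/L2_repr_Lfun. Qed.

Let dotC2 x y : L2_dot x y = L2_dot y x.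
Proof. by apply: eq_Rintegral => t _; rewrite mulrC. Qed.

Let dotP2 a x y z : L2_dot (a *: x + y) z = a * L2_dot x z + L2_dot y z.
Proof.
rewrite /L2_dot -RintegralZl//; last exact: L2_mul_integrable.
rewrite -RintegralD//=; last 2 first.
- by have /(integrableZl measurableT a) := L2_mul_integrable x z.
- exact: L2_mul_integrable.
congr fine; apply: ae_eq_integral => //.
- by apply/measurable_EFinP; apply: measurable_funM; exact: L2_measurable.
- apply/measurable_EFinP; apply: measurable_funD.
    apply: measurable_funM => //.
    by apply: measurable_funM; exact: L2_measurable.
  by apply: measurable_funM; exact: L2_measurable.
- apply: filterS (L2_reprP a x y) => t /= -> _; congr EFin.
  by rewrite mulrDl mulrA.
Qed.

Let dot02 x : 0 <= L2_dot x x.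
Proof. by apply: Rintegral_ge0 => t _; rewrite -expr2 sqr_ge0. Qed.

Let dotx2 x : L2_dot x x = 0 -> x = 0.
Proof.
move=> xx0.
have ix := L2_mul_integrable x x.
have : (\int[mu]_t `|(L2_repr x t * L2_repr x t)%:E| = 0)%E.
  under eq_integral do rewrite gee0_abs ?lee_fin -?expr2 ?sqr_ge0// expr2.
  rewrite -[LHS]fineK ?integrable_fin_num//; congr EFin.
  by rewrite -[RHS]xx0; congr fine; apply: eq_integral => t _; rewrite /= expr2.
move/(ae_eq_integral_abs mu measurableT).
move=> /(_ (measurable_int _ ix)) x0.
rewrite -(reprK' x); have -> : 0 = L2_class 0.
  by rewrite /L2_class; unlock; rewrite -[LHS]/(Quotient.zero _);
    unlock Quotient.zero.
apply/eqP2; apply: filterS x0 => t /(_ I) [] /eqP.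
by rewrite mulf_eq0 orbb => /eqP.
Qed.

HB.instance Definition _ := isInnerProduct.Build R L2 dotC2 dotP2 dot02 dotx2.
End L2.

Section sobolev.
Context (R : realType).

Definition lebesgue01 : set (measurableTypeR R) -> \bar R :=
  mrestr lebesgue_measure (measurable_itv `[0%R, 1%R]).
HB.instance Definition _ := Measure.on lebesgue01.

Let mu : {measure set (measurableTypeR R) -> \bar R} := lebesgue01.
Definition L2_01 := L2 mu.

(* C^1 functions with compact support in the open interval ]0, 1[ *)
Definition test_fun (psi : R -> R) := [/\ forall t, derivable psi t 1,
  continuous (derive1 psi) & exists a b : R, [/\ 0 < a, b < 1 &
    forall t, ~~ (a <= t <= b) -> psi t = 0]].

Definition weak_deriv (x y : L2_01) := forall psi, test_fun psi ->
  \int[mu]_t (L2_repr x t * (derive1 psi) t) = - \int[mu]_t (L2_repr y t * psi t).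

Let int_mul (x : L2_01) (psi : R -> R) : continuous psi ->
  mu.-integrable setT (EFin \o (fun t => L2_repr x t * psi t)).
Proof.
move=> cpsi.
have mpsi : measurable_fun setT psi by exact: continuous_measurable_fun.
have m01 : measurable (`[0%R, 1%R] : set (measurableTypeR R)) by exact: measurable_itv.
apply/(@negligible_integrable _ _ _ mu _ (~` `[0, 1]%classic)) => //.
- exact: measurableC.
- by apply/measurable_EFinP; apply: measurable_funM => //; exact: L2_measurable.
- by rewrite /mu/= /lebesgue01 /mrestr setICl measure0.
rewrite setTD setCK.
apply: (@integrableMl _ _ _ mu `[0, 1]%classic m01 (EFin \o L2_repr x) psi).
- apply: integrableS (measurableT) _ _ _ => //.
  apply/Lfun1_integrable; apply: Lfun_subset12 (L2_repr_Lfun x).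
  by rewrite /mu/= /lebesgue01 /mrestr setTI lebesgue_measure_itv/= lte01.
- exact: measurable_funS mpsi.
- have /compact_bounded[M [Mr HM]] : compact (psi @` `[0, 1]%classic).
    apply: continuous_compact (@segment_compact _ _ _).
    exact: continuous_subspaceT.
  by exists M; split=> // r Mx t t01; apply: (HM r Mx); exists t.
Qed.

Let test_cont psi : test_fun psi -> continuous psi.
Proof.
by move=> [dpsi _ _] t; apply/differentiable_continuous/derivable1_diffP/dpsi.
Qed.

Definition sobolev : {pred L2_01 * L2_01} :=
  mem [set p : L2_01 * L2_01 | weak_deriv p.1 p.2].

Let int_lin a (x z : L2_01) psi : continuous psi ->
  \int[mu]_t (L2_repr (a *: x + z) t * psi t) =
  a * \int[mu]_t (L2_repr x t * psi t) + \int[mu]_t (L2_repr z t * psi t).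
Proof.
move=> cpsi; have mpsi : measurable_fun setT psi.
  exact: continuous_measurable_fun.
rewrite -RintegralZl//; last exact: int_mul.
rewrite -RintegralD//=; last 2 first.
- by have /(integrableZl measurableT a) := int_mul x cpsi.
- exact: int_mul.
congr fine; apply: ae_eq_integral => //.
- by apply/measurable_EFinP; apply: measurable_funM.
- apply/measurable_EFinP; apply: measurable_funD; last exact: measurable_funM.
  by apply: measurable_funM => //; exact: measurable_funM.
- apply: filterS (L2_reprP a x z) => t /= -> _; congr EFin.
  by rewrite mulrDl mulrA.
Qed.

Lemma sobolev_submod_closed : submod_closed sobolev.
Proof.
split=> [|a p q]; rewrite !inE/=.
  move=> psi tpsi; have [_ cpsi' _] := tpsi.
  have := int_lin (-1) 0 0 cpsi'; have := int_lin (-1) 0 0 (test_cont tpsi).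
  by rewrite scaler0 addr0 !mulN1r !addNr => -> ->; rewrite oppr0.
move=> wp wq psi tpsi; have [_ cpsi' _] := tpsi.
rewrite int_lin// [in RHS]int_lin//; last exact: test_cont.
by rewrite wp// wq// opprD mulrN.
Qed.
HB.instance Definition _ := GRing.isSubmodClosed.Build R (L2_01 * L2_01)%type
  sobolev sobolev_submod_closed.

(* An element of the Sobolev space H is stored as the pair (x, x') of an L^2
   class and its weak derivative.  The weak derivative being unique, this is
   the same vector space as {x in G | x' in G}, and D is the second projection. *)
Record H1_01 := MkH1 { H1_pair :> L2_01 * L2_01; _ : H1_pair \in sobolev }.
HB.instance Definition _ := [isSub for H1_pair].
HB.instance Definition _ := [Choice of H1_01 by <:].
HB.instance Definition _ := [SubChoice_isSubLmodule of H1_01 by <:].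
HB.instance Definition _ := isPointed.Build H1_01 0.

Definition H1_deriv (x : H1_01) : L2_01 := x.2.

Definition H1_dot (x y : H1_01) : R := dot x.1 y.1 + dot (H1_deriv x) (H1_deriv y).

Let H1_dotC x y : H1_dot x y = H1_dot y x.
Proof. by rewrite /H1_dot dotC; congr (_ + _); rewrite dotC. Qed.
Let H1_dotP a x y z : H1_dot (a *: x + y) z = a * H1_dot x z + H1_dot y z.
Proof. by rewrite /H1_dot/= !dotPl mulrDr addrACA. Qed.
Let H1_dot_ge0 x : 0 <= H1_dot x x.
Proof. by rewrite addr_ge0// dot_ge0. Qed.
Let H1_dot_eq0 x : H1_dot x x = 0 -> x = 0.
Proof.
move=> /eqP; rewrite paddr_eq0 ?dot_ge0//.
move=> /andP[/eqP/dot_eq0 x1 /eqP/dot_eq0 x2].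
by apply/val_inj; rewrite [val x]surjective_pairing x1 -/(H1_deriv x) x2.
Qed.
HB.instance Definition _ := isInnerProduct.Build R H1_01
  H1_dotC H1_dotP H1_dot_ge0 H1_dot_eq0.

End sobolev.

Section operators.
Context (R : realType).
Implicit Types U V : ipType R.

Definition ipnorm V (x : V) : R := Num.sqrt (dot x x).

Definition ip_open V : set (set V) := [set A | forall x, A x ->
  exists2 e : R, 0 < e & forall y, ipnorm (y - x) < e -> A y].

(* complete orthonormal system: every x is the sum of its Fourier series *)
Definition complete_orthonormal V (w : nat -> V) : Prop :=
  (forall i j, dot (w i) (w j) = (i == j)%:R) /\
  forall x, ipnorm (x - \sum_(j < n) dot x (w j) *: w j) @[n --> \oo] --> 0.

Definition tensor U V (u : U) (v : V) (h : U) : V := dot u h *: v.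

Definition is_adjoint U V (A : U -> V) (B : V -> U) : Prop :=
  forall x y, dot (A x) y = dot x (B y).

Definition opnorm U V (A : U -> V) : \bar R :=
  ereal_sup [set (ipnorm (A x) / ipnorm x)%:E | x in [set x | x != 0]].

Definition hsnorm U V (w : nat -> U) (A : U -> V) : \bar R :=
  sqrte (\sum_(0 <= i <oo) (dot (A (w i)) (A (w i)))%:E)%E.

(* [lam] lists, in nonincreasing order and with multiplicities, the square roots
   of the nonzero eigenvalues of A^* A; if there are only finitely many of them,
   the list is continued by 0.  The e_j with lam j != 0 are corresponding
   orthonormal eigenvectors, and no eigenvector is left over. *)
Definition characteristic_numbers U V (A : U -> V) (lam : nat -> R) : Prop :=
  exists (B : V -> U) (e : nat -> U), is_adjoint A B /\
  [/\ (forall j, 0 <= lam j) /\ (forall i j, (i <= j)%N -> lam j <= lam i),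
      forall i j, lam i != 0 -> lam j != 0 -> dot (e i) (e j) = (i == j)%:R,
      forall j, lam j != 0 -> B (A (e j)) = lam j ^+ 2 *: e j &
      forall (c : R) x, c != 0 -> B (A x) = c *: x ->
        (forall j, lam j != 0 -> dot x (e j) = 0) -> x = 0].

(* lambda_j = O(u^j), j >= 1; the j-th characteristic number is [lam j.-1] *)
Definition geometric_decay U V (A : U -> V) : Prop :=
  exists2 lam, characteristic_numbers A lam & exists u K : R,
    0 < u < 1 /\ forall j, lam j <= K * u ^+ j.+1.

Definition is_sqrt V (A S : V -> V) : Prop :=
  [/\ is_adjoint S S, forall x, 0 <= dot (S x) x & forall x, S (S x) = A x].

(* ||A^{-1/2} f|| in [0, +oo]; it is +oo when f is not in the range of A^{1/2} *)
Definition norm_inv_sqrt V (A : V -> V) (f : V) : \bar R :=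
  ereal_inf [set (ipnorm x)%:E | x in
    [set x | exists2 S, is_sqrt A S & S x = f]].

End operators.

Section borel.
Variable R : realType.
HB.instance Definition _ :=
  Measurable.copy (L2_01 R) (g_sigma_algebraType (@ip_open R (L2_01 R))).
HB.instance Definition _ :=
  Measurable.copy (H1_01 R) (g_sigma_algebraType (@ip_open R (H1_01 R))).

Definition triplet (x : H1_01 R) (y : R) : H1_01 R * R * L2_01 R :=
  (x, y, H1_deriv x).
End borel.

Section random_elements.
Context (dT : measure_display) (T : measurableType dT) (R : realType).
Variable P : probability T R.
Implicit Types U V : ipType R.

(* m = E(X) for a random element X of V, in the weak (Pettis) sense *)
Definition is_mean V (X : T -> V) (m : V) : Prop := forall h,
  P.-integrable setT (fun t => (dot (X t) h)%:E) /\
  ('E_P[fun t => dot (X t) h] = (dot m h)%:E)%E.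

Definition is_op_mean U V (A : T -> U -> V) (L : U -> V) : Prop :=
  forall h, is_mean (A ^~ h) (L h).

Definition indep_sigma (F G : set (set T)) : Prop :=
  forall A B, F A -> G B -> P (A `&` B) = (P A * P B)%E.

Definition same_distribution d' (S : measurableType d') (Z1 Z2 : T -> S) : Prop :=
  forall A, measurable A -> P (Z1 @^-1` A) = P (Z2 @^-1` A).

Definition sigma_family (I : Type) d' (S : measurableType d') (Z : I -> T -> S)
    (E : set I) : set (set T) :=
  <<s \bigcup_(i in E) g_sigma_algebra_preimage (Z i) >>.

End random_elements.

Section lattice.
Variable d : nat.

Definition site := {ffun 'I_d -> int}.
HB.instance Definition _ := Choice.on site.

Definition site_dist (i j : site) : nat := \max_(k < d) `|i k - j k|%N.

(* [grid 1 n] is I_n and [grid 2 n] is I_n^1 *)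
Definition grid (l : int) (n : 'I_d -> nat) : set site :=
  [set i | forall k, l <= i k <= (n k)%:Z].

Lemma finite_grid l n : 0 <= l -> finite_set (grid l n).
Proof.
move=> l0; pose N := \max_(k < d) n k.
apply: (@sub_finite_set _ _ ((fun s : {ffun 'I_d -> 'I_N.+1} =>
  [ffun k => (s k)%:Z] : site) @` setT)); last first.
  exact/finite_image/finite_finset.
move=> i Ii; exists [ffun k => inord `|i k|%N] => //; apply/ffunP => k.
have /andP[ik0 ikn] := Ii k; rewrite !ffunE inordK.
  by rewrite gez0_abs// (le_trans l0).
rewrite ltnS -lez_nat gez0_abs ?(le_trans l0)// (le_trans ikn)// lez_nat.
exact: leq_bigmax.
Qed.

Definition vol (n : 'I_d -> nat) : nat := \prod_(k < d) n k.
Definition vol1 (n : 'I_d -> nat) : nat := \prod_(k < d) (n k - 1).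

Context (R : realType).

Definition avg (V : ipType R) (n : 'I_d -> nat) (F : site -> V) : V :=
  (vol n)%:R^-1 *: \sum_(i \in grid 1 n) F i.
Definition avg1 (V : ipType R) (n : 'I_d -> nat) (F : site -> V) : V :=
  (vol1 n)%:R^-1 *: \sum_(i \in grid 2 n) F i.

Definition admissible (C : R) (n : 'I_d -> nat) : Prop :=
  (forall k, (0 < n k)%N) /\ forall j k, (n j)%:R / (n k)%:R <= C.

(* f n = O(g n) as min_k n_k -> +oo, along admissible n *)
Definition bigO_field (C : R) (f : ('I_d -> nat) -> \bar R)
    (g : ('I_d -> nat) -> R) : Prop :=
  exists (K : R) (N : nat), forall n, admissible C n ->
    (forall k, (N <= n k)%N) -> (f n <= (K * g n)%:E)%E.

Context (dT : measure_display) (T : measurableType dT) (P : probability T R).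

Definition alpha_mix d' (S : measurableType d') (Z : site -> T -> S) (m : nat) :
    \bar R :=
  ereal_sup [set p : \bar R | exists (i : site) (E : set site) (A B : set T),
    [/\ forall j, E j -> (m <= site_dist i j)%N,
        g_sigma_algebra_preimage (Z i) A, sigma_family Z E B &
        p = `|P (A `&` B) - P A * P B|%E]].

(* rates for the distances [nop n t] (operator norm) and [nhs n t]
   (Hilbert-Schmidt norm) between an estimator and its target *)
Definition rates (C : R) (nop nhs : ('I_d -> nat) -> T -> \bar R) : Prop :=
  (forall tau : R, 0 < tau ->
     bigO_field C (fun n => P [set t | (tau%:E < nop n t)%E])
       (fun n => ln (vol n)%:R / (vol n)%:R)) /\
  bigO_field C (fun n => 'N[P]_2%:E[nhs n]%E)
    (fun n => ln (vol n)%:R / Num.sqrt (vol n)%:R).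

Definition op_rates (C : R) (U V : ipType R) (w : nat -> U)
    (An : ('I_d -> nat) -> T -> U -> V) (A : U -> V) : Prop :=
  rates C (fun n t => opnorm (fun x => An n t x - A x))
          (fun n t => hsnorm w (fun x => An n t x - A x)).

Definition vec_rates (C : R) (V : ipType R)
    (xn : ('I_d -> nat) -> T -> V) (x : V) : Prop :=
  rates C (fun n t => (ipnorm (xn n t - x))%:E)
          (fun n t => (ipnorm (xn n t - x))%:E).

End lattice.

(* Main.v *)
Require Import Defs.
From HB Require Import structures.
From mathcomp Require Import all_boot all_order all_algebra.
From mathcomp Require Import all_classical all_reals all_analysis.
From mathcomp Require Import measurable_realfun ring lra zify.
Set Implicit Arguments. Unset Strict Implicit. Unset Printing Implicit Defensive.
Import Order.TTheory GRing.Theory Num.Theory.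
Import numFieldNormedType.Exports.
Local Open Scope classical_set_scope.
Local Open Scope ring_scope.

(** All six estimators are averages, over the sites of a grid, of a function of
    the observation at the site, and both rates follow from one estimate: the expected
    square of the Hilbert-Schmidt distance between estimator and target is
    [O(1 / vol n)].  Markov's inequality then bounds the probability by
    [O(1 / vol n)] and the square root bounds the [L^2] norm by
    [O(1 / sqrt (vol n))] ([rates_of_second_moment]).

    In coordinates the squared distance is a sum over [k] of squares of centred
    averages of bounded real functions [f k (X i)], so its mean is [vol n ^ -2]
    times the sum, over pairs of sites [i], [j], of
    [\sum_k cov (f k (X i)) (f k (X j))].  Infinitely many coordinates take part,
    and applying the scalar covariance inequality to each of them would lose a
    factor equal to their number.  The main step is therefore a covariance
    inequality for vectors with a constant independent of the dimension
    ([hilbert_cov_mixing]): if [\sum_k f k ^ 2 <= A ^ 2] and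
    [\sum_k g k ^ 2 <= B ^ 2], the sum of the covariances is at most
    [32 * A * B * alpha].  It is proved like Grothendieck's inequality, by random
    signs, truncation and iteration.

    Since [theta > 2 * d], the mixing coefficient at distance [m] is dominated by
    a product over the [d] coordinates of [(1 + |i k - j k|) ^ -2] ([weight]), whose
    sum over [j] is at most [3 ^ d].  The double sum over sites is thus [O(vol n)]
    and the variance [O(1 / vol n)] ([avg_second_moment]).

    For the two vectors, [dot gamma (H1_deriv x) = dot x (Dstar gamma)] turns the
    model into [Y = dot X psi + c0 + eps]; the regression function contributes the
    constant [c0] because all the [Y i] have the same mean.  The part without
    noise is once more a bounded function of the regressor.  The products
    [eps i *: X i] have, by independence, the exponentially decaying covariances
    of the noise times bounded factors ([noise_second_moment]).

    The event that the operator norm exceeds [tau] is measurable because the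
    supremum may be taken over rational combinations of a complete orthonormal
    system ([opnorm_gt_rcomb]). *)

(** * Real-valued expectations and covariances *)

Section bounded_measurable.
Context (R : realType).

Definition bmeas d (S : measurableType d) (f : S -> R) : Prop :=
  measurable_fun setT f /\ exists M, forall x, `|f x| <= M.

Lemma bmeas_cst d (S : measurableType d) (c : R) : bmeas (fun _ : S => c).
Proof. by split=> //; exists `|c|. Qed.

Lemma bmeasD d (S : measurableType d) (f g : S -> R) :
  bmeas f -> bmeas g -> bmeas (fun x => f x + g x).
Proof.
move=> [mf [M fM]] [mg [N gN]]; split; first exact: measurable_funD.
by exists (M + N) => x; apply: (le_trans (ler_normD _ _)); apply: lerD.
Qed.

Lemma bmeasM d (S : measurableType d) (f g : S -> R) :
  bmeas f -> bmeas g -> bmeas (fun x => f x * g x).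
Proof.
move=> [mf [M fM]] [mg [N gN]]; split; first exact: measurable_funM.
by exists (M * N) => x; rewrite normrM ler_pM.
Qed.

Lemma bmeasZ d (S : measurableType d) (c : R) (f : S -> R) :
  bmeas f -> bmeas (fun x => c * f x).
Proof. by apply: bmeasM; exact: bmeas_cst. Qed.

Lemma bmeasN d (S : measurableType d) (f : S -> R) :
  bmeas f -> bmeas (fun x => - f x).
Proof.
by move=> [mf [M fM]]; split; [exact: measurable_funN|exists M => x; rewrite normrN].
Qed.

Lemma bmeasB d (S : measurableType d) (f g : S -> R) :
  bmeas f -> bmeas g -> bmeas (fun x => f x - g x).
Proof. by move=> bf bg; apply: bmeasD => //; apply: bmeasN. Qed.

Lemma bmeas_sum d (S : measurableType d) (I : Type) (r : seq I) (f : I -> S -> R) :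
  (forall i, bmeas (f i)) -> bmeas (fun x => \sum_(i <- r) f i x).
Proof.
move=> bf; elim: r => [|i r IH].
  by under eq_fun do rewrite big_nil; exact: bmeas_cst.
by under eq_fun do rewrite big_cons; exact: bmeasD.
Qed.

Lemma bmeas_comp d1 d2 (S1 : measurableType d1) (S2 : measurableType d2)
  (U : S1 -> S2) (f : S2 -> R) :
  measurable_fun setT U -> bmeas f -> bmeas (f \o U).
Proof.
move=> mU [mf [M fM]]; split; first exact: measurableT_comp.
by exists M => x; exact: fM.
Qed.

Lemma bmeas_indic d (S : measurableType d) (A : set S) :
  measurable A -> bmeas (\1_A : S -> R).
Proof.
move=> mA; split; first exact: measurable_indic.
by exists 1 => x; rewrite indicE; case: (_ \in _); rewrite ?normr1 ?normr0.
Qed.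

End bounded_measurable.
#[global] Hint Resolve bmeas_cst bmeasD bmeasM bmeasZ bmeasN bmeasB : bm.

Section expectation.
Context (dT : measure_display) (T : measurableType dT) (R : realType).
Variable P : probability T R.

Definition Ex (F : T -> R) : R := \int[P]_t F t.

Lemma bmeas_integrable F : bmeas F -> P.-integrable setT (EFin \o F).
Proof.
move=> [mF [M FM]]; apply: measurable_bounded_integrable => //.
  by rewrite [X in (X < _)%E]probability_setT ltry.
exists M; split; first exact: num_real.
by move=> r Mr x _; apply: le_trans (FM x) (ltW Mr).
Qed.

Lemma ExD F G : P.-integrable setT (EFin \o F) -> P.-integrable setT (EFin \o G) ->
  Ex (fun t => F t + G t) = Ex F + Ex G.
Proof. by move=> iF iG; rewrite /Ex RintegralD. Qed.

Lemma ExZ c F : P.-integrable setT (EFin \o F) -> Ex (fun t => c * F t) = c * Ex F.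
Proof. by move=> iF; rewrite /Ex RintegralZl. Qed.

Lemma Ex_cst c : Ex (fun=> c) = c.
Proof. by rewrite /Ex Rintegral_cst//= probability_setT mulr1. Qed.

Lemma Ex_subc F c : P.-integrable setT (EFin \o F) -> Ex (fun t => F t - c) = Ex F - c.
Proof.
by move=> iF; rewrite ExD ?Ex_cst//; apply: bmeas_integrable; exact: bmeas_cst.
Qed.

Lemma Ex_indic A : measurable A -> Ex \1_A = fine (P A).
Proof. by move=> mA; rewrite /Ex /Rintegral integral_indic// setIT. Qed.

Lemma integrable_sum (I : Type) (r : seq I) (F : I -> T -> R) :
  (forall i, P.-integrable setT (EFin \o F i)) ->
  P.-integrable setT (EFin \o (fun t => \sum_(i <- r) F i t)).
Proof.
move=> iF; have -> : EFin \o (fun t => \sum_(i <- r) F i t) =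
    (fun t => \sum_(i <- r) (EFin \o F i) t)%E.
  by apply/funext => t /=; rewrite sumEFin.
by apply: integrable_sum.
Qed.

Lemma Ex_sum (I : Type) (r : seq I) (F : I -> T -> R) :
  (forall i, P.-integrable setT (EFin \o F i)) ->
  Ex (fun t => \sum_(i <- r) F i t) = \sum_(i <- r) Ex (F i).
Proof.
move=> iF; elim: r => [|i r IH].
  by under [X in Ex X]eq_fun do rewrite big_nil; rewrite Ex_cst big_nil.
under [X in Ex X]eq_fun do rewrite big_cons.
by rewrite ExD ?big_cons ?IH//; exact: integrable_sum.
Qed.

Lemma le_Ex F G : P.-integrable setT (EFin \o F) -> P.-integrable setT (EFin \o G) ->
  (forall t, F t <= G t) -> Ex F <= Ex G.
Proof. by move=> iF iG FG; apply: le_Rintegral. Qed.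

Lemma Ex_ge0 F : (forall t, 0 <= F t) -> 0 <= Ex F.
Proof. by move=> F0; apply: Rintegral_ge0. Qed.

Lemma ae_eq_Ex F G : measurable_fun setT F -> measurable_fun setT G ->
  {ae P, forall t, F t = G t} -> Ex F = Ex G.
Proof.
move=> mF mG FG; congr fine; apply: ae_eq_integral => //.
- exact/measurable_EFinP.
- exact/measurable_EFinP.
- by apply: filterS FG => t /= ->.
Qed.

Lemma ae_eq_integrable F G : measurable_fun setT F -> P.-integrable setT (EFin \o G) ->
  {ae P, forall t, F t = G t} -> P.-integrable setT (EFin \o F).
Proof.
move=> mF /integrableP[mG iG] FG; apply/integrableP; split; first exact/measurable_EFinP.
rewrite (ae_eq_integral (fun t => `|(EFin \o G) t|)%E)//.
- by apply: measurableT_comp => //; exact/measurable_EFinP.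
- exact: measurableT_comp.
- by apply: filterS FG => t /= ->.
Qed.

Lemma Ex_norm F : P.-integrable setT (EFin \o F) -> `|Ex F| <= Ex (fun t => `|F t|).
Proof. by move=> iF; exact: le_normr_Rintegral. Qed.

Definition cov (F G : T -> R) : R := Ex (fun t => F t * G t) - Ex F * Ex G.

Lemma covC F G : cov F G = cov G F.
Proof.
by rewrite /cov [Ex G * _]mulrC; congr (Ex _ - _); apply/funext => t; rewrite mulrC.
Qed.

Lemma covDl F F' G : bmeas F -> bmeas F' -> bmeas G ->
  cov (fun t => F t + F' t) G = cov F G + cov F' G.
Proof.
move=> bF bF' bG; rewrite /cov; under [X in Ex X - _]eq_fun do rewrite mulrDl.
rewrite !ExD; [ring|..]; apply: bmeas_integrable; auto with bm.
Qed.

Lemma covZl c F G : bmeas F -> bmeas G -> cov (fun t => c * F t) G = c * cov F G.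
Proof.
move=> bF bG; rewrite /cov; under [X in Ex X - _]eq_fun do rewrite -mulrA.
rewrite !ExZ; [ring|..]; apply: bmeas_integrable; auto with bm.
Qed.

Lemma cov_cstl c G : bmeas G -> cov (fun=> c) G = 0.
Proof.
move=> bG; rewrite /cov Ex_cst ExZ ?subrr//; exact: bmeas_integrable.
Qed.

Lemma covDr F G G' : bmeas F -> bmeas G -> bmeas G' ->
  cov F (fun t => G t + G' t) = cov F G + cov F G'.
Proof. by move=> *; rewrite covC covDl// covC [cov G' _]covC. Qed.

Lemma covZr c F G : bmeas F -> bmeas G -> cov F (fun t => c * G t) = c * cov F G.
Proof. by move=> *; rewrite covC covZl// covC. Qed.

Lemma cov_suml (I : Type) (r : seq I) (F : I -> T -> R) G :
  (forall i, bmeas (F i)) -> bmeas G ->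
  cov (fun t => \sum_(i <- r) F i t) G = \sum_(i <- r) cov (F i) G.
Proof.
move=> bF bG; elim: r => [|i r IH].
  by under [X in cov X]eq_fun do rewrite big_nil; rewrite cov_cstl// big_nil.
under [X in cov X]eq_fun do rewrite big_cons.
by rewrite covDl// ?big_cons ?IH//; exact: bmeas_sum.
Qed.

Lemma cov_sumr (I : Type) (r : seq I) F (G : I -> T -> R) :
  bmeas F -> (forall i, bmeas (G i)) ->
  cov F (fun t => \sum_(i <- r) G i t) = \sum_(i <- r) cov F (G i).
Proof.
by move=> bF bG; rewrite covC cov_suml//; apply: eq_bigr => i _; rewrite covC.
Qed.

End expectation.

(** * Covariance inequality for mixing random variables *)

Section scalar_mixing.
Context (dT : measure_display) (T : measurableType dT) (R : realType).
Variable P : probability T R.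

(** The quantity bounded here is the one whose supremum is the mixing
    coefficient of the sigma-algebras generated by [U] and [V]. *)
Definition mixing_le d1 d2 (S1 : measurableType d1) (S2 : measurableType d2)
    (U : T -> S1) (V : T -> S2) (alpha : R) : Prop :=
  forall A B, measurable A -> measurable B ->
    `|fine (P (U @^-1` A `&` V @^-1` B)) -
      fine (P (U @^-1` A)) * fine (P (V @^-1` B))| <= alpha.

(** For [0 <= f <= 1] this is [floor (n.+1 * f) / n.+1], written as a mean of
    indicators because mixing speaks of events. *)
Definition levels d (S : measurableType d) (n : nat) (f : S -> R) (x : S) : R :=
  n.+1%:R^-1 * \sum_(k < n.+1) \1_[set x | k.+1%:R <= n.+1%:R * f x] x.

Lemma sum_levels n (y : R) : 0 <= y <= n%:R ->
  y - 1 <= \sum_(k < n) (k.+1%:R <= y)%R%:R <= y.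
Proof.
elim: n => [|n IH] /andP[y0 yn].
  by rewrite big_ord0 y0 andbT lerBlDr (le_trans yn)// add0r ler01.
rewrite big_ord_recr/=; have [yn1|ny] := leP y n%:R.
  have /andP[h1 h2] := IH (introT andP (conj y0 yn1)).
  have -> : (n.+1%:R <= y) = false.
    by apply/negbTE; rewrite -ltNge; apply: le_lt_trans yn1 _; rewrite ltr_nat.
  by rewrite addr0 h1.
have -> : \sum_(k < n) (k.+1%:R <= y)%R%:R = n%:R :> R.
  rewrite (eq_bigr (fun=> 1)) ?sumr_const ?card_ord// => k _.
  by rewrite (le_trans _ (ltW ny))// ler_nat.
have [h|h] := leP n.+1%:R y.
  have e : n%:R + true%:R = n.+1%:R :> R by exact: natr1.
  by rewrite e h andbT lerBlDr (le_trans yn)// lerDl.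
by rewrite addr0 (ltW ny) andbT lerBlDr natr1.
Qed.

Lemma levels_approx d (S : measurableType d) n (f : S -> R) x :
  0 <= f x <= 1 -> f x - n.+1%:R^-1 <= levels n f x <= f x.
Proof.
move=> /andP[f0 f1]; have n0 : 0 < n.+1%:R :> R by rewrite ltr0n.
have nf : 0 <= n.+1%:R * f x <= n.+1%:R.
  by rewrite mulr_ge0 ?(ltW n0)//= ler_piMr// ltW.
have /andP[] := sum_levels nf; rewrite /levels.
rewrite [X in _ -> _ -> is_true (_ <= _ * X <= _)](_ : _ =
   \sum_(k < n.+1) (k.+1%:R <= n.+1%:R * f x)%R%:R); last first.
  apply: eq_bigr => k _; rewrite indicE; congr (_%:R); congr nat_of_bool.
  by apply/idP/idP => [/set_mem|/mem_set].
move: (\sum_(k < _) _) => s h1 h2; apply/andP; split.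
  by rewrite mulrC ler_pdivlMr// mulrBl mulVf ?gt_eqF// mulrC.
by rewrite mulrC ler_pdivrMr// mulrC.
Qed.

Lemma levels_01 d (S : measurableType d) n (f : S -> R) x :
  0 <= f x <= 1 -> 0 <= levels n f x <= 1.
Proof.
move=> f01; have /andP[_ h] := levels_approx n f01; apply/andP; split.
  by rewrite mulr_ge0// sumr_ge0// => k _; rewrite indicE.
by apply: le_trans h _; case/andP: f01.
Qed.

Lemma measurable_level d (S : measurableType d) (f : S -> R) (a b : R) :
  measurable_fun setT f -> measurable [set x | a <= b * f x].
Proof.
move=> mf.
have mbf : measurable_fun setT (fun x => b * f x) by exact: measurable_funM.
have := mbf measurableT _ (measurable_itv `[a, +oo[); rewrite setTI.
by congr measurable; apply/seteqP; split=> x /=; rewrite in_itv/= andbT.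
Qed.

Lemma bmeas_levels d (S : measurableType d) n (f : S -> R) :
  measurable_fun setT f -> bmeas (levels n f).
Proof.
move=> mf; apply: bmeasZ; apply: bmeas_sum => k; apply: bmeas_indic.
exact: measurable_level.
Qed.

Lemma mul_approx01 (c a a' b b' : R) :
  0 <= a' <= 1 -> 0 <= b <= 1 -> 0 <= b' -> a - c <= a' <= a -> b - c <= b' <= b ->
  0 <= c -> a * b - 2 * c <= a' * b' <= a * b.
Proof.
move=> /andP[a'0 a'1] /andP[b0 b1] b'0 /andP[ha1 ha2] /andP[hb1 hb2] c0.
apply/andP; split; last exact: ler_pM.
have -> : a * b - 2 * c = a' * b' + ((a - a') * b + a' * (b - b') - 2 * c) by ring.
rewrite gerDl subr_le0 mulr_natl mulr2n; apply: lerD.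
  by rewrite -[leRHS]mulr1 ler_pM ?subr_ge0// lerBlDr addrC -lerBlDr.
by rewrite -[leRHS]mul1r ler_pM ?subr_ge0// lerBlDr addrC -lerBlDr.
Qed.

Context d1 d2 (S1 : measurableType d1) (S2 : measurableType d2).
Variables (U : T -> S1) (V : T -> S2) (alpha : R).
Hypotheses (mU : measurable_fun setT U) (mV : measurable_fun setT V).
Hypothesis UV : mixing_le U V alpha.

Lemma mixing_ge0 : 0 <= alpha.
Proof. exact: le_trans (normr_ge0 _) (UV measurableT measurableT). Qed.

Lemma cov_indic_mixing A B : measurable A -> measurable B ->
  `|cov P (\1_A \o U) (\1_B \o V)| <= alpha.
Proof.
move=> mA mB; have := UV mA mB.
have mUA : measurable (U @^-1` A) by rewrite -[X in measurable X]setTI; exact: mU.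
have mVB : measurable (V @^-1` B) by rewrite -[X in measurable X]setTI; exact: mV.
rewrite -!Ex_indic//; last exact: measurableI.
by rewrite indicI.
Qed.

Lemma cov_levels_mixing n m (f : S1 -> R) (g : S2 -> R) :
  measurable_fun setT f -> measurable_fun setT g ->
  `|cov P (levels n f \o U) (levels m g \o V)| <= alpha.
Proof.
move=> mf mg.
pose F (k : 'I_n.+1) : T -> R := \1_[set x | k.+1%:R <= n.+1%:R * f x] \o U.
pose G (k : 'I_m.+1) : T -> R := \1_[set x | k.+1%:R <= m.+1%:R * g x] \o V.
have bf k : bmeas (F k).
  by apply: bmeas_comp => //; apply: bmeas_indic; exact: measurable_level.
have bg k : bmeas (G k).
  by apply: bmeas_comp => //; apply: bmeas_indic; exact: measurable_level.
have bF : bmeas (fun t => \sum_k F k t) by exact: bmeas_sum.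
have bG : bmeas (fun t => \sum_k G k t) by exact: bmeas_sum.
rewrite -[X in cov _ X _]/(fun t => n.+1%:R^-1 * \sum_k F k t).
rewrite -[X in cov _ _ X]/(fun t => m.+1%:R^-1 * \sum_k G k t).
rewrite covZl//; last exact: bmeasZ.
rewrite covZr// cov_suml// mulrA normrM.
have nm0 : 0 < n.+1%:R^-1 * m.+1%:R^-1 :> R by rewrite mulr_gt0// invr_gt0 ltr0n.
rewrite gtr0_norm// -invfM mulrC ler_pdivrMr ?mulr_gt0 ?ltr0n//.
apply: (le_trans (ler_norm_sum _ _ _)).
rewrite [leRHS](_ : _ = \sum_(k < n.+1) \sum_(l < m.+1) alpha); last first.
  rewrite !sumr_const !card_ord -mulrnA -[RHS]mulr_natr natrM mulrC.
  by rewrite [in RHS]mulrC [in RHS](mulrC m.+1%:R).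
apply: ler_sum => k _; rewrite cov_sumr//.
apply: (le_trans (ler_norm_sum _ _ _)); apply: ler_sum => l _.
by apply: cov_indic_mixing; exact: measurable_level.
Qed.

(** Covariance is bilinear, and up to [n.+1%:R^-1] both functions are means of
    indicators, whose covariances are bounded by [alpha]. *)
Lemma cov_mixing01 (f : S1 -> R) (g : S2 -> R) :
  measurable_fun setT f -> measurable_fun setT g ->
  (forall x, 0 <= f x <= 1) -> (forall x, 0 <= g x <= 1) ->
  `|cov P (f \o U) (g \o V)| <= alpha.
Proof.
move=> mf mg f01 g01; apply/ler_addgt0Pr => e e0.
have [n ne] : exists n, 4 * n.+1%:R^-1 < e.
  exists (Num.truncn (4 / e)); rewrite mulrC ltr_pdivrMl ?ltr0n//.
  rewrite -ltr_pdivrMr//; exact: truncnS_gt.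
have bf : bmeas (f \o U).
  apply: bmeas_comp => //; split=> //; exists 1 => x.
  by have /andP[? ?] := f01 x; rewrite ger0_norm.
have bg : bmeas (g \o V).
  apply: bmeas_comp => //; split=> //; exists 1 => x.
  by have /andP[? ?] := g01 x; rewrite ger0_norm.
have bfn : bmeas (levels n f \o U) by apply: bmeas_comp => //; exact: bmeas_levels.
have bgn : bmeas (levels n g \o V) by apply: bmeas_comp => //; exact: bmeas_levels.
have := cov_levels_mixing n n mf mg; rewrite /cov.
set c := n.+1%:R^-1 in ne.
have c0 : 0 <= c by rewrite invr_ge0.
have cmp (F G : T -> R) : bmeas F -> bmeas G -> (forall t, F t - c <= G t <= F t) ->
    Ex P F - c <= Ex P G <= Ex P F.
  move=> bF bG FG; rewrite -Ex_subc; last exact: bmeas_integrable.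
  apply/andP; split; apply: le_Ex; try (apply: bmeas_integrable); auto with bm.
    by move=> t; have /andP[] := FG t.
  by move=> t; have /andP[] := FG t.
have bnd1 (F : T -> R) : bmeas F -> (forall t, 0 <= F t <= 1) -> 0 <= Ex P F <= 1.
  move=> bF F01; apply/andP; split; first by apply: Ex_ge0 => t; case/andP: (F01 t).
  rewrite -[leRHS](Ex_cst P); apply: le_Ex; try (apply: bmeas_integrable); auto with bm.
  by move=> t; case/andP: (F01 t).
have /andP[f1 f2] := cmp _ _ bf bfn (fun t => levels_approx n (f01 (U t))).
have /andP[g1 g2] := cmp _ _ bg bgn (fun t => levels_approx n (g01 (V t))).
have /andP[fp fp1] := bnd1 _ bf (fun t => f01 (U t)).
have /andP[gp gp1] := bnd1 _ bg (fun t => g01 (V t)).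
have /andP[fnp fnp1] := bnd1 _ bfn (fun t => levels_01 n (f01 (U t))).
have /andP[gnp gnp1] := bnd1 _ bgn (fun t => levels_01 n (g01 (V t))).
have E1 : Ex P (fun t => (f \o U) t * (g \o V) t) - 2 * c <=
    Ex P (fun t => (levels n f \o U) t * (levels n g \o V) t) <=
    Ex P (fun t => (f \o U) t * (g \o V) t).
  rewrite -Ex_subc; last by apply: bmeas_integrable; auto with bm.
  apply/andP; split; apply: le_Ex; try (apply: bmeas_integrable); auto 6 with bm;
    by move=> t /=; have /andP[] := mul_approx01 (levels_01 n (f01 (U t)))
      (g01 (V t)) (proj1 (andP (levels_01 n (g01 (V t)))))
      (levels_approx n (f01 (U t))) (levels_approx n (g01 (V t))) c0.
have /andP[e1 e2] := E1.
have /andP[p1 p2] := mul_approx01 (introT andP (conj fnp fnp1))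
  (introT andP (conj gp gp1)) gnp (introT andP (conj f1 f2))
  (introT andP (conj g1 g2)) c0.
rewrite !ler_norml => /andP[h1 h2]; apply/andP.
move: (Ex P _) (Ex P _ * Ex P _) (Ex P _) (Ex P _ * Ex P _) e1 e2 p1 p2 h1 h2.
by move=> x y z w; split; lra.
Qed.

(** The factor 4 comes from mapping [[-M, M]] and [[-N, N]] onto [[0, 1]]. *)
Lemma cov_mixing (f : S1 -> R) (g : S2 -> R) M N :
  measurable_fun setT f -> measurable_fun setT g ->
  0 < M -> 0 < N -> (forall x, `|f x| <= M) -> (forall x, `|g x| <= N) ->
  `|cov P (f \o U) (g \o V)| <= 4 * M * N * alpha.
Proof.
move=> mf mg M0 N0 fM gN.
pose f' x := (2 * M)^-1 * f x + 2^-1; pose g' x := (2 * N)^-1 * g x + 2^-1.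
have mf' : measurable_fun setT f' by apply: measurable_funD => //; exact: measurable_funM.
have mg' : measurable_fun setT g' by apply: measurable_funD => //; exact: measurable_funM.
have sc (a b : R) : 0 < b -> `|a| <= b -> 0 <= (2 * b)^-1 * a + 2^-1 <= 1.
  move=> b0; rewrite ler_norml => /andP[h1 h2].
  have -> : (2 * b)^-1 * a + 2^-1 = (a + b) / (2 * b) by field; rewrite gt_eqF.
  by rewrite divr_ge0 ?ler_pdivrMr//=; lra.
have f01 x : 0 <= f' x <= 1 by exact: sc.
have g01 x : 0 <= g' x <= 1 by exact: sc.
have := cov_mixing01 mf' mg' f01 g01.
have -> : f' \o U = (fun t => (2 * M)^-1 * (f \o U) t + 2^-1) by [].
have -> : g' \o V = (fun t => (2 * N)^-1 * (g \o V) t + 2^-1) by [].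
have bf : bmeas (f \o U) by apply: bmeas_comp => //; split=> //; exists M.
have bg : bmeas (g \o V) by apply: bmeas_comp => //; split=> //; exists N.
rewrite covDl ?covDr ?covZl ?covZr ?cov_cstl; auto with bm.
rewrite [X in _ + _ * X + _]covC !cov_cstl; auto with bm.
rewrite !mulr0 !addr0.
rewrite mulrA normrM gtr0_norm; last by rewrite mulr_gt0// invr_gt0 mulr_gt0.
rewrite -invfM mulrC ler_pdivrMr; last by rewrite !mulr_gt0.
by move=> h; apply: le_trans h _; rewrite le_eqVlt; apply/orP; left; apply/eqP; ring.
Qed.

End scalar_mixing.

(** * Covariance inequality for mixing random vectors *)

Section signed_sums.
Context (R : realType).

(** Signed sum of [x 0, ..., x N.-1] whose signs are the binary digits of [s],
    the lowest digit belonging to the last term, so that [s < 2 ^ N] runs through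
    all choices of signs. *)
Fixpoint rad (x : nat -> R) (N s : nat) : R :=
  if N is N'.+1 then rad x N' s./2 + (-1) ^+ odd s * x N' else 0.

Lemma big_ord_double (m : nat) (F : nat -> R) :
  \sum_(s < m.*2) F s = \sum_(s < m) (F s.*2 + F s.*2.+1).
Proof.
elim: m => [|m IH]; first by rewrite !big_ord0.
by rewrite doubleS !big_ord_recr/= IH addrA.
Qed.

Lemma sum_radS (x y : nat -> R) N (h : R -> R -> R) :
  \sum_(s < 2 ^ N.+1) h (rad x N.+1 s) (rad y N.+1 s) =
  \sum_(s < 2 ^ N) (h (rad x N s + x N) (rad y N s + y N) +
                    h (rad x N s - x N) (rad y N s - y N)).
Proof.
rewrite expnS mul2n (big_ord_double _ (fun s => h (rad x N.+1 s) (rad y N.+1 s))).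
by apply: eq_bigr => s _ /=; rewrite odd_double uphalf_double doubleK !mul1r !mulN1r.
Qed.

Lemma sum_rad_mul (x y : nat -> R) N :
  \sum_(s < 2 ^ N) rad x N s * rad y N s = (2 ^ N)%:R * \sum_(k < N) x k * y k.
Proof.
elim: N => [|N IH]; first by rewrite expn0 big_ord1 big_ord0/= !mulr0.
rewrite (sum_radS x y N (fun a b => a * b)) big_ord_recr/=.
rewrite (eq_bigr (fun s : 'I_(2 ^ N) => 2 * (rad x N s * rad y N s) + 2 * (x N * y N)));
  last by move=> s _; ring.
rewrite big_split/= -mulr_sumr IH sumr_const card_ord expnS natrM -mulr_natl.
ring.
Qed.

(** The 3 counts the ways of pairing four factors.  Signed sums thus have tails
    controlled by the Euclidean norm of [x], whatever the number of terms. *)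
Lemma sum_rad_pow4 (x : nat -> R) N :
  \sum_(s < 2 ^ N) rad x N s ^+ 4 <= (2 ^ N)%:R * (3 * (\sum_(k < N) x k ^+ 2) ^+ 2).
Proof.
elim: N => [|N IH].
  by rewrite expn0 big_ord1 big_ord0/= !expr0n/= !mulr0.
rewrite (sum_radS x x N (fun a _ => a ^+ 4)) big_ord_recr/=.
set v := \sum_(k < N) _ in IH *.
rewrite (eq_bigr (fun s : 'I_(2 ^ N) => 2 * (rad x N s ^+ 4) +
  12 * x N ^+ 2 * (rad x N s * rad x N s) + 2 * x N ^+ 4)); last by move=> s _; ring.
rewrite !big_split/= sumr_const card_ord -[(2 * x N ^+ 4) *+ _]mulr_natl.
rewrite -!mulr_sumr sum_rad_mul expnS natrM.
have -> : \sum_(k < N) x k * x k = v by apply: eq_bigr => k _; rewrite expr2.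
have : 0 <= (2 ^ N)%:R :> R by [].
move: IH; move: (2 ^ N)%:R (\sum_(i < _) _) (x N) v => c S y v IH c0.
have -> : 2%:R * c * (3 * (v + y ^+ 2) ^+ 2) = 2 * (c * (3 * v ^+ 2)) +
   12 * y ^+ 2 * (c * v) + c * (2 * y ^+ 4) + 4 * (c * y ^+ 4) by ring.
apply: (@le_trans _ _ (2 * (c * (3 * v ^+ 2)) + 12 * y ^+ 2 * (c * v) + c * (2 * y ^+ 4))).
  by rewrite !lerD2r ler_pM2l.
by rewrite lerDl mulr_ge0// mulr_ge0// exprn_even_ge0.
Qed.

Definition clamp (M z : R) : R := Num.max (- M) (Num.min M z).

Lemma clamp_le M z : 0 <= M -> `|clamp M z| <= M.
Proof.
move=> M0; rewrite ler_norml /clamp le_max lexx/= ge_max ge_min lexx/= andbT.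
by rewrite (le_trans _ M0)// oppr_le0.
Qed.

Lemma clamp_sqr_le M z : 0 <= M -> clamp M z ^+ 2 <= z ^+ 2.
Proof.
move=> M0; rewrite /clamp; case: (leP M z) => [Mz|zM].
  by rewrite max_r ?(le_trans _ M0) ?oppr_le0// ler_sqr ?nnegrE// (le_trans M0).
case: (leP (- M) z) => // zM'.
have z0 : z <= 0 by rewrite ltW// (lt_le_trans zM')// oppr_le0.
by rewrite sqrrN -[leRHS]sqrrN ler_sqr ?nnegrE ?oppr_ge0// lerNr ltW.
Qed.

(** Since [|z| <= M + z ^ 2 / (4 * M)], the part cut off by the truncation is at
    most [z ^ 2 / (4 * M)]; hence the fourth power. *)
Lemma sub_clamp_sqr M z : 0 < M -> (z - clamp M z) ^+ 2 <= z ^+ 4 / (16 * M ^+ 2).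
Proof.
move=> M0; rewrite ler_pdivlMr ?mulr_gt0 ?exprn_gt0//.
have key (a : R) : 0 <= a - M -> (a - M) ^+ 2 * (16 * M ^+ 2) <= a ^+ 4.
  move=> aM.
  have -> : (a - M) ^+ 2 * (16 * M ^+ 2) = (4 * M * (a - M)) ^+ 2 by ring.
  rewrite (exprM a 2 2) ler_sqr ?nnegrE ?sqr_ge0//; last first.
    by rewrite mulr_ge0// mulr_ge0// ltW.
  by rewrite -subr_ge0 (_ : _ - _ = (a - 2 * M) ^+ 2) ?sqr_ge0//; ring.
rewrite /clamp; case: (leP M z) => [Mz|zM].
  have mM : - M <= M by rewrite (le_trans _ (ltW M0))// oppr_le0 ltW.
  rewrite max_r//.
  by apply: key; rewrite subr_ge0.
case: (leP (- M) z) => zM'.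
  by rewrite subrr expr0n mul0r exprn_even_ge0.
have -> : (z - - M) ^+ 2 = (- z - M) ^+ 2 by ring.
have -> : z ^+ 4 = (- z) ^+ 4 by ring.
by apply: key; rewrite subr_ge0 lerNr ltW.
Qed.

Lemma bmeas_rad d (S : measurableType d) (f : nat -> S -> R) N s :
  (forall k, bmeas (f k)) -> bmeas (fun x => rad (f^~ x) N s).
Proof.
move=> bf; elim: N s => [|N IH] s /=; first exact: bmeas_cst.
by apply: bmeasD => //; exact: bmeasZ.
Qed.

Lemma bmeas_clamp d (S : measurableType d) M (f : S -> R) :
  0 <= M -> bmeas f -> bmeas (fun x => clamp M (f x)).
Proof.
move=> M0 [mf _]; split; last by exists M => x; exact: clamp_le.
by apply: measurable_maxr => //; exact: measurable_minr.
Qed.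

End signed_sums.

Section hilbert_mixing.
Context (dT : measure_display) (T : measurableType dT) (R : realType).
Variable P : probability T R.

Lemma cov_polar (F G F' G' : T -> R) : bmeas F -> bmeas G -> bmeas F' -> bmeas G' ->
  cov P (fun t => F t + F' t) (fun t => G t + G' t) +
  cov P (fun t => F t - F' t) (fun t => G t - G' t) =
  2 * cov P F G + 2 * cov P F' G'.
Proof.
move=> bF bG bF' bG'.
have eB H H' : (fun t => H t - H' t) = (fun t : T => H t + (-1) * H' t) :> (T -> R).
  by apply/funext => t; rewrite mulN1r.
rewrite !eB !covDl ?covDr ?covZl ?covZr; auto with bm.
ring.
Qed.

(** Averaging over the signs cancels the cross terms, so a Hilbert-space
    covariance is a mean of scalar ones. *)
Lemma sum_cov_rad (F G : nat -> T -> R) N :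
  (forall k, bmeas (F k)) -> (forall k, bmeas (G k)) ->
  \sum_(s < 2 ^ N) cov P (fun t => rad (F^~ t) N s) (fun t => rad (G^~ t) N s) =
  (2 ^ N)%:R * \sum_(k < N) cov P (F k) (G k).
Proof.
move=> bF bG; elim: N => [|N IH].
  by rewrite expn0 big_ord1 big_ord0/= mulr0 cov_cstl//; exact: bmeas_cst.
rewrite big_ord_recr/= [in LHS]expnS mul2n (big_ord_double _ (fun s =>
  cov P (fun t => rad (F^~ t) N.+1 s) (fun t => rad (G^~ t) N.+1 s))).
rewrite (eq_bigr (fun s : 'I_(2 ^ N) =>
    2 * cov P (fun t => rad (F^~ t) N s) (fun t => rad (G^~ t) N s) +
    2 * cov P (F N) (G N))); last first.
  move=> s _; rewrite -cov_polar//; try exact: bmeas_rad.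
  congr (_ + _); congr (cov P); apply/funext => t /=;
    by rewrite odd_double ?uphalf_double ?doubleK/= ?mul1r ?mulN1r.
rewrite big_split/= -mulr_sumr IH sumr_const card_ord expnS natrM -mulr_natl.
ring.
Qed.

Lemma Ex_sqr_ge F : bmeas F -> Ex P F ^+ 2 <= Ex P (fun t => F t ^+ 2).
Proof.
move=> bF; have := Ex_ge0 P (fun t => sqr_ge0 (F t - Ex P F)).
have -> : (fun t => (F t - Ex P F) ^+ 2) =
    (fun t => (F t * F t + (- (2 * Ex P F)) * F t) - (- (Ex P F ^+ 2))).
  by apply/funext => t; ring.
rewrite Ex_subc ?ExD ?ExZ; try (apply: bmeas_integrable; auto with bm).
under [X in Ex P X + _ - _]eq_fun do rewrite -expr2.
move: (Ex P _) (Ex P F) => a b h; rewrite -subr_ge0.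
by rewrite (_ : a - b ^+ 2 = a + - (2 * b) * b - - b ^+ 2)//; ring.
Qed.

(** Bound by the Cauchy-Schwarz inequality alone, from which the iteration in
    [hilbert_cov_mixing] starts. *)
Lemma sum_cov_le2 N (F G : nat -> T -> R) A B : 0 < A -> 0 < B ->
  (forall k, bmeas (F k)) -> (forall k, bmeas (G k)) ->
  (forall t, \sum_(k < N) F k t ^+ 2 <= A ^+ 2) ->
  (forall t, \sum_(k < N) G k t ^+ 2 <= B ^+ 2) ->
  `|\sum_(k < N) cov P (F k) (G k)| <= A * B * 2.
Proof.
move=> A0 B0 bF bG FA GB.
have amgm (x y : nat -> R) : \sum_(k < N) x k ^+ 2 <= A ^+ 2 ->
    \sum_(k < N) y k ^+ 2 <= B ^+ 2 -> `|\sum_(k < N) x k * y k| <= A * B.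
  move=> xA yB; apply: (le_trans (ler_norm_sum _ _ _)).
  have h k : `|x k * y k| <= (B / (2 * A)) * x k ^+ 2 + (A / (2 * B)) * y k ^+ 2.
    rewrite -subr_ge0 normrM -[x k ^+ 2]real_normK ?num_real//.
    rewrite -[y k ^+ 2]real_normK ?num_real//.
    have -> : B / (2 * A) * `|x k| ^+ 2 + A / (2 * B) * `|y k| ^+ 2 - `|x k| * `|y k| =
        (B * `|x k| - A * `|y k|) ^+ 2 / (2 * A * B) by field; rewrite !gt_eqF.
    by rewrite divr_ge0 ?sqr_ge0// !mulr_ge0// ltW.
  apply: (le_trans (ler_sum _ (fun (k : 'I_N) _ => h k))).
  rewrite big_split/= -!mulr_sumr.
  have -> : A * B = B / (2 * A) * A ^+ 2 + A / (2 * B) * B ^+ 2.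
    by field; rewrite !gt_eqF.
  by apply: lerD; rewrite ler_pM2l// divr_gt0// mulr_gt0.
have ExA (H : nat -> T -> R) C : (forall k, bmeas (H k)) ->
    (forall t, \sum_(k < N) H k t ^+ 2 <= C ^+ 2) ->
    \sum_(k < N) Ex P (H k) ^+ 2 <= C ^+ 2.
  move=> bH HC.
  have bH2 k : bmeas (fun t => H k t ^+ 2).
    by under eq_fun do rewrite expr2; auto with bm.
  apply: (@le_trans _ _ (Ex P (fun t => \sum_(k < N) H k t ^+ 2))).
    rewrite Ex_sum; first by apply: ler_sum => k _; exact: Ex_sqr_ge.
    by move=> k; exact: bmeas_integrable.
  rewrite -[leRHS](Ex_cst P); apply: le_Ex => //; apply: bmeas_integrable.
    exact: bmeas_sum.
  exact: bmeas_cst.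
rewrite /cov sumrB (le_trans (ler_normB _ _))//.
have -> : A * B * 2 = A * B + A * B by ring.
apply: lerD; last first.
  by apply: (amgm (fun k => Ex P (F k)) (fun k => Ex P (G k))); exact: ExA.
have -> : \sum_(k < N) Ex P (fun t => F k t * G k t) =
    Ex P (fun t => \sum_(k < N) F k t * G k t).
  by rewrite Ex_sum// => k; apply: bmeas_integrable; auto with bm.
have bS : bmeas (fun t => \sum_(k < N) F k t * G k t).
  by apply: bmeas_sum => k; auto with bm.
apply: (le_trans (Ex_norm (bmeas_integrable P bS))).
rewrite -[leRHS](Ex_cst P); apply: le_Ex.
- have := integrable_norm (bmeas_integrable P bS); exact.
- by apply: bmeas_integrable; exact: bmeas_cst.
- by move=> t; apply: (amgm (F^~ t) (G^~ t)).
Qed.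

Context d1 d2 (S1 : measurableType d1) (S2 : measurableType d2).
Variables (U : T -> S1) (V : T -> S2) (alpha : R).
Hypotheses (mU : measurable_fun setT U) (mV : measurable_fun setT V).
Hypothesis UV : mixing_le P U V alpha.

Definition hilbert_cov_le (b : R) : Prop :=
  forall N (f : nat -> S1 -> R) (g : nat -> S2 -> R) A B, 0 < A -> 0 < B ->
  (forall k, bmeas (f k)) -> (forall k, bmeas (g k)) ->
  (forall x, \sum_(k < N) f k x ^+ 2 <= A ^+ 2) ->
  (forall y, \sum_(k < N) g k y ^+ 2 <= B ^+ 2) ->
  `|\sum_(k < N) cov P (f k \o U) (g k \o V)| <= A * B * b.

(** Write the left-hand side as a mean of covariances of signed sums and truncate
    these at [2 * A] and [2 * B].  The truncated parts fall under the scalar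
    inequality, which gives [4 * (2 * A) * (2 * B) * alpha].  The parts cut off,
    indexed by the signs, are again families of functions, of Euclidean norm at
    most [A / 4] and [B / 4] by the fourth moment; the assumed bound applies to
    each of the two remaining terms. *)
Lemma hilbert_cov_step b :
  hilbert_cov_le b -> hilbert_cov_le (16 * alpha + b / 2).
Proof.
move=> hb N f g A B A0 B0 bf bg fA gB.
pose n2 := (2 ^ N)%:R : R; have n20 : 0 < n2 by rewrite ltr0n expn_gt0.
pose q := Num.sqrt n2; have q0 : 0 < q by rewrite sqrtr_gt0.
have qq : q ^+ 2 = n2 by rewrite sqr_sqrtr// ltW.
pose f1 s x := clamp (2 * A) (rad (f^~ x) N s).
pose g1 s y := clamp (2 * B) (rad (g^~ y) N s).
pose f2 s x := rad (f^~ x) N s - f1 s x.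
pose g2 s y := rad (g^~ y) N s - g1 s y.
pose g0 s y := rad (g^~ y) N s.
have A20 : 0 < 2 * A by rewrite mulr_gt0.
have B20 : 0 < 2 * B by rewrite mulr_gt0.
have bf1 s : bmeas (f1 s) by apply: bmeas_clamp; [exact: ltW|exact: bmeas_rad].
have bg1 s : bmeas (g1 s) by apply: bmeas_clamp; [exact: ltW|exact: bmeas_rad].
have bf0 s : bmeas (fun x => rad (f^~ x) N s) by exact: bmeas_rad.
have bg0 s : bmeas (g0 s) by exact: bmeas_rad.
have bf2 s : bmeas (f2 s) by exact: bmeasB.
have bg2 s : bmeas (g2 s) by exact: (bmeasB (bg0 s) (bg1 s)).
have rad2 (x : nat -> R) C : \sum_(k < N) x k ^+ 2 <= C ^+ 2 ->
    \sum_(s < 2 ^ N) rad x N s ^+ 2 <= (q * C) ^+ 2.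
  move=> xC; rewrite exprMn qq (eq_bigr (fun s : 'I_(2 ^ N) => rad x N s * rad x N s)).
    by rewrite sum_rad_mul ler_pM2l//; under eq_bigr do rewrite -expr2.
  by move=> s _; rewrite expr2.
have rad1 (x : nat -> R) C D : 0 < D -> \sum_(k < N) x k ^+ 2 <= C ^+ 2 ->
    \sum_(s < 2 ^ N) clamp D (rad x N s) ^+ 2 <= (q * C) ^+ 2.
  move=> D0 xC; apply: le_trans (rad2 _ _ xC); apply: ler_sum => s _.
  by apply: clamp_sqr_le; exact: ltW.
have radt (x : nat -> R) C : 0 < C -> \sum_(k < N) x k ^+ 2 <= C ^+ 2 ->
    \sum_(s < 2 ^ N) (rad x N s - clamp (2 * C) (rad x N s)) ^+ 2 <= (q * (C / 4)) ^+ 2.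
  move=> C0 xC; have C20 : 0 < 2 * C by rewrite mulr_gt0.
  apply: (le_trans (ler_sum _ (fun (s : 'I_(2 ^ N)) _ => sub_clamp_sqr (rad x N s) C20))).
  rewrite -mulr_suml ler_pdivrMr; last by rewrite mulr_gt0// exprn_gt0.
  apply: (le_trans (sum_rad_pow4 _ _)); rewrite -/n2 exprMn qq -mulrA ler_pM2l//.
  have -> : (C / 4) ^+ 2 * (16 * (2 * C) ^+ 2) = 4 * (C ^+ 2) ^+ 2 by field.
  apply: ler_pM; rewrite ?sqr_ge0 ?ler_nat//.
  rewrite ler_sqr ?nnegrE ?sqr_ge0//; apply: sumr_ge0 => k _; exact: sqr_ge0.
rewrite -(ler_pM2l n20) -[X in X * `|_|]gtr0_norm// -normrM.
rewrite -(@sum_cov_rad (fun k => f k \o U) (fun k => g k \o V)); last 2 first.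
- by move=> k; exact: bmeas_comp.
- by move=> k; exact: bmeas_comp.
have dec (s : nat) : cov P (fun t => rad (f^~ (U t)) N s) (fun t => rad (g^~ (V t)) N s) =
    cov P (f1 s \o U) (g1 s \o V) + cov P (f1 s \o U) (g2 s \o V) +
    cov P (f2 s \o U) (g0 s \o V).
  rewrite -covDr; try exact: bmeas_comp.
  have -> : (fun t => (g1 s \o V) t + (g2 s \o V) t) = g0 s \o V.
    by apply/funext => t; rewrite /g2 /= addrC subrK.
  rewrite -covDl; try exact: bmeas_comp.
  by congr cov; apply/funext => t; rewrite /f2 /= addrC subrK.
under eq_bigr do rewrite dec.
rewrite 2!big_split.
have -> : n2 * (A * B * (16 * alpha + b / 2)) =
    n2 * (A * B * (16 * alpha)) + (q * A) * (q * (B / 4)) * b + (q * (A / 4)) * (q * B) * b.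
  by rewrite -qq; field.
apply: (le_trans (ler_normD _ _)); apply: lerD; last first.
  apply: (hb (2 ^ N)%N f2 g0) => //; rewrite ?mulr_gt0 ?divr_gt0// => z;
    [exact: radt|exact: rad2].
apply: (le_trans (ler_normD _ _)); apply: lerD; last first.
  apply: (hb (2 ^ N)%N f1 g2) => //; rewrite ?mulr_gt0 ?divr_gt0// => z;
    [exact: rad1|exact: radt].
apply: (le_trans (ler_norm_sum _ _ _)).
have -> : n2 * (A * B * (16 * alpha)) = \sum_(s < 2 ^ N) A * B * (16 * alpha).
  by rewrite sumr_const card_ord -[RHS]mulr_natl.
apply: ler_sum => s _.
apply: le_trans (cov_mixing mU mV UV (bf1 s).1 (bg1 s).1 A20 B20 _ _) _.
- by move=> x; apply: clamp_le; exact: ltW.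
- by move=> x; apply: clamp_le; exact: ltW.
- by rewrite le_eqVlt; apply/orP; left; apply/eqP; ring.
Qed.

(** The number [32 * alpha] is the fixed point of [b |-> 16 * alpha + b / 2].
    The constant depends neither on the number of coordinates nor on the
    functions, which is the content of Grothendieck's inequality for the bilinear
    form [cov]. *)
Lemma hilbert_cov_mixing : hilbert_cov_le (32 * alpha).
Proof.
have iter n : hilbert_cov_le (32 * alpha + 2 * 2^-1 ^+ n).
  elim: n => [|n IH].
    move=> N f g A B A0 B0 bf bg fA gB.
    apply: (le_trans (sum_cov_le2 A0 B0 (fun k => bmeas_comp mU (bf k))
      (fun k => bmeas_comp mV (bg k)) (fun t => fA (U t)) (fun t => gB (V t)))).
    rewrite ler_pM2l ?mulr_gt0// expr0 mulr1 lerDr mulr_ge0//.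
    exact: mixing_ge0 UV.
  have := hilbert_cov_step IH; congr hilbert_cov_le.
  by rewrite exprS; field.
move=> N f g A B A0 B0 bf bg fA gB.
rewrite -ler_pdivrMl ?mulr_gt0//; apply/ler_addgt0Pr => e e0.
have [n ne] : exists n, 2 * 2^-1 ^+ n < e.
  exists (Num.truncn (2 / e)).+1; rewrite exprVn ltr_pdivrMr ?exprn_gt0//.
  rewrite -ltr_pdivrMl// mulrC; apply: lt_trans (truncnS_gt _) _.
  by rewrite -natrX ltr_nat ltn_expl.
rewrite ler_pdivrMl ?mulr_gt0//; apply: le_trans (iter n N f g A B A0 B0 bf bg fA gB) _.
by rewrite ler_pM2l ?mulr_gt0// lerD2l ltW.
Qed.

End hilbert_mixing.

(** * Second moments of sums *)

Section variance_of_sums.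
Context (dT : measure_display) (T : measurableType dT) (R : realType).
Variable P : probability T R.
Context dS (S : measurableType dS).

Lemma hilbert_cov_seq (K : Type) (r : seq K) (U V : T -> S) (alpha : R)
    (f : K -> S -> R) A :
  measurable_fun setT U -> measurable_fun setT V -> mixing_le P U V alpha ->
  0 < A -> (forall k, bmeas (f k)) ->
  (forall x, \sum_(k <- r) f k x ^+ 2 <= A ^+ 2) ->
  \sum_(k <- r) cov P (f k \o U) (f k \o V) <= A ^+ 2 * (32 * alpha).
Proof.
move=> mU mV UV A0 bf fA.
case: r fA => [|k0 r'] fA.
  rewrite big_nil mulr_ge0 ?sqr_ge0// mulr_ge0//; exact: mixing_ge0 UV.
set r := k0 :: r' in fA *.
have h := hilbert_cov_mixing mU mV UV (N := size r)
  (f := fun n => f (nth k0 r n)) (g := fun n => f (nth k0 r n)) A0 A0.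
rewrite (big_nth k0) big_mkord expr2; apply: le_trans (ler_norm _) _; apply: h => //.
- by move=> x; have := fA x; rewrite (big_nth k0) big_mkord.
- by move=> x; have := fA x; rewrite (big_nth k0) big_mkord.
Qed.

Lemma Ex_sqr_sum (I : eqType) (s : seq I) (F : I -> T -> R) (m : R) :
  (forall i, bmeas (F i)) -> {in s, forall i, Ex P (F i) = m} ->
  Ex P (fun t => (\sum_(i <- s) (F i t - m)) ^+ 2) =
  \sum_(i <- s) \sum_(j <- s) cov P (F i) (F j).
Proof.
move=> bF Fm.
have bFm i : bmeas (fun t => F i t - m) by apply: bmeasB => //; exact: bmeas_cst.
have bFF i j : bmeas (fun t => (F i t - m) * (F j t - m)) by exact: bmeasM.
have -> : (fun t => (\sum_(i <- s) (F i t - m)) ^+ 2) =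
    (fun t => \sum_(i <- s) \sum_(j <- s) (F i t - m) * (F j t - m)).
  apply/funext => t; rewrite expr2 mulr_suml; apply: eq_bigr => i _.
  by rewrite mulr_sumr.
rewrite Ex_sum; last by move=> i; apply: bmeas_integrable; exact: bmeas_sum.
rewrite big_seq [RHS]big_seq; apply: eq_bigr => i si.
rewrite Ex_sum; last by move=> j; exact: bmeas_integrable.
rewrite big_seq [RHS]big_seq; apply: eq_bigr => j sj.
have -> : (fun t => (F i t - m) * (F j t - m)) =
    (fun t => F i t * F j t + (- m) * F i t + (- m) * F j t - (- m ^+ 2)).
  by apply/funext => t; ring.
rewrite Ex_subc ?ExD ?ExZ; try by apply: bmeas_integrable; auto 6 with bm.
rewrite /cov Fm// Fm//; ring.
Qed.

(** The coordinates are summed before the covariance inequality is applied, once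
    for each pair of sites, so their number does not enter the bound. *)
Lemma variance_sum_mixing (I : eqType) (s : seq I) (K : Type) (r : seq K)
    (U : I -> T -> S) (c : I -> I -> R) (f : K -> S -> R) (m : K -> R) A :
  (forall i, measurable_fun setT (U i)) ->
  {in s &, forall i j, mixing_le P (U i) (U j) (c i j)} ->
  0 < A -> (forall k, bmeas (f k)) ->
  (forall x, \sum_(k <- r) f k x ^+ 2 <= A ^+ 2) ->
  {in s, forall i k, Ex P (f k \o U i) = m k} ->
  \sum_(k <- r) Ex P (fun t => (\sum_(i <- s) (f k (U i t) - m k)) ^+ 2) <=
  A ^+ 2 * (32 * \sum_(i <- s) \sum_(j <- s) c i j).
Proof.
move=> mU mix A0 bf fA fm.
under eq_bigr => k _.
  rewrite (@Ex_sqr_sum _ s (fun i => f k \o U i)); last 2 first.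
  - by move=> i; exact: bmeas_comp.
  - by move=> i si; exact: fm.
over.
rewrite exchange_big/= mulr_sumr mulr_sumr big_seq [leRHS]big_seq; apply: ler_sum => i si.
rewrite exchange_big/= mulr_sumr mulr_sumr big_seq [leRHS]big_seq; apply: ler_sum => j sj.
by apply: hilbert_cov_seq => //; exact: mix.
Qed.

End variance_of_sums.

(** * Summation over the lattice *)

Section lattice_sums.
Variable (R : realType).

Lemma sum_inv_sqr_dist (a N : nat) :
  \sum_(m < N) (`|a%:Z - (m : nat)%:Z|%N.+1%:R ^+ 2)^-1 <= 3 :> R.
Proof.
(* upper bounds for the partial sums: both pieces telescope, and they agree
   at N = a *)
pose b N := if (N <= a)%N then (a - N).+1%:R^-1 else 3 - 2 * (N - a).+1%:R^-1 : R.
suff : \sum_(m < N) (`|a%:Z - (m : nat)%:Z|%N.+1%:R ^+ 2)^-1 <= b N.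
  move=> /le_trans; apply; rewrite /b; case: ifP => _.
    by rewrite (@le_trans _ _ 1) ?invf_le1 ?ler1n// ler1n.
  by rewrite gerBl mulr_ge0// invr_ge0.
elim: N => [|N IH]; first by rewrite big_ord0 /b leq0n invr_ge0.
rewrite big_ord_recr/=; apply: (le_trans (lerD IH (lexx _))); rewrite /b.
have [Na|aN] := ltnP N a.
  rewrite (ltnW Na); have -> : `|a%:Z - N%:Z|%N = (a - N.+1).+1 by lia.
  have -> : (a - N)%N = (a - N.+1).+1 by lia.
  move: (a - N.+1)%N => k; rewrite -!natr1.
  have : 0 <= k%:R :> R by []. move: k%:R => x x0.
  rewrite -subr_ge0.
  have -> : (x + 1)^-1 - ((x + 1 + 1)^-1 + ((x + 1 + 1) ^+ 2)^-1) =
      ((x + 1) * (x + 1 + 1) ^+ 2)^-1.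
    by field; rewrite !gt_eqF//; lra.
  by rewrite invr_ge0 mulr_ge0 ?sqr_ge0//; lra.
have -> : (if (N <= a)%N then (a - N).+1%:R^-1 else 3 - 2 * (N - a).+1%:R^-1) =
    3 - 2 * (N - a).+1%:R^-1 :> R.
  case: ifP => // Na; have -> : N = a by lia.
  by rewrite subnn invr1; lra.
have -> : `|a%:Z - N%:Z|%N = (N - a)%N by lia.
have -> : (N.+1 - a)%N = (N - a).+1 by lia.
move: (N - a)%N => k; rewrite -[k.+2%:R]natr1 -[k.+1%:R]natr1.
have : 0 <= k%:R :> R by []. move: k%:R => x x0.
rewrite -subr_ge0.
have -> : 3 - 2 * (x + 1 + 1)^-1 - (3 - 2 * (x + 1)^-1 + ((x + 1) ^+ 2)^-1) =
   x / ((x + 1) ^+ 2 * (x + 1 + 1)).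
  by field; rewrite !gt_eqF//; lra.
by rewrite divr_ge0// mulr_ge0 ?sqr_ge0//; lra.
Qed.

Variable d : nat.

(** A product over coordinates, so that it can be summed one coordinate at a
    time; up to a constant it dominates every function of the sup-distance that
    decays faster than the power [- 2 * d]. *)
Definition weight (i j : site d) : R :=
  \prod_(k < d) (`|i k - j k|%N.+1%:R ^+ 2)^-1.

Lemma weight_ge0 i j : 0 <= weight i j.
Proof. by apply: prodr_ge0 => k _; rewrite invr_ge0 sqr_ge0. Qed.

Lemma weight_lb (i j : site d) : (((site_dist i j).+1%:R ^+ (2 * d))^-1 : R) <= weight i j.
Proof.
rewrite exprM -exprVn -[X in _ ^+ X](card_ord d) -prodr_const.
apply: ler_prod => k _; rewrite invr_ge0 sqr_ge0/=.
rewrite lef_pV2 ?posrE ?exprn_gt0 ?ltr0n// ler_sqr ?nnegrE// ler_nat ltnS.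
exact: (leq_bigmax (F := fun k => `|i k - j k|%N)).
Qed.

Lemma power_decay_weight (K theta : R) (i j : site d) :
  (2 * d)%:R < theta -> (0 < site_dist i j)%N ->
  K * (site_dist i j)%:R `^ (- theta) <= `|K| * 2 ^+ (2 * d) * weight i j.
Proof.
move=> th m0; set m := site_dist i j in m0 *.
apply: (@le_trans _ _ (`|K| * m%:R `^ (- theta))).
  by rewrite ler_wpM2r ?powR_ge0// ler_norm.
rewrite -mulrA ler_wpM2l//.
apply: (@le_trans _ _ ((m%:R ^+ (2 * d))^-1)).
  rewrite -powR_mulrn// -powRN ler_powR ?ler1n// lerN2; exact: ltW.
apply: (@le_trans _ _ (2 ^+ (2 * d) * (m.+1%:R ^+ (2 * d))^-1)); last first.
  by rewrite ler_wpM2l ?exprn_ge0//; exact: weight_lb.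
rewrite -[X in X <= _]mul1r ler_pdivrMr ?exprn_gt0 ?ltr0n//.
rewrite mulrAC ler_pdivlMr ?exprn_gt0 ?ltr0n// mul1r -exprMn.
by rewrite lerXn2r ?nnegrE ?mulr_ge0// -natrM ler_nat; lia.
Qed.

Lemma exp_decay_weight (a : R) : (0 < d)%N -> 0 < a ->
  exists2 K : R, 0 <= K &
    forall i j : site d, expR (- (a * (site_dist i j)%:R)) <= K * weight i j.
Proof.
move=> d0 a0; pose n := (2 * d)%N.
have n0 : 0 < n%:R :> R by rewrite ltr0n /n muln_gt0.
pose c : R := 1 + n%:R / a; have c0 : 0 < c by rewrite addr_gt0// divr_gt0.
exists (c ^+ n) => [|i j]; first by rewrite exprn_ge0// ltW.
apply: le_trans (_ : c ^+ n * ((site_dist i j).+1%:R ^+ n)^-1 <= _); last first.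
  by rewrite ler_wpM2l ?exprn_ge0 ?(ltW c0)//; exact: weight_lb.
move: (site_dist i j) => m.
rewrite ler_pdivlMr ?exprn_gt0 ?ltr0n// expRN mulrC ler_pdivrMr ?expR_gt0//.
have -> : a * m%:R = n%:R * (a * m%:R / n%:R).
  by rewrite [RHS]mulrC divfK// gt_eqF.
rewrite expRM_natl -exprMn lerXn2r ?nnegrE ?mulr_ge0 ?expR_ge0 ?(ltW c0)//.
apply: (@le_trans _ _ (c * (1 + a * m%:R / n%:R))); last first.
  by rewrite ler_pM2l// expR_ge1Dx.
rewrite -natr1 -subr_ge0.
have -> : c * (1 + a * m%:R / n%:R) - (m%:R + 1) = a * m%:R / n%:R + n%:R / a.
  by rewrite /c; field; rewrite !gt_eqF.
by rewrite addr_ge0// !mulr_ge0// ?invr_ge0 ltW.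
Qed.

Definition grid_seq (l : nat) (n : 'I_d -> nat) : seq (site d) :=
  finmap.enum_fset (fset_set (grid l%:Z n)).

Lemma mem_grid_seq l n i : (i \in grid_seq l n) = (i \in grid l%:Z n).
Proof. by rewrite /grid_seq in_fset_set//; exact: finite_grid. Qed.

Lemma fsbig_grid (V : nmodType) (l : nat) n (F : site d -> V) :
  \sum_(i \in grid l%:Z n) F i = \sum_(i <- grid_seq l n) F i.
Proof. by rewrite fsbig_finite//; exact: finite_grid. Qed.

Definition site_of N (f : {ffun 'I_d -> 'I_N}) : site d := [ffun k => (f k : nat)%:Z].

Lemma site_of_inj N : injective (@site_of N).
Proof.
move=> f g /ffunP fg; apply/ffunP => k; apply/val_inj.
by have := fg k; rewrite !ffunE => -[].
Qed.

(** Sums over a grid become sums over a [family] of finite functions, to which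
    the distributivity of products over sums applies. *)
Lemma big_grid_seq (V : nmodType) (l : nat) n N (F : site d -> V) :
  (forall k, n k < N)%N ->
  \sum_(i <- grid_seq l n) F i =
  \sum_(f in family (fun k => [pred m : 'I_N | (l <= m <= n k)%N])) F (site_of f).
Proof.
move=> nN; rewrite -big_enum -(big_map (@site_of N) xpredT F) /=.
apply: perm_big; apply: uniq_perm.
- exact: finmap.fset_uniq.
- by rewrite map_inj_uniq ?enum_uniq//; exact: site_of_inj.
move=> i; rewrite mem_grid_seq; apply/idP/mapP => [/set_mem gi|[f]].
  have ik k : (`|i k|%N < N)%N.
    by have := gi k; have := nN k; lia.
  exists [ffun k => Ordinal (ik k)].
    rewrite mem_enum; apply/familyP => k; rewrite ffunE !inE/=.
    by have := gi k; lia.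
  by apply/ffunP => k; rewrite !ffunE/=; have := gi k; lia.
rewrite mem_enum => /familyP fam ->; apply/mem_set => k; rewrite ffunE.
by have := fam k; rewrite !inE !lez_nat.
Qed.

Lemma big_ord_interval (l m N : nat) : (0 < l)%N -> (m < N)%N ->
  (\sum_(j < N | (l <= j <= m)%N) 1 = m.+1 - l)%N.
Proof.
move=> l0 mN; rewrite -(big_mkord (fun j => (l <= j <= m)%N) (fun=> 1%N)).
rewrite (eq_bigl (fun j => (l <= j)%N && (j < m.+1)%N))//.
rewrite -(big_nat_widen 0 m.+1 N (fun j => (l <= j)%N))//.
by rewrite -(big_nat_widenl l 0 m.+1 xpredT)// sum_nat_const_nat muln1.
Qed.

Lemma size_grid_seq l n : (0 < l)%N ->
  size (grid_seq l n) = \prod_(k < d) ((n k).+1 - l)%N.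
Proof.
move=> l0; pose N := (\max_(k < d) n k).+1.
have nN k : (n k < N)%N by rewrite ltnS; exact: (leq_bigmax (F := n)).
rewrite -sum1_size (big_grid_seq _ (fun=> 1%N) nN).
rewrite (eq_bigr (fun f : {ffun 'I_d -> 'I_N} => \prod_(k < d) 1)%N); last first.
  by move=> f _; rewrite big1.
rewrite -(bigA_distr_big_dep (fun k (m : 'I_N) => (l <= m <= n k)%N) (fun _ _ => 1%N)).
by apply: eq_bigr => k _; exact: big_ord_interval.
Qed.

Lemma sum_weight_grid l n (i : site d) : (forall k, (0 <= i k)%R) ->
  \sum_(j <- grid_seq l n) weight i j <= 3 ^+ d.
Proof.
move=> i0; pose N := (\max_(k < d) n k).+1.
have nN k : (n k < N)%N by rewrite ltnS; exact: (leq_bigmax (F := n)).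
rewrite (big_grid_seq _ _ nN).
apply: (@le_trans _ _ (\sum_(f : {ffun 'I_d -> 'I_N}) weight i (site_of f))).
  rewrite [leRHS](bigID (mem (family
    (fun k => [pred m : 'I_N | (l <= m <= n k)%N]))))/= lerDl.
  by apply: sumr_ge0 => f _; exact: weight_ge0.
rewrite /weight.
under eq_bigr do under eq_bigr do rewrite ffunE.
rewrite -(bigA_distr_bigA (fun k (m : 'I_N) => (`|i k - (m : nat)%:Z|%N.+1%:R ^+ 2)^-1)).
rewrite -[X in _ ^+ X](card_ord d) -prodr_const; apply: ler_prod => k _.
rewrite sumr_ge0/=; last by move=> m _; rewrite invr_ge0 sqr_ge0.
have -> : i k = `|i k|%N%:Z by rewrite gez0_abs.
exact: sum_inv_sqr_dist.
Qed.

Lemma sum_weight_grid2 l n :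
  \sum_(i <- grid_seq l n) \sum_(j <- grid_seq l n) weight i j <=
  (size (grid_seq l n))%:R * 3 ^+ d.
Proof.
rewrite mulr_natl -[leRHS]addr0 -iter_addr -count_predT -big_const_seq.
rewrite big_seq [leRHS]big_seq; apply: ler_sum => i.
rewrite mem_grid_seq => /set_mem gi; apply: sum_weight_grid => k.
by have /andP[h _] := gi k; apply: le_trans h.
Qed.

End lattice_sums.

(** * Inner product spaces and operator norms *)

Section inner_product.
Context (R : realType) (V : ipType R).
Implicit Types x y z : V.

Lemma dotDl x y z : dot (x + y) z = dot x z + dot y z.
Proof. by rewrite -{1}[x]scale1r dotPl mul1r. Qed.

Lemma dot0l z : dot 0 z = 0 :> R.
Proof. by apply: (addrI (dot 0 z)); rewrite -dotDl !addr0. Qed.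

Lemma dotZl a x z : dot (a *: x) z = a * dot x z.
Proof. by rewrite -[a *: x]addr0 dotPl dot0l addr0. Qed.

Lemma dotNl x z : dot (- x) z = - dot x z.
Proof. by rewrite -[- x]scaleN1r dotZl mulN1r. Qed.

Lemma dotBl x y z : dot (x - y) z = dot x z - dot y z.
Proof. by rewrite dotDl dotNl. Qed.

Lemma dotDr x y z : dot z (x + y) = dot z x + dot z y.
Proof. by rewrite dotC dotDl !(dotC z). Qed.

Lemma dotZr a x z : dot z (a *: x) = a * dot z x.
Proof. by rewrite dotC dotZl (dotC z). Qed.

Lemma dotBr x y z : dot z (x - y) = dot z x - dot z y.
Proof. by rewrite dotC dotBl !(dotC z). Qed.

Lemma dot_suml (I : Type) (r : seq I) (f : I -> V) z :
  dot (\sum_(i <- r) f i) z = \sum_(i <- r) dot (f i) z.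
Proof.
elim: r => [|i r IH]; first by rewrite !big_nil dot0l.
by rewrite !big_cons dotDl IH.
Qed.

Lemma dot_sumr (I : Type) (r : seq I) (f : I -> V) z :
  dot z (\sum_(i <- r) f i) = \sum_(i <- r) dot z (f i).
Proof. by rewrite dotC dot_suml; apply: eq_bigr => i _; rewrite dotC. Qed.

Lemma dot_ext x y : (forall z, dot x z = dot y z) -> x = y.
Proof.
move=> xy; apply/eqP; rewrite -subr_eq0; apply/eqP; apply: dot_eq0.
by rewrite dotBl xy subrr.
Qed.

Lemma ipnorm_ge0 x : 0 <= ipnorm x.
Proof. exact: sqrtr_ge0. Qed.

Lemma ipnorm_sqr x : ipnorm x ^+ 2 = dot x x.
Proof. by rewrite sqr_sqrtr// dot_ge0. Qed.

Lemma ipnorm0 : ipnorm (0 : V) = 0.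
Proof. by rewrite /ipnorm dot0l sqrtr0. Qed.

Lemma ipnorm_gt0 x : x != 0 -> 0 < ipnorm x.
Proof.
move=> x0; rewrite sqrtr_gt0 lt_neqAle dot_ge0 andbT eq_sym.
by apply: contra x0 => /eqP/dot_eq0 ->.
Qed.

Lemma dot_sqr_le x y : dot x y ^+ 2 <= dot x x * dot y y.
Proof.
have [->|y0] := eqVneq y 0; first by rewrite dotC !dot0l mulr0 expr0n.
have yy : 0 < dot y y by rewrite -ipnorm_sqr exprn_gt0// ipnorm_gt0.
have := dot_ge0 (dot y y *: x - dot x y *: y).
rewrite dotBl !dotBr !dotZl !dotZr (dotC y x).
rewrite [X in 0 <= X -> _](_ : _ = dot y y * (dot x x * dot y y - dot x y ^+ 2)); last ring.
by rewrite pmulr_rge0// subr_ge0.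
Qed.

Lemma norm_dot_le x y : `|dot x y| <= ipnorm x * ipnorm y.
Proof.
rewrite -ler_sqr ?nnegrE ?mulr_ge0 ?ipnorm_ge0// exprMn !ipnorm_sqr.
by rewrite real_normK ?num_real// dot_sqr_le.
Qed.

Lemma ipnormZ a x : ipnorm (a *: x) = `|a| * ipnorm x.
Proof. by rewrite /ipnorm dotZl dotZr mulrA -expr2 sqrtrM ?sqr_ge0// sqrtr_sqr. Qed.

Lemma ipnormN x : ipnorm (- x) = ipnorm x.
Proof. by rewrite -[- x]scaleN1r ipnormZ normrN1 mul1r. Qed.

Lemma ipnormD x y : ipnorm (x + y) <= ipnorm x + ipnorm y.
Proof.
rewrite -ler_sqr ?nnegrE ?addr_ge0 ?ipnorm_ge0// ipnorm_sqr.
rewrite dotDl !dotDr (dotC y x) sqrrD !ipnorm_sqr.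
have := le_trans (ler_norm _) (norm_dot_le x y); rewrite mulr2n.
by move: (dot x y) (_ * _) (dot x x) (dot y y) => a b c e; lra.
Qed.

Lemma ipnorm_sum (I : Type) (r : seq I) (f : I -> V) :
  ipnorm (\sum_(i <- r) f i) <= \sum_(i <- r) ipnorm (f i).
Proof.
elim: r => [|i r IH]; first by rewrite !big_nil ipnorm0.
by rewrite !big_cons (le_trans (ipnormD _ _))// lerD2l.
Qed.

Lemma ler_dist_ipnorm x y : `|ipnorm x - ipnorm y| <= ipnorm (x - y).
Proof.
have h (a b : V) : ipnorm a - ipnorm b <= ipnorm (a - b).
  by rewrite lerBlDr -{1}(subrK b a) ipnormD.
rewrite ler_norml h andbT lerNl opprB -[leRHS]ipnormN opprB; exact: h.
Qed.

End inner_product.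

Lemma sum_mul_le_sqrt (R : realType) n (a b : 'I_n -> R) :
  \sum_j a j * b j <= Num.sqrt (\sum_j a j ^+ 2) * Num.sqrt (\sum_j b j ^+ 2).
Proof.
have sq0 (f : 'I_n -> R) : 0 <= \sum_j f j ^+ 2 by apply: sumr_ge0 => j _; exact: sqr_ge0.
rewrite -sqrtrM//; apply: le_trans (ler_norm _) _.
rewrite -sqrtr_sqr ler_sqrt; last exact: mulr_ge0.
have [b0|b0] := eqVneq (\sum_j b j ^+ 2) 0.
  have bj j : b j = 0.
    apply/eqP; rewrite -sqrf_eq0; have := psumr_eq0P (fun i _ => sqr_ge0 (b i)) b0.
    by move=> /(_ j isT) ->.
  by rewrite b0 mulr0 big1 ?expr0n// => j _; rewrite bj mulr0.
have bp : 0 < \sum_j b j ^+ 2 by rewrite lt_neqAle eq_sym b0 sq0.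
set s := \sum_j a j * b j; set p := \sum_j a j ^+ 2; set q := \sum_j b j ^+ 2 in bp *.
have : 0 <= \sum_j (q * a j - s * b j) ^+ 2 by exact: sq0.
rewrite (eq_bigr (fun j => q ^+ 2 * a j ^+ 2 + (- (2 * q * s)) * (a j * b j) +
  s ^+ 2 * b j ^+ 2)); last by move=> j _; ring.
rewrite !big_split/= -!mulr_sumr -/s -/p -/q.
rewrite (_ : _ + _ = q * (p * q - s ^+ 2)); last ring.
by rewrite pmulr_rge0// subr_ge0.
Qed.

Section orthonormal.
Context (R : realType) (V : ipType R) (w : nat -> V).
Hypothesis cw : complete_orthonormal w.

Definition proj n (x : V) : V := \sum_(j < n) dot x (w j) *: w j.

Lemma dot_proj n x : dot x (proj n x) = \sum_(j < n) dot x (w j) ^+ 2.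
Proof.
by rewrite dot_sumr; apply: eq_bigr => j _; rewrite dotZr expr2.
Qed.

Lemma dot_proj_basis n x k : (k < n)%N -> dot (proj n x) (w k) = dot x (w k).
Proof.
move=> kn; rewrite dot_suml (bigD1 (Ordinal kn))//= big1 ?addr0.
  by rewrite dotZl cw.1 eqxx mulr1.
move=> j jk; rewrite dotZl cw.1 (_ : (_ == _) = false) ?mulr0//.
by apply: contraNF jk => /eqP jk; apply/eqP/val_inj.
Qed.

Lemma dot_projproj n x : dot (proj n x) (proj n x) = \sum_(j < n) dot x (w j) ^+ 2.
Proof.
rewrite {2}/proj dot_sumr; apply: eq_bigr => j _.
by rewrite dotZr dot_proj_basis// expr2.
Qed.

Lemma ipnorm_sub_proj n x :
  ipnorm (x - proj n x) ^+ 2 = dot x x - \sum_(j < n) dot x (w j) ^+ 2.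
Proof.
rewrite ipnorm_sqr dotBl !dotBr (dotC (proj n x) x) dot_proj dot_projproj; ring.
Qed.

Lemma bessel n x : \sum_(j < n) dot x (w j) ^+ 2 <= dot x x.
Proof. by rewrite -subr_ge0 -ipnorm_sub_proj sqr_ge0. Qed.

Lemma parseval x : (\sum_(0 <= j <oo) (dot x (w j) ^+ 2)%:E = (dot x x)%:E)%E.
Proof.
apply: cvg_lim => //.
have h : (fun n => dot x x - ipnorm (x - proj n x) ^+ 2) @ \oo --> dot x x.
  rewrite -[X in _ --> X]subr0; apply: cvgB; first exact: cvg_cst.
  rewrite -[X in _ --> X](mulr0 0); under eq_fun do rewrite expr2.
  by apply: cvgM; exact: cw.2.
apply: cvg_EFin; first by apply: nearW => n; rewrite sumEFin.
apply: cvg_trans h; apply: near_eq_cvg; apply: nearW => n /=.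
by rewrite ipnorm_sub_proj opprB addrC subrK sumEFin/= big_mkord.
Qed.

Definition rcomb (s : seq rat) : V := \sum_(j < size s) ratr (nth 0 s j) *: w j.

Lemma rcomb_dense x e : 0 < e -> exists s, ipnorm (rcomb s - x) < e.
Proof.
move=> e0; have e20 : 0 < e / 2 by rewrite divr_gt0.
have /cvgrPdist_lt/(_ _ e20)[n _ /(_ n (leqnn n))] := cw.2 x.
rewrite sub0r normrN ger0_norm ?ipnorm_ge0// -/(proj n x) => xn.
pose eta := e / 2 / n.+1%:R.
have eta0 : 0 < eta by rewrite divr_gt0// ltr0n.
have rat_near (c : R) : {q : rat | `|ratr q - c| < eta}.
  apply: cid; have [q] := @rat_in_itvoo R (c - eta) (c + eta) ltac:(lra).
  by rewrite in_itv/= => /andP[q1 q2]; exists q; rewrite ltr_norml; lra.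
pose q j := sval (rat_near (dot x (w j))).
exists (mkseq q n); rewrite /rcomb size_mkseq.
have -> : \sum_(j < n) ratr (nth 0 (mkseq q n) j) *: w j - x =
    \sum_(j < n) (ratr (q j) - dot x (w j)) *: w j + (proj n x - x).
  rewrite addrA; congr (_ - _); rewrite -big_split/=; apply: eq_bigr => j _.
  by rewrite nth_mkseq// scalerBl subrK.
apply: le_lt_trans (ipnormD _ _) _; rewrite -(opprB x) ipnormN.
have -> : e = e / 2 + e / 2 by lra.
apply: ler_ltD => //; apply: (le_trans (ipnorm_sum _ _)).
apply: (@le_trans _ _ (\sum_(j < n) eta)).
  apply: ler_sum => j _; rewrite ipnormZ /ipnorm cw.1 eqxx sqrtr1 mulr1.
  by apply: ltW; exact: (svalP (rat_near (dot x (w j)))).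
rewrite sumr_const card_ord -[leLHS]mulr_natr /eta -mulrA.
apply: ler_piMr; first exact: ltW.
by rewrite mulrC ler_pdivrMr ?ltr0n// mul1r ler_nat.
Qed.

End orthonormal.

Section operator_norms.
Context (R : realType) (U V : ipType R) (w : nat -> U) (A : U -> V) (B : R).
Hypothesis cw : complete_orthonormal w.
Hypothesis Alin : forall a x y, A (a *: x + y) = a *: A x + A y.
Hypothesis AB : forall x, ipnorm (A x) <= B * ipnorm x.

Let A0 : A 0 = 0.
Proof. by have := Alin (-1) 0 0; rewrite scaler0 addr0 scaleN1r addNr. Qed.

Let AsubE x y : A (x - y) = A x - A y.
Proof. by rewrite addrC -scaleN1r Alin scaleN1r addrC. Qed.

Let Asum (I : Type) (r : seq I) (c : I -> R) (f : I -> U) :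
  A (\sum_(i <- r) c i *: f i) = \sum_(i <- r) c i *: A (f i).
Proof.
elim: r => [|i r IH]; first by rewrite !big_nil.
by rewrite !big_cons Alin IH.
Qed.

Definition hs2 : \bar R := (\sum_(0 <= k <oo) (dot (A (w k)) (A (w k)))%:E)%E.

(** Strict inequalities between continuous functions of [x] persist on the
    dense set of rational combinations; this is what makes the operator norm of
    a random operator a measurable function. *)
Lemma opnorm_gt_rcomb (tau : R) : (tau%:E < opnorm A)%E <->
  exists s, tau * ipnorm (rcomb w s) < ipnorm (A (rcomb w s)).
Proof.
split=> [/ereal_sup_gt[_ [x x0 <-]]|[s hs]]; last first.
  have s0 : rcomb w s != 0.
    by apply: contraTneq hs => ->; rewrite A0 !ipnorm0 mulr0 ltxx.
  apply: lt_le_trans (ereal_sup_ubound _); last by exists (rcomb w s).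
  by rewrite lte_fin ltr_pdivlMr// ipnorm_gt0.
rewrite lte_fin ltr_pdivlMr ?ipnorm_gt0//= -subr_gt0.
set e := (X in 0 < X) => e0.
pose L := `|B| + `|tau| + 1; have L0 : 0 < L.
  by rewrite ltr_wpDl ?addr_ge0.
have [s hs] := rcomb_dense cw x (divr_gt0 e0 L0); exists s.
rewrite ltr_pdivlMr// in hs.
have h1 : ipnorm (A x) - ipnorm (A (rcomb w s)) <= `|B| * ipnorm (rcomb w s - x).
  apply: le_trans (ler_norm _) _; apply: le_trans (ler_dist_ipnorm _ _) _.
  rewrite -opprB ipnormN -AsubE; apply: (le_trans (AB _)).
  by rewrite ler_wpM2r ?ipnorm_ge0// ler_norm.
have h2 : tau * ipnorm (rcomb w s) - tau * ipnorm x <= `|tau| * ipnorm (rcomb w s - x).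
  rewrite -mulrBr; apply: le_trans (ler_norm _) _; rewrite normrM.
  by rewrite ler_wpM2l// ler_dist_ipnorm.
have h3 : 0 <= ipnorm (rcomb w s - x) by exact: ipnorm_ge0.
move: hs h1 h2; rewrite /L /e.
rewrite !mulrDr mulr1 ![ipnorm (rcomb w s - x) * `|_|]mulrC.
move: (`|B| * _) (`|tau| * _) => p q.
by lra.
Qed.

Lemma ipnorm_sqr_le_hs2 x (H : R) : hs2 = H%:E ->
  ipnorm (A x) ^+ 2 <= H * ipnorm x ^+ 2.
Proof.
move=> hsH.
have H0 : 0 <= H by rewrite -lee_fin -hsH nneseries_ge0// => k _ _; rewrite lee_fin dot_ge0.
have partial n : \sum_(k < n) dot (A (w k)) (A (w k)) <= H.
  rewrite -lee_fin -hsH -sumEFin -(big_mkord xpredT (fun k => (dot (A (w k)) (A (w k)))%:E)).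
  by apply: nneseries_lim_ge => k _ _; rewrite lee_fin dot_ge0.
have le_proj n : ipnorm (A (proj w n x)) <= Num.sqrt H * ipnorm x.
  rewrite Asum; apply: (le_trans (ipnorm_sum _ _)).
  under eq_bigr do rewrite ipnormZ.
  have := @sum_mul_le_sqrt R n (fun j => `|dot x (w j)|) (fun j => ipnorm (A (w j))).
  move=> /le_trans; apply; rewrite mulrC; apply: ler_pM; rewrite ?sqrtr_ge0//.
    by rewrite ler_sqrt//; under eq_bigr do rewrite ipnorm_sqr.
  rewrite /ipnorm ler_sqrt ?dot_ge0//; under eq_bigr do rewrite real_normK ?num_real//.
  exact: bessel.
have lim : (fun n => B * ipnorm (x - proj w n x) + Num.sqrt H * ipnorm x) @ \oo -->
    B * 0 + Num.sqrt H * ipnorm x.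
  by apply: cvgD; [apply: cvgM; [exact: cvg_cst|exact: cw.2]|exact: cvg_cst].
have h : ipnorm (A x) <= Num.sqrt H * ipnorm x.
  rewrite -[leRHS]add0r -[X in _ <= X + _](mulr0 B).
  rewrite -(cvg_lim _ lim)//; apply: limr_ge; first by apply/cvg_ex; eexists; exact: lim.
  apply: nearW => n; rewrite -{1}(subrK (proj w n x) x) -[x - _]scale1r Alin !scale1r.
  by apply: (le_trans (ipnormD _ _)); apply: lerD; [exact: AB|exact: le_proj].
rewrite -[X in _ <= X * _]sqr_sqrtr// -exprMn ler_sqr ?nnegrE ?mulr_ge0 ?ipnorm_ge0//.
Qed.

Lemma opnorm_gt_hs2 tau : 0 <= tau -> (tau%:E < opnorm A)%E -> ((tau ^+ 2)%:E <= hs2)%E.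
Proof.
move=> tau0 /ereal_sup_gt[_ [x x0 <-]].
rewrite lte_fin ltr_pdivlMr ?ipnorm_gt0//= => taux.
rewrite leNgt; apply/negP => hst.
have h0 : (0 <= hs2)%E by apply: nneseries_ge0 => k _ _; rewrite lee_fin dot_ge0.
have hfin : hs2 = (fine hs2)%:E.
  by rewrite fineK// ge0_fin_numE// (lt_trans hst)// ltry.
have := ipnorm_sqr_le_hs2 x hfin; rewrite hfin lte_fin in hst.
apply/negP; rewrite -ltNge.
apply: (@le_lt_trans _ _ ((tau * ipnorm x) ^+ 2)).
  by rewrite exprMn ler_wpM2r ?sqr_ge0// ltW.
by rewrite ltr_sqr ?nnegrE ?mulr_ge0 ?ipnorm_ge0.
Qed.

End operator_norms.

(** * Rates of convergence from second moments *)

Lemma big_iota_ord (A : Type) (idx : A) (op : A -> A -> A) n (F : nat -> A) :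
  \big[op/idx]_(i <- iota 0 n) F i = \big[op/idx]_(i < n) F i.
Proof. by rewrite -(big_mkord xpredT) /index_iota subn0. Qed.

Section random_vectors.
Context (dT : measure_display) (T : measurableType dT) (R : realType).
Variable P : probability T R.

(** In a separable space this is the same as measurability for the Borel
    sigma-algebra of the norm. *)
Definition wmeas (V : ipType R) (G : T -> V) : Prop :=
  forall h, measurable_fun setT (fun t => dot (G t) h).

Section one_space.
Context (V : ipType R) (z : nat -> V).
Hypothesis cz : complete_orthonormal z.
Variable G : T -> V.
Hypothesis mG : wmeas G.

Lemma parseval_funE : (fun t => (dot (G t) (G t))%:E) =
  (fun t => \sum_(0 <= l <oo) (dot (G t) (z l) ^+ 2)%:E)%E.
Proof. by apply/funext => t; rewrite parseval. Qed.

Lemma measurable_coef_sqr l : measurable_fun setT (fun t => (dot (G t) (z l) ^+ 2)%:E).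
Proof. by apply/measurable_EFinP; apply: measurable_funX; exact: mG. Qed.

Lemma measurable_dot_self : measurable_fun setT (fun t => dot (G t) (G t)).
Proof.
apply/measurable_EFinP; rewrite -[X in measurable_fun _ X]/(fun t => (dot (G t) (G t))%:E).
rewrite parseval_funE; apply: ge0_emeasurable_sum => [k t _ _|k _].
  by rewrite lee_fin sqr_ge0.
exact: measurable_coef_sqr.
Qed.

Lemma measurable_ipnorm : measurable_fun setT (fun t => ipnorm (G t)).
Proof.
have -> : (fun t => ipnorm (G t)) = (fun t => dot (G t) (G t) `^ 2^-1).
  by apply/funext => t; rewrite powR12_sqrt ?dot_ge0.
apply: (measurableT_comp (measurable_powR 2^-1)); exact: measurable_dot_self.
Qed.

Lemma integral_dot_self : (\int[P]_t (dot (G t) (G t))%:E =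
  \sum_(0 <= l <oo) \int[P]_t (dot (G t) (z l) ^+ 2)%:E)%E.
Proof.
rewrite parseval_funE integral_nneseries// => [l|l t _]; first exact: measurable_coef_sqr.
by rewrite lee_fin sqr_ge0.
Qed.

End one_space.

Lemma nneseries_le_bound (f : nat -> \bar R) (K : \bar R) : (forall n, 0 <= f n)%E ->
  (forall n, \sum_(k < n) f k <= K)%E -> (\sum_(0 <= k <oo) f k <= K)%E.
Proof.
move=> f0 fK; apply: lime_le; first exact: is_cvg_nneseries.
by apply: nearW => n; rewrite big_mkord.
Qed.

Section two_spaces.
Context (U V : ipType R) (w : nat -> U) (z : nat -> V).
Hypotheses (cw : complete_orthonormal w) (cz : complete_orthonormal z).
Variable D : T -> U -> V.
Hypothesis mD : forall x, wmeas (D ^~ x).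

Lemma measurable_hs2 : measurable_fun setT (fun t => hs2 w (D t)).
Proof.
apply: ge0_emeasurable_sum => [k t _ _|k _]; first by rewrite lee_fin dot_ge0.
by apply/measurable_EFinP; exact: (measurable_dot_self cz).
Qed.

Lemma integral_hs2_le (K : R) :
  (forall N, \sum_(p <- [seq (k, l) | k <- iota 0 N, l <- iota 0 N])
     \int[P]_t (dot (D t (w p.1)) (z p.2) ^+ 2)%:E <= K%:E)%E ->
  (\int[P]_t hs2 w (D t) <= K%:E)%E.
Proof.
move=> DK; rewrite integral_nneseries//; last 2 first.
- by move=> k; apply/measurable_EFinP; exact: (measurable_dot_self cz).
- by move=> k t _; rewrite lee_fin dot_ge0.
have i0 k l : (0 <= \int[P]_t (dot (D t (w k)) (z l) ^+ 2)%:E)%E.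
  by apply: integral_ge0 => t _; rewrite lee_fin sqr_ge0.
apply: nneseries_le_bound => [k|N].
  by apply: integral_ge0 => t _; rewrite lee_fin dot_ge0.
under eq_bigr => k _ do rewrite (integral_dot_self cz (mD _)).
rewrite -nneseries_sum//; apply: nneseries_le_bound => [l|M].
  by apply: sume_ge0.
(* enlarge the rectangle of indices to a square *)
pose Q := maxn N M; apply: le_trans (DK Q); rewrite big_allpairs_dep/=.
rewrite exchange_big/= big_iota_ord.
under [leRHS]eq_bigr do rewrite big_iota_ord.
apply: (@le_trans _ _ (\sum_(k < N) \sum_(l < Q)
    \int[P]_t (dot (D t (w k)) (z l) ^+ 2)%:E)%E).
  apply: lee_sum => k _; rewrite (big_ord_widen Q (fun l =>
    \int[P]_t (dot (D t (w k)) (z l) ^+ 2)%:E)%E (leq_maxr N M)).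
  by rewrite [leRHS](bigID (fun l : 'I_Q => (l < M)%N))/= leeDl// sume_ge0.
rewrite (big_ord_widen Q (fun k => \sum_(l < Q)
    \int[P]_t (dot (D t (w k)) (z l) ^+ 2)%:E)%E (leq_maxl N M)).
rewrite [leRHS](bigID (fun k : 'I_Q => (k < N)%N))/= leeDl// sume_ge0// => k _.
exact: sume_ge0.
Qed.

Lemma measurable_opnorm_gt (tau : R) (B : T -> R) :
  (forall t a x y, D t (a *: x + y) = a *: D t x + D t y) ->
  (forall t x, ipnorm (D t x) <= B t * ipnorm x) ->
  measurable [set t | (tau%:E < opnorm (D t))%E].
Proof.
move=> Dlin DB.
have -> : [set t | (tau%:E < opnorm (D t))%E] = \bigcup_(s : seq rat)
    [set t | tau * ipnorm (rcomb w s) < ipnorm (D t (rcomb w s))].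
  apply/seteqP; split => t /=.
    by move/(opnorm_gt_rcomb cw (Dlin t) (DB t)) => [s hs]; exists s.
  by move=> [s _ hs]; apply/(opnorm_gt_rcomb cw (Dlin t) (DB t)); exists s.
apply: countable_bigcupT_measurable => // s.
have := measurable_ipnorm cz (mD (rcomb w s)).
move=> /(_ measurableT _ (measurable_itv `]tau * ipnorm (rcomb w s), +oo[)).
by rewrite setTI; congr measurable; apply/seteqP; split=> t /=; rewrite in_itv/= andbT.
Qed.

End two_spaces.
End random_vectors.

Section rates_from_second_moments.
Context (dT : measure_display) (T : measurableType dT) (R : realType).
Variable P : probability T R.

Lemma prob_gt_le (nop H : T -> \bar R) (tau M : R) : 0 < tau ->
  measurable_fun setT H -> (forall t, 0 <= H t)%E ->
  measurable [set t | (tau%:E < nop t)%E] ->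
  (forall t, tau%:E < nop t -> (tau ^+ 2)%:E <= H t)%E ->
  (\int[P]_t H t <= M%:E)%E -> (P [set t | tau%:E < nop t] <= (M / tau ^+ 2)%:E)%E.
Proof.
move=> tau0 mH H0 mnop nopH HM; have tau20 : 0 < tau ^+ 2 by rewrite exprn_gt0.
have := le_integral_abse P measurableT mH tau20; rewrite setTI.
under eq_integral do rewrite gee0_abs//.
move=> /le_trans/(_ HM) h.
rewrite -(@lee_pmul2l R (tau ^+ 2)%:E)// -EFinM.
rewrite (_ : tau ^+ 2 * (M / tau ^+ 2) = M); last by field; rewrite gt_eqF.
apply: le_trans h; rewrite lee_pmul2l//.
apply: le_measure; rewrite ?inE//.
  have := mH measurableT _ (emeasurable_itv `[(tau ^+ 2)%:E, +oo[); rewrite setTI.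
  congr measurable; apply/seteqP; split=> t /=; rewrite in_itv/= andbT gee0_abs//.
by move=> t /= /nopH; rewrite gee0_abs.
Qed.

Lemma Lnorm_sqrte_le (H : T -> \bar R) (M : R) : (forall t, 0 <= H t)%E ->
  (\int[P]_t H t <= M%:E)%E ->
  ('N[P]_2%:E[@sqrte R \o H] <= (Num.sqrt M)%:E)%E.
Proof.
move=> H0 HM; rewrite unlock.
have -> : (\int[P]_t `|sqrte (H t)| `^ 2 = \int[P]_t H t)%E.
  apply: eq_integral => t _; rewrite gee0_abs ?sqrte_ge0//.
  by rewrite -poweR12_sqrt// -poweRrM mulVf// poweRe1.
have I0 : (0 <= \int[P]_t H t)%E by exact: integral_ge0.
rewrite poweR12_sqrt//.
case: (\int[P]_t H t)%E HM I0 => [r||]//=; rewrite !lee_fin => rM _.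
exact: ler_wsqrtr.
Qed.

Variable d : nat.
Hypothesis d0 : (0 < d)%N.

(** Markov's inequality gives the first rate and the square root the second; the
    logarithms only help, being at least [ln 2] as soon as all sides of the grid
    are at least 2. *)
Lemma rates_of_second_moment (C : R) (nop nhs : ('I_d -> nat) -> T -> \bar R) (K : R) :
  0 <= K ->
  (forall n, admissible C n -> (forall k, (2 <= n k)%N) -> exists H : T -> \bar R,
    [/\ measurable_fun setT H, forall t, (0 <= H t)%E,
        forall t, nhs n t = sqrte (H t),
        forall tau, 0 < tau -> measurable [set t | (tau%:E < nop n t)%E] /\
          forall t, ((tau%:E < nop n t)%E -> ((tau ^+ 2)%:E <= H t)%E) &
        (\int[P]_t H t <= (K / (vol n)%:R)%:E)%E]) ->
  rates P C nop nhs.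
Proof.
move=> K0 hn.
have ln20 : 0 < ln 2 :> R by rewrite ln_gt0// ltr1n.
have vol2 (n : 'I_d -> nat) : (forall k, (2 <= n k)%N) -> (2 <= vol n)%N.
  move=> n2; rewrite /vol (bigD1 (Ordinal d0))//= -[2%N]muln1 leq_mul//.
  by apply: prodn_gt0 => k; apply: leq_trans (n2 k).
have lnvol (n : 'I_d -> nat) : (forall k, (2 <= n k)%N) -> 1 <= ln (vol n)%:R / ln 2 :> R.
  move=> /vol2 h; rewrite ler_pdivlMr// mul1r ler_ln ?posrE ?ltr0n ?ler_nat//.
  exact: leq_trans h.
split=> [tau tau0|].
  exists (K / tau ^+ 2 / ln 2); exists 2%N.
  move=> n an n2.
  have [H [mH H0 _ /(_ tau tau0)[mtau tauH] HK]] := hn n an n2.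
  apply: (le_trans (prob_gt_le tau0 mH H0 mtau tauH HK)); rewrite lee_fin.
  have -> : K / tau ^+ 2 / ln 2 * (ln (vol n)%:R / (vol n)%:R) =
      K / (vol n)%:R / tau ^+ 2 * (ln (vol n)%:R / ln 2) by ring.
  by rewrite ler_peMr ?lnvol// !mulr_ge0// invr_ge0 ?sqr_ge0.
exists (Num.sqrt K / ln 2); exists 2%N.
  move=> n an n2.
have [H [mH H0 nhsE _ HK]] := hn n an n2.
have -> : nhs n = @sqrte R \o H by apply/funext.
apply: (le_trans (Lnorm_sqrte_le H0 HK)); rewrite lee_fin sqrtrM// sqrtrV//.
have -> : Num.sqrt K / ln 2 * (ln (vol n)%:R / Num.sqrt (vol n)%:R) =
   Num.sqrt K / Num.sqrt (vol n)%:R * (ln (vol n)%:R / ln 2) by ring.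
by rewrite ler_peMr ?lnvol// mulr_ge0 ?invr_ge0 ?sqrtr_ge0.
Qed.

End rates_from_second_moments.

(** * Averages of functions of the regressors *)

Lemma ae_forall_in (dT : measure_display) (T : measurableType dT) (R : realType)
    (P : probability T R) (I : eqType) (s : seq I) (Q : I -> T -> Prop) :
  {in s, forall i, {ae P, forall t, Q i t}} ->
  {ae P, forall t, {in s, forall i, Q i t}}.
Proof.
elim: s => [|i s IH] Qs; first exact: aeW.
have Qi := Qs i (mem_head _ _).
have : {ae P, forall t, {in s, forall i, Q i t}}.
  by apply: IH => j js; apply: Qs; rewrite inE js orbT.
by apply: filterS2 Qi => t Qit Qst j; rewrite inE => /orP[/eqP ->//|]; exact: Qst.
Qed.

Section sobolev_borel.
Variable R : realType.

(** The sigma-algebra of the Sobolev space is generated by the sets that are open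
    for the norm, and the superlevel sets of a Lipschitz function are such. *)
Lemma measurable_lipschitz (f : H1_01 R -> R) (L : R) :
  (forall x y, `|f x - f y| <= L * ipnorm (x - y)) -> measurable_fun setT f.
Proof.
move=> fL; apply: (measurability _ (RGenOInfty.measurableE R)) => //.
move=> _ [_ [c ->] <-]; rewrite setTI; apply: sub_sigma_algebra => x /=.
rewrite in_itv/= andbT => cx.
pose M := `|L| + 1; have M0 : 0 < M by rewrite ltr_wpDl.
exists ((f x - c) / M) => [|y]; first by rewrite divr_gt0 ?subr_gt0.
rewrite ltr_pdivlMr// => yx; rewrite in_itv/= andbT.
have h1 : f x - f y <= L * ipnorm (y - x).
  by rewrite -[y - x]opprB ipnormN; apply: le_trans (ler_norm _) (fL _ _).
have h2 : L * ipnorm (y - x) <= ipnorm (y - x) * M.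
  rewrite mulrC ler_wpM2l ?ipnorm_ge0// /M.
  by apply: (le_trans (ler_norm _)); rewrite lerDl.
by have := le_lt_trans (le_trans h1 h2) yx; lra.
Qed.

Lemma measurable_dot (h : H1_01 R) : measurable_fun setT (fun x : H1_01 R => dot x h).
Proof.
apply: (@measurable_lipschitz _ (ipnorm h)) => x y.
by rewrite -dotBl mulrC norm_dot_le.
Qed.

Lemma measurable_H1_ipnorm : measurable_fun setT (@ipnorm R (H1_01 R)).
Proof. by apply: (@measurable_lipschitz _ 1) => x y; rewrite mul1r ler_dist_ipnorm. Qed.

Lemma ipnorm_H1_deriv (x : H1_01 R) : ipnorm (H1_deriv x) <= ipnorm x.
Proof.
by apply: ler_wsqrtr; rewrite -[leRHS]/(dot x.1 x.1 + dot (H1_deriv x) (H1_deriv x)) lerDr dot_ge0.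
Qed.

Definition hball (C : R) : set (H1_01 R) := [set x | ipnorm x <= C].

Lemma measurable_hball C : measurable (hball C).
Proof.
have := measurable_H1_ipnorm measurableT (measurable_itv `]-oo, C]).
by rewrite setTI; congr measurable; apply/seteqP; split=> x /=; rewrite in_itv.
Qed.

(** Bounds that hold almost surely are turned into bounds that hold everywhere
    by truncating functions of the regressor outside a ball. *)
Definition ball_trunc (C : R) (f : H1_01 R -> R) (x : H1_01 R) : R :=
  \1_(hball C) x * f x.

Lemma ball_trunc_in C (f : H1_01 R -> R) x : ipnorm x <= C -> ball_trunc C f x = f x.
Proof.
by move=> xC; rewrite /ball_trunc indicE (mem_set (xC : hball C x)) mul1r.
Qed.

Lemma ball_trunc_out C (f : H1_01 R -> R) x : C < ipnorm x -> ball_trunc C f x = 0.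
Proof.
move=> Cx; rewrite /ball_trunc indicE memNset ?mul0r// => /(lt_le_trans Cx).
by rewrite ltxx.
Qed.

Lemma bmeas_ball_trunc C (f : H1_01 R -> R) : measurable_fun setT f ->
  (exists M, forall x, ipnorm x <= C -> `|f x| <= M) -> bmeas (ball_trunc C f).
Proof.
move=> mf [M fM]; split.
  by apply: measurable_funM => //; apply: measurable_indic; exact: measurable_hball.
exists `|M| => x; have [xC|Cx] := leP (ipnorm x) C.
  by rewrite ball_trunc_in// (le_trans (fM _ xC))// ler_norm.
by rewrite ball_trunc_out// normr0.
Qed.

Lemma sum_ball_trunc_sqr C (K : Type) (r : seq K) (f : K -> H1_01 R -> R) A :
  (forall x, ipnorm x <= C -> \sum_(k <- r) f k x ^+ 2 <= A ^+ 2) ->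
  forall x, \sum_(k <- r) ball_trunc C (f k) x ^+ 2 <= A ^+ 2.
Proof.
move=> fA x; have [xC|Cx] := leP (ipnorm x) C.
  by under eq_bigr do rewrite ball_trunc_in//; exact: fA.
by under eq_bigr do rewrite ball_trunc_out// expr0n/=; rewrite big1 ?sqr_ge0.
Qed.

End sobolev_borel.

Section averages.
Context (dT : measure_display) (T : measurableType dT) (R : realType).
Variable P : probability T R.
Variables (d : nat) (X : site d -> {RV P >-> H1_01 R}).
Variables (C Ka : R).
Hypothesis Ka0 : 0 <= Ka.
Hypothesis mixX : forall i j, mixing_le P (X i) (X j) (Ka * weight R i j).

Let mX i : measurable_fun setT (X i).
Proof. exact: measurable_funPT. Qed.

Lemma Ex_le_on_ball (f : H1_01 R -> R) i M : {ae P, forall t, ipnorm (X i t) <= C} ->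
  measurable_fun setT f -> 0 <= M -> (forall x, ipnorm x <= C -> f x <= M) ->
  (exists N, forall x, ipnorm x <= C -> `|f x| <= N) ->
  Ex P (f \o X i) <= M.
Proof.
move=> XC mf M0 fM fN; have bt := bmeas_ball_trunc mf fN.
rewrite (@ae_eq_Ex _ _ _ P _ (ball_trunc C f \o X i)); last 3 first.
- exact: measurableT_comp.
- exact: (bmeas_comp (mX i) bt).1.
- by apply: filterS XC => t Xt /=; rewrite ball_trunc_in.
rewrite -[leRHS](Ex_cst P); apply: le_Ex.
- by apply: bmeas_integrable; exact: bmeas_comp.
- by apply: bmeas_integrable; exact: bmeas_cst.
move=> t /=; have [xC|Cx] := leP (ipnorm (X i t)) C.
  by rewrite ball_trunc_in// fM.
by rewrite ball_trunc_out.
Qed.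

Lemma integrable_on_ball (f : H1_01 R -> R) i : {ae P, forall t, ipnorm (X i t) <= C} ->
  measurable_fun setT f -> (exists N, forall x, ipnorm x <= C -> `|f x| <= N) ->
  P.-integrable setT (EFin \o (f \o X i)).
Proof.
move=> XC mf fN; have bt := bmeas_ball_trunc mf fN.
apply: (@ae_eq_integrable _ _ _ P _ (ball_trunc C f \o X i)).
- exact: measurableT_comp.
- by apply: bmeas_integrable; exact: bmeas_comp.
- by apply: filterS XC => t Xt /=; rewrite ball_trunc_in.
Qed.

(** The real numbers [f k x] are the coordinates of a vector of norm at most [A]
    attached to the regressor, and [m] those of its mean. *)
Lemma avg_second_moment (s : seq (site d)) (K : Type) (r : seq K)
    (f : K -> H1_01 R -> R) (m : K -> R) (A W : R) :
  {in s, forall i, {ae P, forall t, ipnorm (X i t) <= C}} ->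
  0 < A -> (forall k, measurable_fun setT (f k)) ->
  (forall k, exists M, forall x, ipnorm x <= C -> `|f k x| <= M) ->
  (forall x, ipnorm x <= C -> \sum_(k <- r) f k x ^+ 2 <= A ^+ 2) ->
  {in s, forall i k, Ex P (f k \o X i) = m k} ->
  (0 < size s)%N ->
  \sum_(i <- s) \sum_(j <- s) weight R i j <= (size s)%:R * W ->
  (\sum_(k <- r) \int[P]_t
     (((size s)%:R^-1 * \sum_(i <- s) (f k (X i t) - m k)) ^+ 2)%:E
   <= (A ^+ 2 * 32 * Ka * W / (size s)%:R)%:E)%E.
Proof.
move=> XC A0 mf fM fA fm s0 sW; set v := (size s)%:R.
have v0 : 0 < v :> R by rewrite ltr0n.
have bt k : bmeas (ball_trunc C (f k)) by exact: bmeas_ball_trunc.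
have btX k i : bmeas (ball_trunc C (f k) \o X i) by exact: bmeas_comp.
have bS k : bmeas (fun t => (\sum_(i <- s) (ball_trunc C (f k) (X i t) - m k)) ^+ 2).
  have bS1 : bmeas (fun t => \sum_(i <- s) (ball_trunc C (f k) (X i t) - m k)).
    by apply: bmeas_sum => i; apply: bmeasB; [exact: btX|exact: bmeas_cst].
  by under eq_fun do rewrite expr2; exact: bmeasM.
have XCs : {ae P, forall t, {in s, forall i, ipnorm (X i t) <= C}}.
  exact: ae_forall_in.
have eqF k : (\int[P]_t ((v^-1 * \sum_(i <- s) (f k (X i t) - m k)) ^+ 2)%:E =
    (v^-1 ^+ 2 * Ex P (fun t => (\sum_(i <- s) (ball_trunc C (f k) (X i t) - m k)) ^+ 2))%:E)%E.
  rewrite -ExZ; last exact: bmeas_integrable.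
  rewrite /Ex /Rintegral fineK; last first.
    by apply: integrable_fin_num => //; apply: bmeas_integrable; exact: bmeasZ.
  apply: ae_eq_integral => //.
  - apply/measurable_EFinP; apply: measurable_funX; apply: measurable_funM => //.
    apply: measurable_sum => i; apply: measurable_funB => //.
    exact: measurableT_comp.
  - by apply/measurable_EFinP; exact: (bmeasZ _ (bS k)).1.
  - apply: filterS XCs => t Xt _; congr EFin; rewrite exprMn; congr (_ * _ ^+ 2).
    rewrite big_seq [RHS]big_seq; apply: eq_bigr => i si; congr (_ - _).
    by rewrite ball_trunc_in// Xt.
under eq_bigr do rewrite eqF.
rewrite sumEFin lee_fin -mulr_sumr.
have key := @variance_sum_mixing _ _ _ P _ _ _ s _ r X
  (fun i j => Ka * weight R i j) (fun k => ball_trunc C (f k)) m A mX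
  (fun i j _ _ => mixX i j) A0 bt.
apply: (@le_trans _ _ (v^-1 ^+ 2 * (A ^+ 2 * (32 * (Ka * (v * W)))))).
  rewrite ler_wpM2l ?sqr_ge0//; apply: le_trans (key _ _) _.
  - exact: sum_ball_trunc_sqr.
  - move=> i si k; rewrite -(fm i si k); apply: ae_eq_Ex => //.
    + exact: (btX k i).1.
    + exact: measurableT_comp.
    + by apply: filterS (XC i si) => t Xt /=; rewrite ball_trunc_in.
  - rewrite ler_wpM2l ?sqr_ge0// ler_wpM2l//.
    under eq_bigr do rewrite -mulr_sumr.
    by rewrite -mulr_sumr ler_wpM2l.
by rewrite le_eqVlt; apply/orP; left; apply/eqP; field; rewrite gt_eqF.
Qed.

End averages.

(** * Operator estimators *)

Section grid_averages.
Context (R : realType) (d : nat).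

Lemma size_grid_seq1 (n : 'I_d -> nat) : size (grid_seq 1 n) = vol n.
Proof. by rewrite size_grid_seq//; apply: eq_bigr => k _; rewrite subn1. Qed.

Lemma size_grid_seq2 (n : 'I_d -> nat) : size (grid_seq 2 n) = vol1 n.
Proof. by rewrite size_grid_seq//; apply: eq_bigr => k _; rewrite subSS. Qed.

Lemma avgE (V : ipType R) (n : 'I_d -> nat) (F : site d -> V) :
  avg n F = (vol n)%:R^-1 *: \sum_(i <- grid_seq 1 n) F i.
Proof. by rewrite /avg -fsbig_grid. Qed.

Lemma avg1E (V : ipType R) (n : 'I_d -> nat) (F : site d -> V) :
  avg1 n F = (vol1 n)%:R^-1 *: \sum_(i <- grid_seq 2 n) F i.
Proof. by rewrite /avg1 -fsbig_grid. Qed.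

Lemma sub_grid_seq l (n : 'I_d -> nat) i : (0 < l)%N -> i \in grid_seq l n -> grid 1 n i.
Proof.
move=> l0; rewrite mem_grid_seq => /set_mem gi k.
by have /andP[lk ->] := gi k; rewrite andbT; apply: le_trans lk; rewrite lez_nat.
Qed.

Lemma vol_gt0 (n : 'I_d -> nat) : (forall k, (0 < n k)%N) -> (0 < vol n)%N.
Proof. by move=> n0; exact: prodn_gt0. Qed.

Lemma avg_sub_const (s : seq (site d)) (F : site d -> R) (m : R) : (0 < size s)%N ->
  (size s)%:R^-1 * \sum_(i <- s) (F i - m) =
  (size s)%:R^-1 * \sum_(i <- s) F i - m.
Proof.
move=> s0; rewrite sumrB mulrBr big_const_seq count_predT iter_addr addr0.
by rewrite -[m *+ _]mulr_natl mulKf// pnatr_eq0 -lt0n.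
Qed.

End grid_averages.

Section operator_rates.
Context (dT : measure_display) (T : measurableType dT) (R : realType).
Variable P : probability T R.
Variables (d : nat) (Cn : R) (X : site d -> {RV P >-> H1_01 R}).
Variables (C Ka : R).
Hypothesis d0 : (0 < d)%N.
Hypothesis C0 : 0 < C.
Hypothesis Ka0 : 0 <= Ka.
Hypothesis mixX : forall i j, mixing_le P (X i) (X j) (Ka * weight R i j).
Hypothesis XC : forall n, admissible Cn n -> forall i, grid 1 n i ->
  {ae P, forall t, ipnorm (X i t) <= C}.

(** With the identity and the derivation for [p] and [q] this covers the four
    operators.  The limit [L], known only through its matrix coefficients, is
    linear and bounded because these are the means of those of bounded tensors. *)
Lemma op_rates_tensor (U V : ipType R) (w : nat -> U) (z : nat -> V)
    (p : H1_01 R -> U) (q : H1_01 R -> V) (L : U -> V) :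
  complete_orthonormal w -> complete_orthonormal z ->
  (forall h, measurable_fun setT (fun x => dot (p x) h)) ->
  (forall h, measurable_fun setT (fun x => dot (q x) h)) ->
  (forall x, ipnorm (p x) <= ipnorm x) -> (forall x, ipnorm (q x) <= ipnorm x) ->
  (forall n, admissible Cn n -> forall i, grid 1 n i -> forall h k,
    Ex P (fun t => dot (p (X i t)) h * dot (q (X i t)) k) = dot (L h) k) ->
  op_rates P Cn w (fun n t h => avg n (fun i => tensor (p (X i t)) (q (X i t)) h)) L.
Proof.
move=> cw cz mp mq np nq hL.
pose g h k x := dot (p x) h * dot (q x) k.
have mg h k : measurable_fun setT (g h k) by apply: measurable_funM.
have gC h k x : ipnorm x <= C -> `|g h k x| <= C ^+ 2 * (ipnorm h * ipnorm k).
  move=> xC; rewrite normrM.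
  apply: (@le_trans _ _ ((C * ipnorm h) * (C * ipnorm k))); last first.
    by rewrite le_eqVlt; apply/orP; left; apply/eqP; ring.
  apply: ler_pM => //; apply: (le_trans (norm_dot_le _ _)).
    by rewrite ler_wpM2r ?ipnorm_ge0// (le_trans (np _)).
  by rewrite ler_wpM2r ?ipnorm_ge0// (le_trans (nq _)).
apply: (@rates_of_second_moment _ _ _ _ _ d0 _ _ _ ((C ^+ 2) ^+ 2 * 32 * Ka * 3 ^+ d)).
  by rewrite !mulr_ge0 ?sqr_ge0 ?exprn_ge0 // ltW.
move=> n an n2.
pose s := grid_seq 1 n.
have sgrid i : i \in s -> grid 1 n i by exact: sub_grid_seq.
have s0 : (0 < size s)%N by rewrite size_grid_seq1 vol_gt0//; case: an.
have v0 : 0 < (vol n)%:R :> R by rewrite ltr0n -size_grid_seq1.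
have [i0 i0s] : exists i0, i0 \in s by case: s s0 {sgrid} => // i s' _; exists i; rewrite mem_head.
have hLi := hL n an _ (sgrid _ i0s); have XCi := XC an (sgrid _ i0s).
have Llin a x y : L (a *: x + y) = a *: L x + L y.
  apply: dot_ext => k; rewrite dotDl dotZl -!hLi.
  rewrite -ExZ; last by apply: (integrable_on_ball XCi (mg x k)); eexists => z'; exact: gC.
  rewrite -ExD.
  - by congr Ex; apply/funext => t; rewrite dotDr dotZr; ring.
  - apply: (integrable_on_ball XCi (f := fun x' => a * g x k x')).
      exact: measurable_funM.
    exists (`|a| * (C ^+ 2 * (ipnorm x * ipnorm k))) => x' xC.
    by rewrite normrM ler_wpM2l// gC.
  - by apply: (integrable_on_ball XCi (mg y k)); eexists => z'; exact: gC.
have LB x : ipnorm (L x) <= C ^+ 2 * ipnorm x.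
  have [Lx0|Lx0] := eqVneq (L x) 0.
    by rewrite Lx0 ipnorm0 mulr_ge0 ?sqr_ge0 ?ipnorm_ge0.
  have lx := ipnorm_gt0 Lx0.
  rewrite -(ler_pM2r lx) -expr2 ipnorm_sqr -hLi -mulrA.
  apply: (Ex_le_on_ball XCi (mg x (L x))).
  - by rewrite !mulr_ge0 ?ipnorm_ge0 // ltW.
  - by move=> y yC; apply: le_trans (ler_norm _) (gC _ _ _ yC).
  - by eexists => y; exact: gC.
pose D t h := avg n (fun i => tensor (p (X i t)) (q (X i t)) h) - L h.
have dotD t h k : dot (D t h) k =
    (size s)%:R^-1 * \sum_(i <- s) (g h k (X i t) - dot (L h) k).
  rewrite avg_sub_const// dotBl avgE dotZl dot_suml size_grid_seq1.
  by congr (_ * _ - _); apply: eq_bigr => i _; rewrite dotZl.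
have mD h : wmeas (D ^~ h).
  move=> k; under eq_fun do rewrite dotD.
  apply: measurable_funM => //; apply: measurable_sum => i.
  apply: measurable_funB => //; apply: measurableT_comp => //; exact: mg.
exists (fun t => hs2 w (D t)); split.
- exact: (measurable_hs2 w cz mD).
- by move=> t; apply: nneseries_ge0 => k _ _; rewrite lee_fin dot_ge0.
- by [].
- move=> tau tau0.
  have Dlin t a x y : D t (a *: x + y) = a *: D t x + D t y.
    apply: dot_ext => k; rewrite [in RHS]dotDl [in RHS]dotZl !dotD !avg_sub_const// Llin dotDl dotZl.
    have -> : \sum_(i <- s) g (a *: x + y) k (X i t) =
        a * \sum_(i <- s) g x k (X i t) + \sum_(i <- s) g y k (X i t).
      rewrite mulr_sumr -big_split/=; apply: eq_bigr => i _.
      by rewrite /g dotDr dotZr; ring.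
    ring.
  pose B t := (vol n)%:R^-1 * \sum_(i <- s) ipnorm (X i t) ^+ 2 + C ^+ 2.
  have DB t x : ipnorm (D t x) <= B t * ipnorm x.
    apply: (le_trans (ipnormD _ _)); rewrite ipnormN mulrDl; apply: lerD => //.
    rewrite avgE ipnormZ ger0_norm ?invr_ge0// -mulrA ler_wpM2l ?invr_ge0//.
    apply: (le_trans (ipnorm_sum _ _)); rewrite mulr_suml; apply: ler_sum => i _.
    rewrite ipnormZ; apply: (le_trans (ler_wpM2r (ipnorm_ge0 _) (norm_dot_le _ _))).
    rewrite mulrAC ler_wpM2r ?ipnorm_ge0// expr2.
    by apply: ler_pM; rewrite ?ipnorm_ge0.
  split; first exact: (measurable_opnorm_gt cw cz mD _ Dlin DB).
  by move=> t; exact: (opnorm_gt_hs2 cw (Dlin t) (DB t) (ltW tau0)).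
- apply: (integral_hs2_le cz mD) => N.
  under eq_bigr do under eq_integral do rewrite dotD.
  rewrite -size_grid_seq1.
  apply: (@avg_second_moment _ _ _ P _ X C Ka Ka0 mixX s _ _
    (fun kl => g (w kl.1) (z kl.2)) (fun kl => dot (L (w kl.1)) (z kl.2)) (C ^+ 2) (3 ^+ d)).
  + by move=> i si; exact: (XC an (sgrid _ si)).
  + by rewrite exprn_gt0.
  + by move=> kl; exact: mg.
  + by move=> kl; eexists => x; exact: gC.
  + move=> x xC; rewrite big_allpairs_dep/=.
    rewrite big_iota_ord; under eq_bigr do rewrite big_iota_ord.
    under eq_bigr => k _ do (under eq_bigr do rewrite exprMn); rewrite -/(_ ^+ 2).
    under eq_bigr do rewrite -mulr_sumr.
    rewrite -mulr_suml expr2; apply: ler_pM.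
    * by apply: sumr_ge0 => k _; exact: sqr_ge0.
    * by apply: sumr_ge0 => k _; exact: sqr_ge0.
    * apply: (le_trans (bessel cw N (p x))); rewrite -ipnorm_sqr.
      by rewrite lerXn2r ?nnegrE ?ipnorm_ge0 ?(ltW C0)// (le_trans (np _)).
    * apply: (le_trans (bessel cz N (q x))); rewrite -ipnorm_sqr.
      by rewrite lerXn2r ?nnegrE ?ipnorm_ge0 ?(ltW C0)// (le_trans (nq _)).
  + by move=> i si kl; exact: (hL n an i (sgrid _ si)).
  + by [].
  + exact: sum_weight_grid2.
Qed.

End operator_rates.

(** * Products with independent noise *)

Section independent_products.
Context (dT : measure_display) (T : measurableType dT) (R : realType).
Variable P : probability T R.

Lemma integrable_mul_bounded (F G : T -> R) : bmeas F ->
  P.-integrable setT (EFin \o G) -> P.-integrable setT (EFin \o (fun t => F t * G t)).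
Proof.
move=> [mF [M FM]] iG; apply: (integrableMr measurableT mF _ iG).
by exists M; split; [exact: num_real|move=> r Mr x _; apply: le_trans (FM x) (ltW Mr)].
Qed.

Lemma Ex_sum_in (I : eqType) (s : seq I) (F : I -> T -> R) :
  {in s, forall i, P.-integrable setT (EFin \o F i)} ->
  P.-integrable setT (EFin \o (fun t => \sum_(i <- s) F i t)) /\
  Ex P (fun t => \sum_(i <- s) F i t) = \sum_(i <- s) Ex P (F i).
Proof.
elim: s => [|i s IH] iF.
  under [X in EFin \o X]eq_fun do rewrite big_nil.
  under [X in Ex P X]eq_fun do rewrite big_nil.
  by rewrite Ex_cst big_nil; split=> //; apply: bmeas_integrable; exact: bmeas_cst.
have iFi := iF i (mem_head _ _).
have [isum Es] : P.-integrable setT (EFin \o (fun t => \sum_(i <- s) F i t)) /\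
    Ex P (fun t => \sum_(i <- s) F i t) = \sum_(i <- s) Ex P (F i).
  by apply: IH => j js; apply: iF; rewrite inE js orbT.
under [X in EFin \o X]eq_fun do rewrite big_cons.
under [X in Ex P X]eq_fun do rewrite big_cons.
split; last by rewrite ExD// Es big_cons.
by have := integrableD measurableT iFi isum.
Qed.

Lemma clamp_id (M z : R) : `|z| <= M -> clamp M z = z.
Proof.
by rewrite ler_norml => /andP[h1 h2]; rewrite /clamp (min_idPr h2) (max_idPr h1).
Qed.

Lemma clamp_norm_le (M z : R) : 0 <= M -> `|clamp M z| <= `|z|.
Proof.
move=> M0; rewrite -ler_sqr ?nnegrE// !real_normK ?num_real//; exact: clamp_sqr_le.
Qed.

Lemma Ex_clamp_cvg (G : T -> R) : P.-integrable setT (EFin \o G) ->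
  forall e, 0 < e -> exists2 M, 0 < M & Ex P (fun t => `|clamp M (G t) - G t|) <= e.
Proof.
move=> iG e e0; have mG : measurable_fun setT G.
  by apply/measurable_EFinP; exact: measurable_int iG.
have mc M : measurable_fun setT (fun t => clamp M (G t)).
  by apply: measurable_maxr => //; exact: measurable_minr.
have mcE n : measurable_fun setT (fun t => (clamp n.+1%:R (G t))%:E).
  by apply/measurable_EFinP; exact: mc.
have mGE : measurable_fun setT (EFin \o G) by exact/measurable_EFinP.
have cvgc : {ae P, forall t, setT t ->
    (clamp n.+1%:R (G t))%:E @[n --> \oo] --> (EFin \o G) t}.
  apply: aeW => t _; apply: cvg_near_cst; exists (Num.truncn `|G t|) => // n /= Gn.
  congr EFin; apply: clamp_id; apply: ltW; apply: lt_le_trans (truncnS_gt _) _.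
  by rewrite ler_nat.
have dom : {ae P, forall t (n : nat), setT t ->
    (`|(clamp n.+1%:R (G t))%:E| <= `|(EFin \o G) t|)%E}.
  by apply: aeW => t n _; rewrite /= lee_fin clamp_norm_le.
have [_ h _] := dominated_convergence measurableT mcE mGE cvgc (integrable_norm iG) dom.
have /fine_cvgP[_ /cvgrPdist_le/(_ _ e0)[n _ /(_ n (leqnn n))]] := h.
rewrite /= sub0r normrN => hn; exists n.+1%:R; first by rewrite ltr0n.
by apply: le_trans (ler_norm _) hn.
Qed.

(** A mixing bound 0 is independence.  The covariance inequality needs bounded
    functions, so [g] is first truncated. *)
Lemma indep_Ex_mul d1 d2 (S1 : measurableType d1) (S2 : measurableType d2)
    (U : T -> S1) (V : T -> S2) (f : S1 -> R) (g : S2 -> R) :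
  measurable_fun setT U -> measurable_fun setT V -> mixing_le P U V 0 ->
  bmeas f -> measurable_fun setT g -> P.-integrable setT (EFin \o (g \o V)) ->
  Ex P (fun t => f (U t) * g (V t)) = Ex P (f \o U) * Ex P (g \o V).
Proof.
move=> mU mV UV bf mg ig; have [mf [M fM]] := bf.
have M0 : 0 <= M.
  have [t|e] := pselect (exists t : T, True).
    by case: t => t _; exact: le_trans (normr_ge0 _) (fM (U t)).
  have : P setT = 0%E.
    rewrite (_ : setT = set0) ?measure0//; apply/seteqP; split => // t _.
    by case: e; exists t.
  by rewrite probability_setT => /eqP; rewrite onee_eq0.
have bfU : bmeas (f \o U) by exact: bmeas_comp.
apply/eqP; rewrite -subr_eq0 -normr_le0; apply/ler_addgt0Pr => e e0; rewrite add0r.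
pose K := 2 * (M + 1); have K0 : 0 < K by rewrite mulr_gt0// ltr_wpDl.
have [N N0 hN] := Ex_clamp_cvg ig (divr_gt0 e0 K0).
pose gN y := clamp N (g y).
have bgN : bmeas gN.
  split; first by apply: measurable_maxr => //; exact: measurable_minr.
  by exists N => y; apply: clamp_le; exact: ltW.
have bgNV : bmeas (gN \o V) by exact: bmeas_comp.
have c0 : cov P (f \o U) (gN \o V) = 0.
  apply/eqP; rewrite -normr_le0.
  have fM1 x : `|f x| <= M + 1 by apply: le_trans (fM x) _; rewrite lerDl.
  have := @cov_mixing _ _ _ P _ _ _ _ U V 0 mU mV UV f gN (M + 1) N mf bgN.1 _ N0 fM1
    (fun y => clamp_le _ (ltW N0)).
  by rewrite mulr0; apply; rewrite ltr_wpDl.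
have idiff : P.-integrable setT (EFin \o (fun t => gN (V t) - g (V t))).
  have -> : EFin \o (fun t => gN (V t) - g (V t)) =
      ((EFin \o (gN \o V)) \- (EFin \o (g \o V)))%E by apply/funext.
  by apply: integrableB => //; exact: bmeas_integrable.
have E1 : Ex P (fun t => f (U t) * gN (V t)) - Ex P (fun t => f (U t) * g (V t)) =
    Ex P (fun t => f (U t) * (gN (V t) - g (V t))).
  apply/eqP; rewrite subr_eq; apply/eqP; rewrite -ExD.
  - by congr Ex; apply/funext => t; ring.
  - exact: integrable_mul_bounded.
  - exact: integrable_mul_bounded.
have E2 : Ex P (gN \o V) - Ex P (g \o V) = Ex P (fun t => gN (V t) - g (V t)).
  apply/eqP; rewrite subr_eq; apply/eqP; rewrite -ExD//.
  by congr Ex; apply/funext => t; rewrite subrK.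
have ExM : Ex P (fun t => M * `|gN (V t) - g (V t)|) <= M * (e / K).
  rewrite ExZ; last exact: (integrable_norm idiff).
  by rewrite ler_wpM2l.
have b1 : `|Ex P (fun t => f (U t) * (gN (V t) - g (V t)))| <= M * (e / K).
  have ip := integrable_mul_bounded bfU idiff.
  apply: (le_trans (Ex_norm ip)); apply: le_trans ExM; apply: le_Ex.
  - exact: (integrable_norm ip).
  - apply: (@integrable_mul_bounded (fun=> M) (fun t => `|gN (V t) - g (V t)|)).
      exact: bmeas_cst.
    exact: (integrable_norm idiff).
  - by move=> t; rewrite normrM ler_wpM2r// fM.
have b2 : `|Ex P (f \o U) * Ex P (fun t => gN (V t) - g (V t))| <= M * (e / K).
  rewrite normrM; apply: ler_pM => //.
    apply: (le_trans (Ex_norm (bmeas_integrable P bfU))).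
    rewrite -[leRHS](Ex_cst P); apply: le_Ex.
    - exact: (integrable_norm (bmeas_integrable P bfU)).
    - by apply: bmeas_integrable; exact: bmeas_cst.
    - by move=> t; exact: fM.
  exact: le_trans (Ex_norm idiff) hN.
have -> : Ex P (fun t => f (U t) * g (V t)) - Ex P (f \o U) * Ex P (g \o V) =
  Ex P (f \o U) * Ex P (fun t => gN (V t) - g (V t)) -
  Ex P (fun t => f (U t) * (gN (V t) - g (V t))).
  rewrite -E1 -E2; move: c0; rewrite /cov /=.
  by move=> /eqP; rewrite subr_eq0 => /eqP ->; ring.
apply: (le_trans (ler_normB _ _)).
apply: (@le_trans _ _ (M * (e / K) + M * (e / K))); first exact: lerD.
have M1 : 0 < M + 1 by rewrite ltr_wpDl.
have -> : M * (e / K) + M * (e / K) = e * (M / (M + 1)).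
  by rewrite /K; field; rewrite gt_eqF.
by rewrite ler_piMr ?(ltW e0)// ler_pdivrMr// mul1r lerDl.
Qed.

End independent_products.

(** * Vector estimators *)

Section vector_rates.
Context (dT : measure_display) (T : measurableType dT) (R : realType).
Variable P : probability T R.
Variables (d : nat) (Cn : R) (X : site d -> {RV P >-> H1_01 R}).
Variables (Y eps : site d -> {RV P >-> R}).
Variables (C Ka sigma2 Ke c0 : R) (psi : H1_01 R).
Hypothesis d0 : (0 < d)%N.
Hypothesis C0 : 0 < C.
Hypothesis Ka0 : 0 <= Ka.
Hypothesis mixX : forall i j, mixing_le P (X i) (X j) (Ka * weight R i j).
Hypothesis XC : forall n, admissible Cn n -> forall i, grid 1 n i ->
  {ae P, forall t, ipnorm (X i t) <= C}.
Hypothesis Ke0 : 0 <= Ke.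
Hypothesis ieps : forall n, admissible Cn n -> forall i j, grid 1 n i -> grid 1 n j ->
  P.-integrable setT (EFin \o (fun t => eps i t * eps j t)).
Hypothesis epsK : forall n, admissible Cn n -> forall i j, grid 1 n i -> grid 1 n j ->
  0 <= Ex P (fun t => eps i t * eps j t) <= Ke * weight R i j.
Hypothesis indXeps : forall n, admissible Cn n ->
  forall i j, grid 1 n i -> grid 1 n j ->
  mixing_le P (fun t => (X i t, X j t)) (fun t => (eps i t, eps j t)) 0.
Hypothesis modelY : forall n, admissible Cn n -> forall i, grid 1 n i ->
  {ae P, forall t, Y i t = dot (X i t) psi + c0 + eps i t}.

Let mX i : measurable_fun setT (X i). Proof. exact: measurable_funPT. Qed.
Let meps i : measurable_fun setT (eps i). Proof. exact: measurable_funPT. Qed.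
Let mY i : measurable_fun setT (Y i). Proof. exact: measurable_funPT. Qed.

Section one_target.
Variables (V : ipType R) (z : nat -> V) (q : H1_01 R -> V).
Hypothesis cz : complete_orthonormal z.
Hypothesis mq : forall h, measurable_fun setT (fun x => dot (q x) h).
Hypothesis nq : forall x, ipnorm (q x) <= ipnorm x.

Let cut l := ball_trunc C (fun x => dot (q x) (z l)).

Let dot_bound k x : ipnorm x <= C -> `|dot (q x) k| <= C * ipnorm k.
Proof.
move=> xC; apply: (le_trans (norm_dot_le _ _)).
by rewrite ler_wpM2r ?ipnorm_ge0// (le_trans (nq _)).
Qed.

Let bmeas_cut l : bmeas (cut l).
Proof. by apply: bmeas_ball_trunc => //; eexists => x; exact: dot_bound. Qed.

Let bessel_ball M x : ipnorm x <= C -> \sum_(l < M) dot (q x) (z l) ^+ 2 <= C ^+ 2.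
Proof.
move=> xC; apply: (le_trans (bessel cz M (q x))); rewrite -ipnorm_sqr.
by rewrite lerXn2r ?nnegrE ?ipnorm_ge0 ?(ltW C0)// (le_trans (nq _)).
Qed.

Let sum_cut_sqr M x : \sum_(l < M) cut l x ^+ 2 <= C ^+ 2.
Proof.
by apply: (sum_ball_trunc_sqr (f := fun (l : 'I_M) x => dot (q x) (z l))) => y;
  exact: bessel_ball.
Qed.

Let sum_cut_mul M x y : \sum_(l < M) cut l x * cut l y <= C ^+ 2.
Proof.
apply: (le_trans (sum_mul_le_sqrt (fun l : 'I_M => cut l x) (fun l => cut l y))).
have h x' : Num.sqrt (\sum_(l < M) cut l x' ^+ 2) <= C.
  by rewrite -[leRHS](ger0_norm (ltW C0)) -sqrtr_sqr ler_wsqrtr.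
by rewrite expr2; apply: ler_pM; rewrite ?sqrtr_ge0.
Qed.

(** The regressors being independent of the noise, the products [eps * X] keep
    the covariance decay of the noise itself. *)
Lemma noise_second_moment n (s : seq (site d)) M (W : R) : admissible Cn n ->
  {in s, forall i, grid 1 n i} -> (0 < size s)%N ->
  \sum_(i <- s) \sum_(j <- s) weight R i j <= (size s)%:R * W ->
  (\sum_(l < M) \int[P]_t
     (((size s)%:R^-1 * \sum_(i <- s) eps i t * dot (q (X i t)) (z l)) ^+ 2)%:E
   <= (C ^+ 2 * Ke * W / (size s)%:R)%:E)%E.
Proof.
move=> an sg s0 sW; set v := (size s)%:R.
have v0 : 0 < v :> R by rewrite ltr0n.
pose F l i j t := (cut l (X i t) * cut l (X j t)) * (eps i t * eps j t).
have bcc l i j : bmeas (fun t => cut l (X i t) * cut l (X j t)).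
  by apply: bmeasM; exact: (bmeas_comp (mX _) (bmeas_cut l)).
have iF l i j : i \in s -> j \in s -> P.-integrable setT (EFin \o F l i j).
  by move=> si sj; apply: integrable_mul_bounded => //; apply: ieps an _ _ _ _; exact: sg.
have EF l i j : i \in s -> j \in s ->
    Ex P (F l i j) = Ex P (fun t => cut l (X i t) * cut l (X j t)) *
                     Ex P (fun t => eps i t * eps j t).
  move=> si sj.
  apply: (@indep_Ex_mul _ _ _ P _ _ _ _ (fun t => (X i t, X j t))
    (fun t => (eps i t, eps j t)) (fun x => cut l x.1 * cut l x.2) (fun e => e.1 * e.2)).
  - exact: measurable_fun_pair.
  - exact: measurable_fun_pair.
  - by apply: indXeps an _ _ _ _; exact: sg.
  - by apply: bmeasM; [exact: (bmeas_comp measurable_fst (bmeas_cut l))|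
      exact: (bmeas_comp measurable_snd (bmeas_cut l))].
  - by apply: measurable_funM.
  - by apply: ieps an _ _ _ _; exact: sg.
have XCs : {ae P, forall t, {in s, forall i, ipnorm (X i t) <= C}}.
  by apply: ae_forall_in => i si; exact: XC an _ (sg i si).
have int_eq l : (\int[P]_t ((v^-1 * \sum_(i <- s) eps i t * dot (q (X i t)) (z l)) ^+ 2)%:E
    = (v^-1 ^+ 2 * \sum_(i <- s) \sum_(j <- s) Ex P (F l i j))%:E)%E.
  have iFs i : i \in s -> P.-integrable setT (EFin \o (fun t => \sum_(j <- s) F l i j t)) /\
      Ex P (fun t => \sum_(j <- s) F l i j t) = \sum_(j <- s) Ex P (F l i j).
    by move=> si; apply: Ex_sum_in => j; exact: iF.
  have [iFF EFF] := Ex_sum_in (fun i si => (iFs i si).1).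
  have -> : \sum_(i <- s) \sum_(j <- s) Ex P (F l i j) =
      Ex P (fun t => \sum_(i <- s) \sum_(j <- s) F l i j t).
    by rewrite EFF big_seq [RHS]big_seq; apply: eq_bigr => i si; rewrite (iFs i si).2.
  rewrite -ExZ// /Ex /Rintegral fineK; last first.
    apply: integrable_fin_num => //.
    by apply: integrable_mul_bounded => //; exact: bmeas_cst.
  apply: ae_eq_integral => //.
  - apply/measurable_EFinP; apply: measurable_funX; apply: measurable_funM => //.
    apply: measurable_sum => i; apply: measurable_funM => //.
    exact: (measurableT_comp (mq (z l)) (mX i)).
  - apply/measurable_EFinP; apply: measurable_funM => //.
    by apply/measurable_EFinP; exact: measurable_int iFF.
  - apply: filterS XCs => t Xt _; congr EFin; rewrite exprMn; congr (_ * _).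
    rewrite expr2 mulr_suml big_seq [RHS]big_seq; apply: eq_bigr => i si.
    rewrite mulr_sumr big_seq [RHS]big_seq; apply: eq_bigr => j sj.
    by rewrite /F /cut !ball_trunc_in ?Xt//; ring.
under eq_bigr do rewrite int_eq.
rewrite sumEFin lee_fin -mulr_sumr.
apply: (@le_trans _ _ (v^-1 ^+ 2 * (C ^+ 2 * Ke * (v * W)))); last first.
  by rewrite le_eqVlt; apply/orP; left; apply/eqP; field; rewrite gt_eqF.
rewrite ler_wpM2l ?sqr_ge0//.
apply: (@le_trans _ _ (C ^+ 2 * Ke * \sum_(i <- s) \sum_(j <- s) weight R i j)); last first.
  by rewrite ler_wpM2l// mulr_ge0// sqr_ge0.
rewrite exchange_big/= mulr_sumr big_seq [leRHS]big_seq; apply: ler_sum => i si.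
rewrite exchange_big/= mulr_sumr big_seq [leRHS]big_seq; apply: ler_sum => j sj.
under eq_bigr do rewrite EF//.
rewrite -mulr_suml -mulrA; have /andP[e0 eK] := epsK an (sg i si) (sg j sj).
apply: (@le_trans _ _ (C ^+ 2 * Ex P (fun t => eps i t * eps j t))).
  rewrite ler_wpM2r// -Ex_sum; last by move=> l; exact: bmeas_integrable.
  rewrite -[leRHS](Ex_cst P); apply: le_Ex.
  - by apply: bmeas_integrable; apply: bmeas_sum.
  - by apply: bmeas_integrable; exact: bmeas_cst.
  - by move=> t; exact: sum_cut_mul.
by rewrite ler_wpM2l ?sqr_ge0.
Qed.

(** [avg1] leaves out the sites with a coordinate equal to 1, but each side of
    the grid keeps at least half of its length. *)
Let cutoff_loss (n : 'I_d -> nat) : (forall k, (2 <= n k)%N) ->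
  (vol1 n)%:R^-1 <= 2 ^+ d * (vol n)%:R^-1 :> R.
Proof.
move=> n2.
have v0 : (0 < vol n)%N by apply: vol_gt0 => k; apply: leq_trans (n2 k).
have v10 : (0 < vol1 n)%N by apply: prodn_gt0 => k; rewrite subn_gt0.
rewrite -[leLHS]mul1r ler_pdivrMr ?ltr0n// mulrAC ler_pdivlMr ?ltr0n// mul1r.
rewrite -natrX -natrM ler_nat /vol /vol1 -[X in (X ^ _)%N]/2%N.
rewrite -[X in (_ ^ X)%N](card_ord d) -prod_nat_const -big_split/=.
by apply: leq_prod => k _; have := n2 k; lia.
Qed.

(** The summand [Y i *: q (X i)] splits into [(dot (X i) psi + c0) *: q (X i)], a
    bounded function of the regressor treated by mixing, and [eps i *: q (X i)],
    treated by [noise_second_moment]. *)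
Lemma vec_rates_product (Del : V) :
  (forall n, admissible Cn n -> forall i, grid 1 n i -> forall k,
    Ex P (fun t => (dot (X i t) psi + c0) * dot (q (X i t)) k) = dot Del k) ->
  vec_rates P Cn (fun n t => avg1 n (fun i => Y i t *: q (X i t))) Del.
Proof.
move=> hDel.
pose b k x := (dot x psi + c0) * dot (q x) k.
have mb k : measurable_fun setT (b k).
  apply: measurable_funM; last exact: mq.
  by apply: measurable_funD => //; exact: measurable_dot.
pose B := C * ipnorm psi + `|c0| + 1.
have B0 : 0 < B by rewrite ltr_wpDl// addr_ge0// mulr_ge0 ?ipnorm_ge0// ltW.
have lB x : ipnorm x <= C -> `|dot x psi + c0| <= B.
  move=> xC; apply: (le_trans (ler_normD _ _)).
  apply: (@le_trans _ _ (C * ipnorm psi + `|c0|)); last by rewrite /B lerDl.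
  by rewrite lerD2r (le_trans (norm_dot_le _ _))// ler_wpM2r ?ipnorm_ge0.
have bC k x : ipnorm x <= C -> `|b k x| <= B * (C * ipnorm k).
  by move=> xC; rewrite normrM; apply: ler_pM => //; [exact: lB|exact: dot_bound].
pose K1 := (B * C) ^+ 2 * 32 * Ka * 3 ^+ d; pose K2 := C ^+ 2 * Ke * 3 ^+ d.
have K10 : 0 <= K1 by rewrite /K1 mulr_ge0 ?exprn_ge0// mulr_ge0// mulr_ge0 ?sqr_ge0.
have K20 : 0 <= K2 by rewrite /K2 mulr_ge0 ?exprn_ge0// mulr_ge0 ?sqr_ge0.
have K120 : 0 <= 2 * K1 + 2 * K2 by apply: addr_ge0; apply: mulr_ge0.
apply: (@rates_of_second_moment _ _ _ _ _ d0 _ _ _ ((2 * K1 + 2 * K2) * 2 ^+ d)).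
  by rewrite mulr_ge0 ?exprn_ge0.
move=> n an n2.
pose s := grid_seq 2 n.
have sgrid : {in s, forall i, grid 1 n i} by move=> i; exact: sub_grid_seq.
have s0 : (0 < size s)%N.
  by rewrite size_grid_seq2; apply: prodn_gt0 => k; rewrite subn_gt0.
set v := (size s)%:R : R; have v0 : 0 < v by rewrite ltr0n.
pose x t := avg1 n (fun i => Y i t *: q (X i t)) - Del.
have dotx t k : dot (x t) k =
    v^-1 * (\sum_(i <- s) Y i t * dot (q (X i t)) k) - dot Del k.
  rewrite dotBl avg1E dotZl dot_suml -size_grid_seq2.
  by congr (_ * _ - _); apply: eq_bigr => i _; rewrite dotZl.
have mx : wmeas x.
  move=> k; under eq_fun do rewrite dotx.
  apply: measurable_funB => //; apply: measurable_funM => //.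
  apply: measurable_sum => i; apply: measurable_funM => //.
  exact: (measurableT_comp (mq k) (mX i)).
have Ys : {ae P, forall t, {in s, forall i, Y i t = dot (X i t) psi + c0 + eps i t}}.
  by apply: ae_forall_in => i si; exact: modelY an _ (sgrid i si).
pose f1 l t := v^-1 * \sum_(i <- s) (b (z l) (X i t) - dot Del (z l)).
pose f2 l t := v^-1 * \sum_(i <- s) eps i t * dot (q (X i t)) (z l).
have mf1 l : measurable_fun setT (f1 l).
  apply: measurable_funM => //; apply: measurable_sum => i.
  by apply: measurable_funB => //; exact: (measurableT_comp (mb (z l)) (mX i)).
have mf2 l : measurable_fun setT (f2 l).
  apply: measurable_funM => //; apply: measurable_sum => i.
  by apply: measurable_funM => //; exact: (measurableT_comp (mq (z l)) (mX i)).
have mf12 l : measurable_fun setT (fun t => (f1 l t ^+ 2)%:E).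
  by apply/measurable_EFinP; exact: measurable_funX.
have mf22 l : measurable_fun setT (fun t => (f2 l t ^+ 2)%:E).
  by apply/measurable_EFinP; exact: measurable_funX.
have split_sqr l : (\int[P]_t (dot (x t) (z l) ^+ 2)%:E <=
    2%:E * \int[P]_t (f1 l t ^+ 2)%:E + 2%:E * \int[P]_t (f2 l t ^+ 2)%:E)%E.
  rewrite -!ge0_integralZl ?lee_fin//; try by move=> t _; rewrite lee_fin sqr_ge0.
  rewrite -ge0_integralD//; last 4 first.
  - by move=> t _; rewrite -EFinM lee_fin mulr_ge0 ?sqr_ge0.
  - by apply: measurable_funeM.
  - by move=> t _; rewrite -EFinM lee_fin mulr_ge0 ?sqr_ge0.
  - by apply: measurable_funeM.
  apply: ae_ge0_le_integral => //.
  - by move=> t _; rewrite lee_fin sqr_ge0.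
  - by apply/measurable_EFinP; apply: measurable_funX; exact: mx.
  - move=> t _; rewrite -!EFinM -EFinD lee_fin.
    by apply: addr_ge0; apply: mulr_ge0; rewrite ?sqr_ge0.
  - by apply: emeasurable_funD; exact: measurable_funeM.
  apply: filterS Ys => t Yt _; rewrite -!EFinM -EFinD lee_fin.
  have -> : dot (x t) (z l) = f1 l t + f2 l t.
    rewrite /f1 avg_sub_const// dotx addrAC; congr (_ - _).
    rewrite /f2 -mulrDr -big_split/=; congr (_ * _).
    by rewrite big_seq [RHS]big_seq; apply: eq_bigr => i si; rewrite Yt// mulrDl.
  rewrite -subr_ge0 (_ : _ - _ = (f1 l t - f2 l t) ^+ 2) ?sqr_ge0//; ring.
have h1 M : (\sum_(l <- iota 0 M) \int[P]_t (f1 l t ^+ 2)%:E <= (K1 / v)%:E)%E.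
  apply: (@avg_second_moment _ _ _ P _ X C Ka Ka0 mixX s _ _
    (fun l => b (z l)) (fun l => dot Del (z l)) (B * C) (3 ^+ d)).
  + by move=> i si; exact: (XC an (sgrid _ si)).
  + exact: mulr_gt0.
  + by move=> l; exact: mb.
  + by move=> l; eexists => y; exact: bC.
  + move=> y yC; rewrite big_iota_ord; under eq_bigr do rewrite exprMn.
    rewrite -mulr_sumr exprMn; apply: ler_pM; rewrite ?sqr_ge0//.
    * by apply: sumr_ge0 => l _; exact: sqr_ge0.
    * by rewrite -[leLHS]real_normK ?num_real// lerXn2r ?nnegrE ?(ltW B0)// lB.
    * exact: bessel_ball.
  + by move=> i si l; exact: (hDel n an i (sgrid _ si)).
  + by [].
  + exact: sum_weight_grid2.
have h2 M : (\sum_(l < M) \int[P]_t (f2 l t ^+ 2)%:E <= (K2 / v)%:E)%E.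
  by apply: (noise_second_moment M (W := 3 ^+ d) an sgrid s0); exact: sum_weight_grid2.
exists (fun t => (dot (x t) (x t))%:E); split.
- by apply/measurable_EFinP; exact: (measurable_dot_self cz mx).
- by move=> t; rewrite lee_fin dot_ge0.
- by [].
- move=> tau tau0; split.
    have := measurable_ipnorm cz mx measurableT (measurable_itv `]tau, +oo[).
    by rewrite setTI; congr measurable; apply/seteqP; split=> t /=;
      rewrite in_itv/= andbT lte_fin.
  move=> t; rewrite lte_fin => /ltW h; rewrite lee_fin -ipnorm_sqr.
  by rewrite lerXn2r ?nnegrE ?ipnorm_ge0 ?(ltW tau0).
- rewrite (integral_dot_self P cz mx).
  apply: (@le_trans _ _ ((2 * K1 + 2 * K2) / v)%:E); last first.
    rewrite lee_fin -[leRHS]mulrA ler_wpM2l//.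
    by rewrite /v /s size_grid_seq2 cutoff_loss.
  apply: nneseries_le_bound => [l|M].
    by apply: integral_ge0 => t _; rewrite lee_fin sqr_ge0.
  apply: (le_trans (lee_sum _ (fun (l : 'I_M) _ => split_sqr l))).
  rewrite big_split/= -!ge0_sume_distrr; last 2 first.
  + by move=> l _; apply: integral_ge0 => t _; rewrite lee_fin sqr_ge0.
  + by move=> l _; apply: integral_ge0 => t _; rewrite lee_fin sqr_ge0.
  have -> : (2 * K1 + 2 * K2) / v = 2 * (K1 / v) + 2 * (K2 / v).
    by rewrite mulrDl -[2 * K1 / v]mulrA -[2 * K2 / v]mulrA.
  rewrite [X in (_ <= X)%E]EFinD; apply: leeD;
    rewrite [X in (_ <= X)%E]EFinM lee_pmul2l//; last exact: h2.
  by have := h1 M; rewrite big_iota_ord.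
Qed.

End one_target.
End vector_rates.

(** * Consequences of the model *)

Lemma dist_unit_interval (R : realType) (x y : R) :
  0 <= x -> x <= 1 -> 0 <= y -> y <= 1 -> `|x - y| <= 1.
Proof. by move=> *; rewrite ler_norml; apply/andP; split; lra. Qed.

Section from_the_model.
Context (dT : measure_display) (T : measurableType dT) (R : realType).
Variable P : probability T R.

Lemma Ex_same_distribution dS (S : measurableType dS) (Z1 Z2 : T -> S) (f : S -> R) :
  measurable_fun setT Z1 -> measurable_fun setT Z2 -> same_distribution P Z1 Z2 ->
  measurable_fun setT f -> Ex P (f \o Z1) = Ex P (f \o Z2).
Proof.
move=> m1 m2 eqZ mf; congr fine.
have mE : measurable_fun setT (EFin \o f) by exact/measurable_EFinP.
have pos (h : S -> \bar R) : measurable_fun setT h -> (forall x, 0 <= h x)%E ->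
    (\int[P]_t h (Z1 t) = \int[P]_t h (Z2 t))%E.
  move=> mh h0.
  have := @ge0_integral_pushforward _ _ _ _ R _ m1 P setT h measurableT mh (fun x _ => h0 x).
  have := @ge0_integral_pushforward _ _ _ _ R _ m2 P setT h measurableT mh (fun x _ => h0 x).
  rewrite !preimage_setT => <- <-; apply: eq_measure_integral => A mA _.
  exact: eqZ.
rewrite [LHS]integralE [RHS]integralE; congr (_ - _)%E.
  rewrite (funepos_comp (EFin \o f) Z1) (funepos_comp (EFin \o f) Z2).
  exact: (pos _ (measurable_funepos mE) (funepos_ge0 (EFin \o f))).
rewrite (funeneg_comp (EFin \o f) Z1) (funeneg_comp (EFin \o f) Z2).
exact: (pos _ (measurable_funeneg mE) (funeneg_ge0 (EFin \o f))).
Qed.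

Lemma Ex_expectation (F : T -> R) : Ex P F = fine 'E_P[F]%E.
Proof. by rewrite unlock. Qed.

Lemma Ex_is_mean (V : ipType R) (F : T -> V) m h : is_mean P F m ->
  Ex P (fun t => dot (F t) h) = dot m h.
Proof. by move=> Fm; have [_ e] := Fm h; rewrite Ex_expectation e. Qed.

Variable d : nat.
Variables (X : site d -> {RV P >-> H1_01 R}) (Y eps : site d -> {RV P >-> R}).

Lemma same_distribution_pair (X0 : T -> H1_01 R) (Y0 : T -> R) i :
  same_distribution P (fun t => triplet (X i t) (Y i t))
                      (fun t => triplet (X0 t) (Y0 t)) ->
  same_distribution P (fun t => (X i t, Y i t)) (fun t => (X0 t, Y0 t)).
Proof.
move=> XY A mA.
by have := XY (A `*` setT) (measurableX mA measurableT); rewrite /preimage/=;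
  congr (P _ = P _); apply/seteqP; split=> t //= [].
Qed.

(** The term [+ 1] accounts for a site paired with itself, where only the trivial
    bound 1 is available. *)
Lemma mixing_of_alpha (theta K : R) : (2 * d)%:R < theta ->
  (forall m, (0 < m)%N ->
    (alpha_mix P (fun i t => triplet (X i t) (Y i t)) m <= (K * m%:R `^ (- theta))%:E)%E) ->
  forall i j, mixing_le P (X i) (X j) ((`|K| * 2 ^+ (2 * d) + 1) * weight R i j).
Proof.
move=> th hK i j A B mA mB.
have mX k D : measurable D -> measurable (X k @^-1` D).
  by move=> mD; rewrite -[X in measurable X]setTI; exact: measurable_funPT.
have fA := fin_num_measure P _ (mX i A mA).
have fB := fin_num_measure P _ (mX j B mB).
have fAB := fin_num_measure P _ (measurableI _ _ (mX i A mA) (mX j B mB)).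
have w0 := weight_ge0 R i j.
have [m0|m0] := posnP (site_dist i j).
  have w1 : 1 <= weight R i j.
    by apply: le_trans (weight_lb R i j); rewrite m0 expr1n invr1.
  apply: (@le_trans _ _ 1).
    have p01 D : measurable D -> 0 <= fine (P D) <= 1.
      move=> mD; rewrite fine_ge0 ?measure_ge0//=.
      by rewrite -lee_fin fineK ?fin_num_measure// probability_le1.
    have /andP[a0 a1] := p01 _ (mX i A mA).
    have /andP[b0 b1] := p01 _ (mX j B mB).
    have /andP[c0 c1] := p01 _ (measurableI _ _ (mX i A mA) (mX j B mB)).
    have ab0 := mulr_ge0 a0 b0; have ab1 := mulr_ile1 a0 b0 a1 b1.
    exact: dist_unit_interval.
  by rewrite -[leLHS]mulr1 ler_pM// lerDr mulr_ge0// exprn_ge0.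
apply: (@le_trans _ _ (`|K| * 2 ^+ (2 * d) * weight R i j)); last first.
  by rewrite ler_wpM2r// lerDl.
apply: le_trans (power_decay_weight K th m0).
rewrite -lee_fin; apply: le_trans (hK _ m0).
apply: ereal_sup_ubound; exists i, [set j], (X i @^-1` A), (X j @^-1` B); split.
- by move=> _ ->.
- exists (A `*` setT `*` setT); first by apply: measurableX => //; exact: measurableX.
  by rewrite setTI; apply/seteqP; split=> t //= [[]].
- apply: sub_sigma_algebra; exists j => //.
  exists (B `*` setT `*` setT); first by apply: measurableX => //; exact: measurableX.
  by rewrite setTI; apply/seteqP; split=> t //= [[]].
- by rewrite -[in RHS](fineK fA) -[in RHS](fineK fB) -[in RHS](fineK fAB).
Qed.

Lemma mixing_of_indep (D : set (site d)) i j : D i -> D j ->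
  indep_sigma P (sigma_family (fun i t => (X i t, H1_deriv (X i t))) D)
                (sigma_family eps D) ->
  mixing_le P (fun t => (X i t, X j t)) (fun t => (eps i t, eps j t)) 0.
Proof.
move=> Di Dj ind A B mA mB.
have FA : sigma_family (fun i t => (X i t, H1_deriv (X i t))) D
    ((fun t => (X i t, X j t)) @^-1` A).
  pose gens := \bigcup_(k in D) g_sigma_algebra_preimage
    (fun t => (X k t, H1_deriv (X k t))).
  have mk k : D k -> @measurable_fun _ _ (g_sigma_algebraType gens) (H1_01 R) setT (X k).
    move=> Dk _ B' mB'; apply: sub_sigma_algebra; exists k => //.
    exists (B' `*` setT); first exact: measurableX.
    by rewrite setTI; apply/seteqP; split=> t //= [].
  have mp : @measurable_fun _ _ (g_sigma_algebraType gens) (H1_01 R * H1_01 R)%type setT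
    (fun t => (X i t, X j t)) by apply: measurable_fun_pair; exact: mk.
  by have := mp measurableT A mA; rewrite setTI.
have GB : sigma_family eps D ((fun t => (eps i t, eps j t)) @^-1` B).
  pose gens := \bigcup_(k in D) g_sigma_algebra_preimage (eps k).
  have mk k : D k -> @measurable_fun _ _ (g_sigma_algebraType gens) R setT (eps k).
    move=> Dk _ B' mB'; apply: sub_sigma_algebra; exists k => //.
    by exists B'.
  have mp : @measurable_fun _ _ (g_sigma_algebraType gens) (R * R)%type setT
    (fun t => (eps i t, eps j t)) by apply: measurable_fun_pair; exact: mk.
  by have := mp measurableT B mB; rewrite setTI.
by rewrite (ind _ _ FA GB) fineM ?subrr ?normr0//; apply: fin_num_measure;
  rewrite -[X in measurable X]setTI; apply: measurable_fun_pair => //; exact: measurable_funPT.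
Qed.

Section noise.
Variables (n : 'I_d -> nat) (sigma2 a : R).
Hypothesis centered : forall i, grid 1 n i -> 'E_P[eps i]%E = 0%E.
Hypothesis hcov : forall i j, grid 1 n i -> grid 1 n j ->
  covariance P (eps i) (eps j) = (sigma2 * expR (- (a * (site_dist i j)%:R)))%:E.

Let meps i : measurable_fun setT (eps i). Proof. exact: measurable_funPT. Qed.

Let covE i j : grid 1 n i -> grid 1 n j ->
  (\int[P]_t (eps i t * eps j t)%:E = (sigma2 * expR (- (a * (site_dist i j)%:R)))%:E)%E.
Proof.
move=> gi gj; rewrite -hcov// unlock !centered// unlock.
apply: eq_integral => t _; congr EFin.
by rewrite -[RHS]/((eps i t - 0) * (eps j t - 0)) !subr0.
Qed.

(** The covariances being finite numbers, the diagonal one makes the noise square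
    integrable. *)
Lemma integrable_eps_sqr i : grid 1 n i ->
  P.-integrable setT (EFin \o (fun t => eps i t * eps i t)).
Proof.
move=> gi; apply/integrableP; split.
  by apply/measurable_EFinP; exact: measurable_funM.
under eq_integral do rewrite gee0_abs ?lee_fin -?expr2 ?sqr_ge0//.
by rewrite -[X in (X < _)%E]/(\int[P]_t (eps i t * eps i t)%:E)%E covE// ltry.
Qed.

Lemma integrable_eps_mul i j : grid 1 n i -> grid 1 n j ->
  P.-integrable setT (EFin \o (fun t => eps i t * eps j t)).
Proof.
move=> gi gj.
have := integrableD measurableT (integrable_eps_sqr gi) (integrable_eps_sqr gj).
apply: le_integrable => //.
  by apply/measurable_EFinP; exact: measurable_funM.
move=> t _ /=; rewrite lee_fin [leRHS]ger0_norm; last first.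
  by rewrite addr_ge0// -expr2 sqr_ge0.
rewrite normrM -subr_ge0 -[eps i t * eps i t]expr2 -[eps j t * eps j t]expr2.
rewrite -[eps i t ^+ 2]real_normK ?num_real// -[eps j t ^+ 2]real_normK ?num_real//.
move: `|eps i t| `|eps j t| => x y.
rewrite (_ : _ - _ = 2^-1 * (x ^+ 2 + y ^+ 2 + (x - y) ^+ 2)); last by field.
by rewrite mulr_ge0// !addr_ge0// sqr_ge0.
Qed.

Lemma integrable_eps i : grid 1 n i -> P.-integrable setT (EFin \o eps i).
Proof.
move=> gi; have := integrableD measurableT (integrable_eps_sqr gi)
  (bmeas_integrable P (bmeas_cst T (1 : R))).
apply: le_integrable => //; first exact/measurable_EFinP.
move=> t _ /=; rewrite lee_fin [leRHS]ger0_norm; last first.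
  by rewrite addr_ge0// -expr2 sqr_ge0.
rewrite -subr_ge0 -[eps i t * eps i t]expr2 -[eps i t ^+ 2]real_normK ?num_real//.
move: `|eps i t| => x.
rewrite (_ : _ - _ = 2^-1 * (x ^+ 2 + 1 + (x - 1) ^+ 2)); last by field.
by rewrite mulr_ge0// !addr_ge0// sqr_ge0.
Qed.

Lemma Ex_eps_mul i j : grid 1 n i -> grid 1 n j ->
  Ex P (fun t => eps i t * eps j t) = sigma2 * expR (- (a * (site_dist i j)%:R)).
Proof. by move=> gi gj; rewrite /Ex /Rintegral covE. Qed.

Lemma Ex_eps i : grid 1 n i -> Ex P (eps i) = 0.
Proof. by move=> gi; rewrite Ex_expectation centered. Qed.

Lemma Ex_eps_mul_bounded C i (f : H1_01 R -> R) : grid 1 n i ->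
  {ae P, forall t, ipnorm (X i t) <= C} ->
  mixing_le P (fun t => (X i t, X i t)) (fun t => (eps i t, eps i t)) 0 ->
  measurable_fun setT f -> (exists M, forall x, ipnorm x <= C -> `|f x| <= M) ->
  P.-integrable setT (EFin \o (fun t => f (X i t) * eps i t)) /\
  Ex P (fun t => f (X i t) * eps i t) = 0.
Proof.
move=> gi XC ind mf [M fM].
pose f' := ball_trunc C f.
have bf' : bmeas f' by apply: bmeas_ball_trunc => //; exists M.
have mXi : measurable_fun setT (X i) by exact: measurable_funPT.
have ff' : {ae P, forall t, f (X i t) * eps i t = f' (X i t) * eps i t}.
  by apply: filterS XC => t Xt; rewrite /f' ball_trunc_in.
have mfe : measurable_fun setT (fun t => f (X i t) * eps i t).
  by apply: measurable_funM => //; exact: measurableT_comp.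
have bf'X : bmeas (f' \o X i) by exact: bmeas_comp.
have if'e := integrable_mul_bounded bf'X (integrable_eps gi).
split; first by apply: (ae_eq_integrable mfe _ ff'); exact: if'e.
rewrite (@ae_eq_Ex _ _ _ P _ (fun t => f' (X i t) * eps i t))//; last first.
  by apply/measurable_EFinP; exact: measurable_int if'e.
rewrite (@indep_Ex_mul _ _ _ P _ _ _ _ (fun t => (X i t, X i t))
    (fun t => (eps i t, eps i t)) (fun x => f' x.1) (fun e => e.1)).
- by rewrite -[X in _ * Ex P X]/(eps i : T -> R) Ex_eps// mulr0.
- exact: measurable_fun_pair.
- exact: measurable_fun_pair.
- exact: ind.
- exact: (bmeas_comp measurable_fst bf').
- exact: measurable_fst.
- exact: integrable_eps.
Qed.

End noise.
End from_the_model.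

(** * Rates for the six estimators *)

Theorem theorem1
  (R : realType) (dT : measure_display) (T : measurableType dT)
  (P : probability T R) (d : nat) (hd : (2 <= d)%N)
  (Cn : R) (hCn : 0 < Cn)
  (* the model *)
  (X : site d -> {RV P >-> H1_01 R}) (Y eps : site d -> {RV P >-> R})
  (X0 : {RV P >-> H1_01 R}) (Y0 : {RV P >-> R})
  (phi : H1_01 R) (gamma : L2_01 R) (r : ('I_d -> R) -> R)
  (a sigma2 : R) (ha : 0 < a) (hsigma2 : 0 < sigma2)
  (hmodel : forall n, admissible Cn n -> forall i, grid 1 n i ->
    {ae P, forall t, Y i t = dot phi (X i t) + dot gamma (H1_deriv (X i t)) +
      r (fun k => (i k)%:~R / (n k).+1%:R) + eps i t})
  (hcenteredX : forall n, admissible Cn n -> forall i, grid 1 n i ->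
    is_mean P (X i) 0 /\ is_mean P (fun t => H1_deriv (X i t)) 0)
  (hcentered_eps : forall n, admissible Cn n -> forall i, grid 1 n i ->
    'E_P[eps i]%E = 0%E)
  (hindep : forall n, admissible Cn n -> indep_sigma P
    (sigma_family (fun i t => (X i t, H1_deriv (X i t))) (grid 1 n))
    (sigma_family eps (grid 1 n)))
  (hcov : forall n, admissible Cn n -> forall i j, grid 1 n i -> grid 1 n j ->
    covariance P (eps i) (eps j) =
    (sigma2 * expR (- (a * (site_dist i j)%:R)))%:E)
  (hdistr : forall n, admissible Cn n -> forall i, grid 1 n i ->
    same_distribution P (fun t => triplet (X i t) (Y i t))
                        (fun t => triplet (X0 t) (Y0 t)))
  (* the operators *)
  (Gam : H1_01 R -> H1_01 R) (Gam' : L2_01 R -> H1_01 R)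
  (Gam's : H1_01 R -> L2_01 R) (Gam'' : L2_01 R -> L2_01 R)
  (Del : H1_01 R) (Del' : L2_01 R) (Dstar : L2_01 R -> H1_01 R)
  (hGam : is_op_mean P (fun t => tensor (X0 t) (X0 t)) Gam)
  (hGam' : is_op_mean P (fun t => tensor (H1_deriv (X0 t)) (X0 t)) Gam')
  (hGam's : is_adjoint Gam' Gam's)
  (hGam'' : is_op_mean P
    (fun t => tensor (H1_deriv (X0 t)) (H1_deriv (X0 t))) Gam'')
  (hDel : is_mean P (fun t => Y0 t *: X0 t) Del)
  (hDel' : is_mean P (fun t => Y0 t *: H1_deriv (X0 t)) Del')
  (hDstar : is_adjoint (@H1_deriv R) Dstar)
  (v : nat -> H1_01 R) (hv : complete_orthonormal v)
  (vs : nat -> L2_01 R) (hvs : complete_orthonormal vs)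
  (* assumptions (1)-(5) *)
  (h1 : (forall x, Gam x = 0 -> x = 0) /\ (forall x, Gam'' x = 0 -> x = 0))
  (h2 : ~ [set fg : H1_01 R * L2_01 R | fg.1 + Dstar fg.2 = 0] (phi, gamma))
  (h3 : (norm_inv_sqrt Gam phi < +oo)%E /\ (norm_inv_sqrt Gam'' gamma < +oo)%E)
  (theta : R) (htheta : (2 * d)%:R < theta)
  (h4 : let Z := fun i t => triplet (X i t) (Y i t) in
    alpha_mix P Z m @[m --> \oo] --> 0%E /\
    exists K : R, forall m : nat, (0 < m)%N ->
      (alpha_mix P Z m <= (K * m%:R `^ (- theta))%:E)%E)
  (h5 : exists2 C : R, 0 < C & forall n, admissible Cn n ->
    forall i, grid 1 n i -> {ae P, forall t, ipnorm (X i t) <= C}) :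
  (geometric_decay Gam ->
     op_rates P Cn v
       (fun n t h => avg n (fun i => tensor (X i t) (X i t) h)) Gam) /\
  (geometric_decay Gam' ->
     op_rates P Cn vs
       (fun n t h => avg n (fun i => tensor (H1_deriv (X i t)) (X i t) h)) Gam') /\
  (geometric_decay Gam's ->
     op_rates P Cn v
       (fun n t h => avg n (fun i => tensor (X i t) (H1_deriv (X i t)) h)) Gam's) /\
  (geometric_decay Gam'' ->
     op_rates P Cn vs
       (fun n t h =>
          avg n (fun i => tensor (H1_deriv (X i t)) (H1_deriv (X i t)) h)) Gam'') /\
  (geometric_decay (fun c : R^o => c *: Del) ->
     vec_rates P Cn (fun n t => avg1 n (fun i => Y i t *: X i t)) Del) /\
  (geometric_decay (fun c : R^o => c *: Del') ->
     vec_rates P Cn (fun n t => avg1 n (fun i => Y i t *: H1_deriv (X i t))) Del').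
Proof.
have d0 : (0 < d)%N by exact: leq_trans hd.
have [C C0 XC] := h5.
have [_ [K hK]] := h4.
set Ka := `|K| * 2 ^+ (2 * d) + 1.
have Ka0 : 0 <= Ka by rewrite addr_ge0// mulr_ge0// exprn_ge0.
have mixX := mixing_of_alpha htheta hK : forall i j, mixing_le P (X i) (X j) (Ka * weight R i j).
have dotDs x h : dot (H1_deriv x) h = dot x (Dstar h) by exact: hDstar.
have mH h : measurable_fun setT (fun x : H1_01 R => dot x h) by exact: measurable_dot.
have mG h : measurable_fun setT (fun x : H1_01 R => dot (H1_deriv x) h).
  by under eq_fun do rewrite dotDs; exact: mH.
have nH (x : H1_01 R) : ipnorm x <= ipnorm x by [].
have nG := @ipnorm_H1_deriv R.
have mXY i : measurable_fun setT (fun t => (X i t, Y i t)).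
  by apply: measurable_fun_pair; exact: measurable_funPT.
have mXY0 : measurable_fun setT (fun t => (X0 t, Y0 t)).
  by apply: measurable_fun_pair; exact: measurable_funPT.
have law n : admissible Cn n -> forall i, grid 1 n i ->
    forall f : H1_01 R * R -> R, measurable_fun setT f ->
    Ex P (fun t => f (X i t, Y i t)) = Ex P (fun t => f (X0 t, Y0 t)).
  move=> an i gi f mf; apply: (Ex_same_distribution (mXY i) mXY0 _ mf).
  exact: same_distribution_pair (hdistr n an i gi).
have lawX n : admissible Cn n -> forall i, grid 1 n i ->
    forall f : H1_01 R -> R, measurable_fun setT f ->
    Ex P (fun t => f (X i t)) = Ex P (fun t => f (X0 t)).
  move=> an i gi f mf; apply: (law n an i gi (f \o fst)).
  exact: (measurableT_comp mf measurable_fst).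
have oprates := op_rates_tensor d0 C0 Ka0 mixX XC.
have mean_tensor (U V : ipType R) (p : H1_01 R -> U) (q : H1_01 R -> V) (L : U -> V) :
    (forall h, measurable_fun setT (fun x => dot (p x) h)) ->
    (forall h, measurable_fun setT (fun x => dot (q x) h)) ->
    is_op_mean P (fun t => tensor (p (X0 t)) (q (X0 t))) L ->
    forall n, admissible Cn n -> forall i, grid 1 n i -> forall h k,
    Ex P (fun t => dot (p (X i t)) h * dot (q (X i t)) k) = dot (L h) k.
  move=> mp mq hL n an i gi h k.
  rewrite (lawX n an i gi (fun x => dot (p x) h * dot (q x) k)); last exact: measurable_funM.
  rewrite -(Ex_is_mean k (hL h)); congr Ex; apply/funext => t.
  by rewrite /tensor dotZl.
(* E Y = r(i / (n + 1)) at every site, so identical distribution forces the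
   regression function to take a single value on all the design points *)
set c0 := Ex P Y0; set psi := phi + Dstar gamma.
have ieps n (an : admissible Cn n) := integrable_eps_mul (hcentered_eps n an) (hcov n an).
have modelY n : admissible Cn n -> forall i, grid 1 n i ->
    {ae P, forall t, Y i t = dot (X i t) psi + c0 + eps i t}.
  move=> an i gi; set rho := r (fun k => (i k)%:~R / (n k).+1%:R).
  have Yrho : {ae P, forall t, Y i t = dot (X i t) psi + rho + eps i t}.
    apply: filterS (hmodel n an i gi) => t ->; rewrite /psi dotDr -dotDs.
    by rewrite (dotC phi) (dotC gamma).
  have [Xc _] := hcenteredX n an i gi.
  have ie := integrable_eps (hcentered_eps n an) (hcov n an) gi.
  have iX : P.-integrable setT (EFin \o (fun t => dot (X i t) psi)) by have [] := Xc psi.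
  have irho : P.-integrable setT (EFin \o (fun _ : T => rho)).
    by apply: bmeas_integrable; exact: bmeas_cst.
  have iXr : P.-integrable setT (EFin \o (fun t => dot (X i t) psi + rho)).
    by have := integrableD measurableT iX irho.
  have iXre : P.-integrable setT (EFin \o (fun t => dot (X i t) psi + rho + eps i t)).
    by have := integrableD measurableT iXr ie.
  suff -> : c0 = rho by [].
  rewrite /c0 -(law n an i gi snd); last exact: measurable_snd.
  rewrite (@ae_eq_Ex _ _ _ P _ (fun t => dot (X i t) psi + rho + eps i t)).
  - rewrite ExD// ExD// Ex_cst (Ex_is_mean _ Xc) dot0l add0r.
    by rewrite (Ex_eps (hcentered_eps n an) gi) addr0.
  - exact: measurable_funPT.
  - by apply/measurable_EFinP; exact: measurable_int iXre.
  - exact: Yrho.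
have indXe n : admissible Cn n -> forall i j, grid 1 n i -> grid 1 n j ->
    mixing_le P (fun t => (X i t, X j t)) (fun t => (eps i t, eps j t)) 0.
  by move=> an i j gi gj; exact: mixing_of_indep gi gj (hindep n an).
have [Ke Ke0 expK] := exp_decay_weight d0 ha.
have epsK n : admissible Cn n -> forall i j, grid 1 n i -> grid 1 n j ->
    0 <= Ex P (fun t => eps i t * eps j t) <= sigma2 * Ke * weight R i j.
  move=> an i j gi gj; rewrite (Ex_eps_mul (hcentered_eps n an) (hcov n an) gi gj).
  rewrite mulr_ge0 ?expR_ge0 ?(ltW hsigma2)//= -mulrA ler_wpM2l ?(ltW hsigma2)//.
have sKe0 : 0 <= sigma2 * Ke by rewrite mulr_ge0// ltW.
have vecrates := @vec_rates_product _ _ _ P d Cn X Y eps C Ka (sigma2 * Ke) c0 psi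
  d0 C0 Ka0 mixX XC sKe0 ieps epsK indXe modelY.
have mean_product (V : ipType R) (q : H1_01 R -> V) (D : V) :
    (forall h, measurable_fun setT (fun x => dot (q x) h)) ->
    (forall x, ipnorm (q x) <= ipnorm x) ->
    is_mean P (fun t => Y0 t *: q (X0 t)) D ->
    forall n, admissible Cn n -> forall i, grid 1 n i -> forall k,
    Ex P (fun t => (dot (X i t) psi + c0) * dot (q (X i t)) k) = dot D k.
  move=> mq nq hD n an i gi k.
  have mb : measurable_fun setT (fun x : H1_01 R => (dot x psi + c0) * dot (q x) k).
    by apply: measurable_funM => //; apply: measurable_funD.
  have qC x : ipnorm x <= C -> `|dot (q x) k| <= C * ipnorm k.
    move=> xC; apply: (le_trans (norm_dot_le _ _)).
    by rewrite ler_wpM2r ?ipnorm_ge0// (le_trans (nq _)).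
  have ib : P.-integrable setT
      (EFin \o ((fun x : H1_01 R => (dot x psi + c0) * dot (q x) k) \o X i)).
    apply: (integrable_on_ball (XC n an i gi) mb).
    exists ((C * ipnorm psi + `|c0|) * (C * ipnorm k)) => x xC.
    rewrite normrM; apply: ler_pM => //; last exact: qC.
    apply: (le_trans (ler_normD _ _)); rewrite lerD2r.
    by apply: (le_trans (norm_dot_le _ _)); rewrite ler_wpM2r ?ipnorm_ge0.
  have [iqe Eqe] := Ex_eps_mul_bounded (hcentered_eps n an) (hcov n an) gi (XC n an i gi)
    (indXe n an i i gi gi) (mq k) (ex_intro _ _ qC).
  rewrite -(Ex_is_mean k hD).
  have -> : (fun t => dot (Y0 t *: q (X0 t)) k) =
      (fun t => (fun u : H1_01 R * R => u.2 * dot (q u.1) k) (X0 t, Y0 t)).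
    by apply/funext => t; rewrite dotZl.
  have mu : measurable_fun setT (fun u : H1_01 R * R => u.2 * dot (q u.1) k).
    by apply: measurable_funM => //; exact: (measurableT_comp (mq k) measurable_fst).
  rewrite -(law n an i gi _ mu) -[LHS]addr0 -Eqe -ExD//.
  apply: ae_eq_Ex.
  - apply: measurable_funD.
      by apply/measurable_EFinP; exact: measurable_int ib.
    by apply/measurable_EFinP; exact: measurable_int iqe.
  - exact: (measurableT_comp mu (mXY i)).
  - by apply: filterS (modelY n an i gi) => t /= ->; ring.
split=> [_|]; first by apply: (oprates _ _ v v id id) => //;
  exact: (mean_tensor _ _ id id Gam mH mH hGam).
split=> [_|]; first by apply: (oprates _ _ vs v (@H1_deriv R) id) => //;
  exact: (mean_tensor _ _ (@H1_deriv R) id Gam' mG mH hGam').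
split=> [_|].
  apply: (oprates _ _ v vs id (@H1_deriv R)) => // n an i gi h k.
  rewrite dotC -hGam's -(mean_tensor _ _ (@H1_deriv R) id Gam' mG mH hGam' n an i gi).
  by congr Ex; apply/funext => t; rewrite mulrC.
split=> [_|]; first by apply: (oprates _ _ vs vs (@H1_deriv R) (@H1_deriv R)) => //;
  exact: (mean_tensor _ _ (@H1_deriv R) (@H1_deriv R) Gam'' mG mG hGam'').
split=> _; first by apply: (vecrates _ v id) => //;
  exact: (mean_product _ id Del mH nH hDel).
by apply: (vecrates _ vs (@H1_deriv R)) => //;
  exact: (mean_product _ (@H1_deriv R) Del' mG nG hDel').
Qed.
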